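(* Let $M=(M,<,\dots)$ be an almost o-minimal structure. Then there is a proper elementary extension $M^* \succ M$ (that is, $M \prec M^*$ and $M \neq M^*$) that is still almost o-minimal.
   Context: Let $L$ be a first-order language containing a binary symbol $<$. All structures $M=(M,<,\dots)$ considered are $L$-structures expanding a (nonempty) dense linear ordering $(M,<)$ without endpoints. ''Definable'' means definable by a first-order $L$-formula with parameters from the structure. ''Interval'' means an interval with endpoints in $M\cup\{-\infty,\infty\}$. A subset of $M$ is bounded if it is contained in some interval $(a,b)$ with $a<b$ in $M$. The structure $M$ is called almost o-minimal if every bounded definable subset of $M$ can be written as a finite union of points and intervals. The notation $M\prec N$ (or $N \succ M$) means that $M$ is an elementary substructure of $N$ (in the language $L$). *)

(* Defs.v *)
From mathcomp Require Import all_boot.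
From mathcomp Require Import classical_sets.

Set Implicit Arguments.
Unset Strict Implicit.
Unset Printing Implicit Defensive.

Local Open Scope classical_set_scope.

(* Symbols are sorted by arity; [fun_symb L 0] are the constants. Equality is
   a logical symbol and is not listed among the relation symbols. *)
Record language := Language {
  fun_symb : nat -> Type;
  rel_symb : nat -> Type;
  lt_symb : rel_symb 2 }.

Record structure (L : language) := Structure {
  carrier :> Type;
  fun_interp : forall n, fun_symb L n -> n.-tuple carrier -> carrier;
  rel_interp : forall n, rel_symb L n -> n.-tuple carrier -> Prop }.

(* Variables are de Bruijn indices: [fAll] binds index 0. *)
Inductive term (L : language) :=
| tVar of nat
| tApp n of fun_symb L n & ('I_n -> term L).

Inductive formula (L : language) :=
| fFalse
| fEq of term L & term L
| fRel n of rel_symb L n & ('I_n -> term L)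
| fImp of formula L & formula L
| fAll of formula L.

Definition scons (T : Type) (x : T) (v : nat -> T) : nat -> T :=
  fun n => if n is k.+1 then v k else x.

Fixpoint eval (L : language) (M : structure L) (v : nat -> M) (t : term L) : M :=
  match t with
  | tVar k => v k
  | tApp n f ts => fun_interp f [tuple eval v (ts i) | i < n]
  end.

(* The remaining connectives and the existential quantifier are classically
   definable from those of [formula]. *)
Fixpoint sat (L : language) (M : structure L) (v : nat -> M) (phi : formula L)
    : Prop :=
  match phi with
  | fFalse => False
  | fEq t u => eval v t = eval v u
  | fRel n r ts => rel_interp r [tuple eval v (ts i) | i < n]
  | fImp p q => sat v p -> sat v q
  | fAll p => forall x : M, sat (scons x v) p
  end.

(* The variable 0 ranges over the set; the others are the parameters, of which
   only finitely many occur in [phi]. *)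
Definition definable (L : language) (M : structure L) (X : set M) : Prop :=
  exists (phi : formula L) (v : nat -> M), X = [set x | sat (scons x v) phi].

Definition elementary (L : language) (M N : structure L) (j : M -> N) : Prop :=
  forall (phi : formula L) (v : nat -> M), sat v phi <-> sat (j \o v) phi.

Definition proper_elementary_extension (L : language) (M N : structure L)
    : Prop :=
  exists j : M -> N, elementary j /\ range j <> setT.

Definition lt (L : language) (M : structure L) (x y : M) : Prop :=
  rel_interp (lt_symb L) [tuple x; y].

Record dense_linear_order_without_endpoints (L : language) (M : structure L)
    : Prop := {
  dlo_nonempty : exists x : M, True;
  dlo_irreflexive : forall x : M, ~ lt x x;
  dlo_transitive : forall x y z : M, lt x y -> lt y z -> lt x z;
  dlo_total : forall x y : M, lt x y \/ x = y \/ lt y x;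
  dlo_dense : forall x y : M, lt x y -> exists z : M, lt x z /\ lt z y;
  dlo_no_min : forall x : M, exists y : M, lt y x;
  dlo_no_max : forall x : M, exists y : M, lt x y }.

Inductive extended (T : Type) := NInfty | Fin of T | PInfty.
Arguments NInfty {T}.
Arguments PInfty {T}.

Definition ext_lt (L : language) (M : structure L) (a b : extended M) : Prop :=
  match a, b with
  | Fin x, Fin y => lt x y
  | NInfty, Fin _ | NInfty, PInfty | Fin _, PInfty => True
  | _, _ => False
  end.

Definition ext_le (L : language) (M : structure L) (a b : extended M) : Prop :=
  ext_lt a b \/ a = b.

Definition open_itv (L : language) (M : structure L) (a b : extended M)
    : set M :=
  [set x | ext_lt a (Fin x) /\ ext_lt (Fin x) b].

Definition closed_itv (L : language) (M : structure L) (a b : extended M)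
    : set M :=
  [set x | ext_le a (Fin x) /\ ext_le (Fin x) b].

(* Open, closed and half-open intervals alike: each finite endpoint may or may
   not belong to [I]. *)
Definition is_interval (L : language) (M : structure L) (I : set M) : Prop :=
  exists a b : extended M,
    [/\ ext_lt a b, open_itv a b `<=` I & I `<=` closed_itv a b].

Definition is_point (T : Type) (A : set T) : Prop := exists a : T, A = [set a].

Definition bounded (L : language) (M : structure L) (X : set M) : Prop :=
  exists a b : M, lt a b /\ X `<=` open_itv (Fin a) (Fin b).

Definition finite_union_of_points_and_intervals (L : language)
    (M : structure L) (X : set M) : Prop :=
  exists (n : nat) (A : 'I_n -> set M),
    (forall i, is_point (A i) \/ is_interval (A i)) /\
    X = \bigcup_i A i.

Definition almost_o_minimal (L : language) (M : structure L) : Prop :=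
  dense_linear_order_without_endpoints M /\
  forall X : set M, definable X -> bounded X ->
    finite_union_of_points_and_intervals X.

(* Main.v *)
Require Import Defs.
From mathcomp Require Import all_boot.
From mathcomp Require Import boolp classical_sets filter.
From Stdlib Require List.

Set Implicit Arguments.
Unset Strict Implicit.
Unset Printing Implicit Defensive.

(** The extension [N] is a bounded ultrapower of [M]: its elements are the
    sequences of elements of [M] with values in a fixed interval, modulo a
    nonprincipal ultrafilter on [nat]. The full ultrapower does not do, since a
    definable family of finite subsets of a fixed bounded interval may have
    members of unbounded cardinality if its parameters are unbounded. The
    intervals are the sets [ext_itv c d]: the interval [(c, d)], extended to infinity on
    the sides where every definable set is eventually constant. The definable
    subsets of [ext_itv c d] are then finite unions of points and intervals, so that the
    structure induced by [M] on [ext_itv c d] is o-minimal. Two facts are needed.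

    Bounded witnesses ([bounded_witness]): a definable condition on [x] with
    parameters in [ext_itv c d] which has a solution has one in a fixed [ext_itv c' d'],
    independent of the parameters. This gives the theorem of Los ([los]), so that
    [N] is an elementary extension of [M]. If some definable set oscillates at
    plus infinity, its boundary points form a definable set [D] of order type
    omega, and the least bound in [D] for a solution is a definable function from
    a power of [ext_itv c d] to [D]. By the monotonicity theorem ([monotone_subitv]) a
    definable function of one variable is constant or strictly monotone on some
    subinterval; as initial segments of [D] are finite, the function cannot be
    strictly monotone, so it is piecewise constant and takes finitely many
    values. Several variables are bounded one at a time.

    Uniform finiteness ([uniform_finiteness]): in an o-minimal structure the
    finite members of a definable family have bounded cardinality. Applied to the
    boundary points of the fibres of a definable set with parameters in [ext_itv c d],
    it gives a bound [k] for their number; hence the bounded definable subsets of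
    [N] have at most [k] boundary points as well, and [N] is almost o-minimal.

    Uniform finiteness is proved by induction on the number [n] of parameters.
    A definable subset of a box contains a box or misses one, and a definable
    function is continuous on some box ([box_generic]). Call a set dense if it
    meets every box in a set containing a box. For a dense set of parameters the
    family is locally trivial: near each point of the vertical line it is empty or
    the graph of a continuous function ([good_dense]), so that the cardinality of
    the fibres is locally constant there ([local_count]). A locally constant
    number is bounded on a dense set ([locally_constant_bounded]), by induction,
    passing to its maximum along the fibres of the last parameter. Over the
    remaining, nowhere dense, set of parameters one coordinate is, up to another
    nowhere dense set, one of finitely many definable functions of the previous
    ones, which reduces the number of parameters ([thin_bound]). *)

(** * Definability structures on a dense linear order *)

Record linord (T : Type) (lo : T -> T -> Prop) : Prop := LinOrd {
  lo_irr : forall x, ~ lo x x;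
  lo_trans : forall x y z, lo x y -> lo y z -> lo x z;
  lo_tri : forall x y, lo x y \/ x = y \/ lo y x }.

Lemma linord_flip T (lo : T -> T -> Prop) :
  linord lo -> linord (fun x y => lo y x).
Proof.
move=> [I Tr Tri]; split=> //; first by move=> x y z h1 h2; apply: Tr h2 h1.
by move=> x y; have := Tri y x; intuition.
Qed.

Lemma lo_lt_le T (lo : T -> T -> Prop) : linord lo ->
  forall x y z, lo x y -> ~ lo z y -> lo x z.
Proof.
move=> L x y z xy zy; case: (lo_tri L y z) => [yz|[<-|zy']] //.
exact: (lo_trans L xy yz).
Qed.

Lemma lo_le_lt T (lo : T -> T -> Prop) : linord lo ->
  forall x y z, ~ lo y x -> lo y z -> lo x z.
Proof.
move=> L x y z xy yz; case: (lo_tri L x y) => [xy'|[->|//]] //.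
exact: (lo_trans L xy' yz).
Qed.

Lemma lo_le_le T (lo : T -> T -> Prop) : linord lo ->
  forall x y z, ~ lo y x -> ~ lo z y -> ~ lo z x.
Proof. by move=> L x y z xy yz zx; apply: yz; exact: (lo_lt_le L zx). Qed.

Lemma lo_eq_le T (lo : T -> T -> Prop) : linord lo ->
  forall x y, x = y -> ~ lo x y.
Proof. by move=> L x y ->; apply: lo_irr L _. Qed.

Ltac not_known P :=
  lazymatch goal with _ : P |- _ => fail | _ => idtac end.

(* Derives a contradiction from a cycle through [s]: collect the points that
   are above [s], strictly or not. *)
Ltac ord_from L lo s :=
  repeat match goal with
  | H : lo s s |- _ => case: (lo_irr L H)
  | H1 : lo s ?y, H2 : ~ lo s ?y |- _ => case: (H2 H1)
  | H1 : lo s ?y, H2 : lo ?y ?z |- _ =>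
      not_known (lo s z); have ? := lo_trans L H1 H2
  | H1 : lo s ?y, H2 : ~ lo ?z ?y |- _ =>
      not_known (lo s z); have ? := lo_lt_le L H1 H2
  | H1 : ~ lo ?y s, H2 : lo ?y ?z |- _ =>
      not_known (lo s z); have ? := lo_le_lt L H1 H2
  | H1 : ~ lo ?y s, H2 : ~ lo ?z ?y |- _ =>
      not_known (~ lo z s); have ? := lo_le_le L H1 H2
  end.

(* Proves goals about a linear order from the [lo], [~ lo], [=] and [<>] facts
   of the context, by looking for a cycle after negating the goal. *)
Ltac ord_with L lo :=
  try match goal with |- ?x <> ?y => let E := fresh in intro E end;
  repeat match goal with
  | E : ?x = ?y |- _ =>
      first [ not_known (~ lo x y); have ? := @lo_eq_le _ _ L x y E
            | not_known (~ lo y x); have ? := @lo_eq_le _ _ L y x (esym E) ]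
  end;
  repeat match goal with
  | E : ?x <> ?y |- _ =>
      not_known (lo x y); not_known (lo y x);
      case: (lo_tri L x y) => [?|[?|?]]; [|done|]
  end;
  first
  [ lazymatch goal with
    | |- lo ?x ?y =>
        apply: contrapT; let E := fresh in intro E; solve [ord_from L lo y]
    | |- ~ lo ?x ?y => let E := fresh in intro E; solve [ord_from L lo x]
    | |- ?x = ?y => case: (lo_tri L x y) => [?|[//|?]];
        [exfalso; solve [ord_from L lo x] | exfalso; solve [ord_from L lo y]]
    end
  | exfalso; match goal with H : lo ?x _ |- _ => solve [ord_from L lo x] end ].

(** Vectors are functions on an index type; adding a coordinate means adding the
    index [None]. *)
Definition oc (T : Type) (V : Set) (x : T) (y : V -> T) : option V -> T :=
  fun o => if o is Some v then y v else x.

Lemma oc_eta T (V : Set) (e : option V -> T) :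
  e = oc (e None) (fun v => e (Some v)).
Proof. by apply: funext => -[]. Qed.

Definition vcat (T : Type) (V W : Set) (y : V -> T) (z : W -> T) : V + W -> T :=
  fun s => match s with inl v => y v | inr w => z w end.

(** Parameters enter definable sets only through this substitution. *)
Definition sb (T : Type) (V W : Set) (s : W -> V + T) (e : V -> T) : W -> T :=
  fun w => match s w with inl v => e v | inr m => m end.

(** Definable sets are subsets of [V -> T] for an arbitrary index type [V]; the
    closure properties are those of first-order formulas with parameters. The
    notion is abstract because it is applied to a first-order structure, to the
    structures induced on its intervals, and to the reversals of both. *)
Record dstr (T : Type) := DStr {
  dlt : T -> T -> Prop;
  dlo : linord dlt;
  dlt_dense : forall x y, dlt x y -> exists z, dlt x z /\ dlt z y;
  dlt_nomin : forall x, exists y, dlt y x;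
  dlt_nomax : forall x, exists y, dlt x y;
  dpt : exists x : T, True;
  dfn : forall V : Set, ((V -> T) -> Prop) -> Prop;
  dfn_ext : forall (V : Set) (P Q : (V -> T) -> Prop),
    (forall e, P e <-> Q e) -> dfn P -> dfn Q;
  dfn_false : forall V : Set, dfn (fun _ : V -> T => False);
  dfn_imp : forall (V : Set) (P Q : (V -> T) -> Prop),
    dfn P -> dfn Q -> dfn (fun e => P e -> Q e);
  dfn_all0 : forall (V : Set) (P : (option V -> T) -> Prop),
    dfn P -> dfn (fun e : V -> T => forall x, P (oc x e));
  dfn_sb : forall (V W : Set) (s : W -> V + T) (P : (W -> T) -> Prop),
    dfn P -> dfn (fun e : V -> T => P (sb s e));
  dfn_lt0 : dfn (fun e : bool -> T => dlt (e true) (e false));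
  dfn_eq0 : dfn (fun e : bool -> T => e true = e false) }.

Arguments dfn {T} d {V}.

(** Reversing the order halves the one-sided arguments below. *)
Definition op (T : Type) (O : dstr T) : dstr T.
Proof.
refine (@DStr T (fun x y => dlt O y x) (linord_flip (dlo O)) _
  (dlt_nomax O) (dlt_nomin O) (dpt O) (@dfn T O) (@dfn_ext T O) (@dfn_false T O)
  (@dfn_imp T O) (@dfn_all0 T O) (@dfn_sb T O) _ (dfn_eq0 O)).
- by move=> x y /(dlt_dense (d:=O)) [z [? ?]]; exists z.
- exact: (@dfn_sb T O bool bool (fun b => inl (~~ b)) _ (dfn_lt0 O)).
Defined.

Section Closure.
Variables (T : Type) (O : dstr T).
Implicit Types V W : Set.

Definition dfn2 V (S : (V -> T) -> T -> Prop) :=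
  dfn O (fun e : option V -> T => S (fun v => e (Some v)) (e None)).

(** The coordinates of [t e] are coordinates of [e] or parameters, so that
    pulling back along [t] is a substitution. *)
Definition vt V W (t : (V -> T) -> W -> T) :=
  exists s : W -> V + T, forall e, t e = sb s e.

(** Definability of the graph, the value being the new coordinate. *)
Definition dt V (t : (V -> T) -> T) :=
  dfn O (fun e : option V -> T => e None = t (fun v => e (Some v))).

Lemma vt_var V W (s : W -> V) : vt (fun (e : V -> T) w => e (s w)).
Proof. by exists (fun w => inl (s w)). Qed.

Lemma vt_const V W (c : W -> T) : vt (fun (e : V -> T) => c).
Proof. by exists (fun w => inr (c w)). Qed.

Lemma vt_oc_var V W (t : (V -> T) -> W -> T) (v : V) :
  vt t -> vt (fun e => oc (e v) (t e)).
Proof.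
move=> [s sE]; exists (fun o => if o is Some w then s w else inl v) => e.
by rewrite sE; apply: funext => -[].
Qed.

Lemma vt_oc_const V W (t : (V -> T) -> W -> T) (c : T) :
  vt t -> vt (fun e => oc c (t e)).
Proof.
move=> [s sE]; exists (fun o => if o is Some w then s w else inr c) => e.
by rewrite sE; apply: funext => -[].
Qed.

Lemma vt_cat V W (X : Set) (t : (V -> T) -> W -> T) (u : (V -> T) -> X -> T) :
  vt t -> vt u -> vt (fun e => vcat (t e) (u e)).
Proof.
move=> [s sE] [r rE].
exists (fun o => match o with inl w => s w | inr x => r x end) => e.
by rewrite sE rE; apply: funext => -[].
Qed.

Lemma dfn_app V W (P : (W -> T) -> Prop) (t : (V -> T) -> W -> T) :
  dfn O P -> vt t -> dfn O (fun e => P (t e)).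
Proof.
move=> HP [s sE]; apply: dfn_ext (dfn_sb s HP) => e.
by rewrite sE.
Qed.

Lemma dfn_true V : dfn O (fun _ : V -> T => True).
Proof. by apply: dfn_ext (dfn_imp (dfn_false O V) (dfn_false O V)) => e; split. Qed.

Lemma dfn_not V (P : (V -> T) -> Prop) : dfn O P -> dfn O (fun e => ~ P e).
Proof. by move=> HP; apply: dfn_imp HP (dfn_false O V). Qed.

Lemma dfn_or V (P Q : (V -> T) -> Prop) :
  dfn O P -> dfn O Q -> dfn O (fun e => P e \/ Q e).
Proof.
move=> HP HQ; apply: dfn_ext (dfn_imp (dfn_not HP) HQ) => e.
by split=> [h|]; [case: (EM (P e)); intuition | intuition].
Qed.

Lemma dfn_and V (P Q : (V -> T) -> Prop) :
  dfn O P -> dfn O Q -> dfn O (fun e => P e /\ Q e).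
Proof.
move=> HP HQ; apply: dfn_ext (dfn_not (dfn_imp HP (dfn_not HQ))) => e.
split=> [h|]; last by intuition.
by split; apply: contrapT => h'; apply: h => p q //; apply: h'.
Qed.

Lemma dfn_iff V (P Q : (V -> T) -> Prop) :
  dfn O P -> dfn O Q -> dfn O (fun e => P e <-> Q e).
Proof. by move=> HP HQ; apply: dfn_and; apply: dfn_imp. Qed.

Lemma dfn_all V (P : T -> (V -> T) -> Prop) :
  dfn O (fun e : option V -> T => P (e None) (fun v => e (Some v))) ->
  dfn O (fun e => forall x, P x e).
Proof. exact: dfn_all0. Qed.

Lemma dfn_ex V (P : T -> (V -> T) -> Prop) :
  dfn O (fun e : option V -> T => P (e None) (fun v => e (Some v))) ->
  dfn O (fun e => exists x, P x e).
Proof.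
move=> HP; apply: dfn_ext
  (dfn_not (dfn_all (P := fun x e => ~ P x e) (dfn_not HP))) => e; split.
  by move=> h; apply: contrapT => h'; apply: h => x px; apply: h'; exists x.
by move=> [x px] h; apply: (h x).
Qed.

Lemma dt_app V W (f : (W -> T) -> T) (t : (V -> T) -> W -> T) :
  dt f -> vt t -> dt (fun e => f (t e)).
Proof.
move=> Hf [s sE].
have H : vt (fun e : option V -> T => oc (e None) (t (fun v => e (Some v)))).
  exists (fun o => if o is Some w
                   then match s w with inl v => inl (Some v) | inr m => inr m end
                   else inl None) => e.
  apply: funext => -[w|] //=; rewrite sE /sb.
  by case: (s w).
by apply: dfn_ext (dfn_app Hf H).
Qed.

Lemma dfn_eqv V (v w : V) : dfn O (fun e => e v = e w).
Proof. exact: (dfn_app (dfn_eq0 O) (vt_var (fun b : bool => if b then v else w))). Qed.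

Lemma dt_var V (v : V) : dt (fun e => e v).
Proof. exact: dfn_eqv. Qed.

Lemma dt_const V (c : T) : dt (fun e : V -> T => c).
Proof.
have H : vt (fun (e : option V -> T) (b : bool) => if b then e None else c).
  by exists (fun b : bool => if b then inl None else inr c) => e; apply: funext => -[].
exact: (dfn_app (dfn_eq0 O) H).
Qed.

Lemma dfn_let V (t : (V -> T) -> T) (P : T -> (V -> T) -> Prop) :
  dt t -> dfn O (fun e : option V -> T => P (e None) (fun v => e (Some v))) ->
  dfn O (fun e => P (t e) e).
Proof.
move=> Ht HP.
apply: dfn_ext (dfn_ex (P := fun x e => x = t e /\ P x e) (dfn_and Ht HP)) => e.
by split=> [[x [->]]|p] //; exists (t e).
Qed.

Lemma dt_wk V (t : (V -> T) -> T) :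
  dt t -> dt (fun e : option V -> T => t (fun v => e (Some v))).
Proof. by move=> Ht; apply: dt_app Ht (vt_var _). Qed.

Lemma dfn_lt V (s t : (V -> T) -> T) :
  dt s -> dt t -> dfn O (fun e => dlt O (s e) (t e)).
Proof.
move=> Hs Ht.
apply: (dfn_let (P := fun x e => dlt O x (t e))) Hs _.
apply: (dfn_let (P := fun x e => dlt O (e None) x)) (dt_wk Ht) _.
exact: (dfn_app (dfn_lt0 O)
  (vt_var (fun b : bool => if b then Some None else None))).
Qed.

Lemma dfn_eq V (s t : (V -> T) -> T) :
  dt s -> dt t -> dfn O (fun e => s e = t e).
Proof.
move=> Hs Ht.
apply: (dfn_let (P := fun x e => x = t e)) Hs _.
apply: (dfn_let (P := fun x e => e None = x)) (dt_wk Ht) _.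
exact: dfn_eqv.
Qed.

Lemma dfn_app2 V W (S : (W -> T) -> T -> Prop) (t : (V -> T) -> W -> T) s :
  dfn2 S -> vt t -> dt s -> dfn O (fun e => S (t e) (s e)).
Proof.
move=> HS [r rE] Hs.
apply: (dfn_let (P := fun x e => S (t e) x)) Hs _.
have H : vt (fun e : option V -> T => oc (e None) (t (fun v => e (Some v)))).
  exists (fun o => if o is Some w
                   then match r w with inl v => inl (Some v) | inr m => inr m end
                   else inl None) => e.
  apply: funext => -[w|] //=; rewrite rE /sb.
  by case: (r w).
by apply: dfn_ext (dfn_app HS H).
Qed.

Definition dfn1 (P : T -> Prop) := dfn O (fun e : unit -> T => P (e tt)).

Lemma dfn_app1 V (P : T -> Prop) (t : (V -> T) -> T) :
  dfn1 P -> dt t -> dfn O (fun e => P (t e)).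
Proof.
move=> HP Ht; apply: (dfn_let (P := fun x e => P x)) Ht _.
exact: (dfn_app (P := fun e : unit -> T => P (e tt)) HP (vt_var (fun _ => None))).
Qed.

Definition dt1 (f : T -> T) := dt (fun e : unit -> T => f (e tt)).

Lemma dt_app1 V (f : T -> T) (t : (V -> T) -> T) :
  dt1 f -> dt t -> dt (fun e => f (t e)).
Proof.
move=> Hf Ht; apply: (dfn_let (P := fun x e => e None = f x)) (dt_wk Ht) _.
exact: (dfn_app (P := fun e : option unit -> T => e None = f (e (Some tt))) Hf
  (vt_var (fun o : option unit => if o is Some _ then None else Some None))).
Qed.

(** Values outside the domain of [G] are set to a parameter; inside it they are
    determined, so that nothing is really chosen. *)
Lemma definable_choice V (G : (V -> T) -> T -> Prop) : dfn2 G ->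
  (forall y s s', G y s -> G y s' -> s = s') ->
  exists2 f, dt f & forall y, (exists s, G y s) -> G y (f y).
Proof.
move=> HG uniq; have [c _] := dpt O.
pose G' y s := G y s \/ ((~ exists s', G y s') /\ s = c).
have /choice [f hf] : forall y, exists s, G' y s.
  move=> y; case: (EM (exists s, G y s)) => [[s h]|h]; first by exists s; left.
  by exists c; right.
exists f => [|y [s gs]]; last first.
  by case: (hf y) => // -[]; case; exists s.
have HE : dfn2 (fun y s => exists s', G y s').
  rewrite /dfn2; apply: dfn_ex.
  exact: (dfn_app (P := fun e : option V -> T => G (fun v => e (Some v)) (e None)) HG
   (vt_var (fun o : option V => if o is Some v then Some (Some v) else None))).
have Hc : dfn2 (fun (y : V -> T) s => s = c) by apply: dfn_eq (dt_var _) (dt_const _ _).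
apply: dfn_ext (dfn_or HG (dfn_and (dfn_not HE) Hc)) => e.
have uniq' s s' : G' (fun v => e (Some v)) s -> G' (fun v => e (Some v)) s' -> s = s'.
  move=> [h|[n ->]] [h'|[n' ->]] //; first exact: uniq h h'.
    by case: n'; exists s.
  by case: n; exists s'.
split=> [h|->]; last exact: hf.
by apply: uniq' (hf _); exact: h.
Qed.

Definition dfnr (R : T -> T -> Prop) :=
  dfn O (fun e : bool -> T => R (e true) (e false)).

Lemma dfn_appr V (R : T -> T -> Prop) (s t : (V -> T) -> T) :
  dfnr R -> dt s -> dt t -> dfn O (fun e => R (s e) (t e)).
Proof.
move=> HR Hs Ht.
apply: (dfn_let (P := fun x e => R x (t e))) Hs _.
apply: (dfn_let (P := fun x e => R (e None) x)) (dt_wk Ht) _.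
exact: (dfn_app (P := fun e : bool -> T => R (e true) (e false)) HR
  (vt_var (fun b : bool => if b then Some None else None))).
Qed.

(** With iterated [option] as index types, a vector of length [n.+1] is
    literally of the form [oc x y]. *)
Fixpoint fin (n : nat) : Set := if n is m.+1 then option (fin m) else Empty_set.

Definition fin0_elim (A : Type) (i : fin 0) : A :=
  match (i : Empty_set) with end.

Lemma fin0_eq (y z : fin 0 -> T) : y = z.
Proof. by apply: funext => -[]. Qed.

Lemma dfn_allfin n V (P : fin n -> (V -> T) -> Prop) :
  (forall i, dfn O (P i)) -> dfn O (fun e => forall i, P i e).
Proof.
elim: n P => [|n IH] P HP.
  by apply: dfn_ext (dfn_true V) => e; split=> // _ [].
apply: dfn_ext (dfn_and (HP None) (IH (fun i => P (Some i)) (fun i => HP _))).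
by move=> e; split=> [[h1 h2] [i|]|h] //; split.
Qed.

Lemma dfn_allv n V (P : (fin n -> T) -> (V -> T) -> Prop) :
  dfn O (fun e : V + fin n -> T =>
    P (fun i => e (inr i)) (fun v => e (inl v))) ->
  dfn O (fun e => forall y, P y e).
Proof.
elim: n V P => [|n IH] V P HP.
  have H : vt (fun e : V -> T =>
      vcat e (@fin0_elim T)).
    exists (fun s => match s with inl v => inl v | inr i => fin0_elim _ i end).
    by move=> e; apply: funext => -[|[]].
  apply: dfn_ext (dfn_app HP H) => e; rewrite /=.
  split=> [h y|]; last by apply.
  by rewrite (fin0_eq y (@fin0_elim T)).
apply: dfn_ext (dfn_all (P := fun x e => forall y : fin n -> T, P (oc x y) e)
  (IH _ (fun y e => P (oc (e None) y) (fun v => e (Some v))) _)) => [e|].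
  by split=> [h y|h x y]; [rewrite (oc_eta y)|]; apply: h.
have H : vt (fun e : option V + fin n -> T =>
   vcat (fun v : V => e (inl (Some v)))
       (oc (e (inl None)) (fun i => e (inr i)))).
  by apply: vt_cat; [exact: vt_var | apply: vt_oc_var; exact: vt_var].
exact: dfn_ext (dfn_app HP H).
Qed.

Lemma dfn_exv n V (P : (fin n -> T) -> (V -> T) -> Prop) :
  dfn O (fun e : V + fin n -> T =>
    P (fun i => e (inr i)) (fun v => e (inl v))) ->
  dfn O (fun e => exists y, P y e).
Proof.
move=> HP; apply: dfn_ext
  (dfn_not (dfn_allv (P := fun x e => ~ P x e) (dfn_not HP))) => e; split.
  by move=> h; apply: contrapT => h'; apply: h => x px; apply: h'; exists x.
by move=> [x px] h; apply: (h x).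
Qed.

End Closure.

Arguments dfn2 {T} O {V}.
Arguments dt {T} O {V}.
Arguments dfn1 {T} O.
Arguments dt1 {T} O.
Arguments dfnr {T} O.

Ltac vt_tac := lazy beta; first
 [ done
 | refine (vt_const _ _)
 | refine (vt_var _ _)
 | refine (@vt_oc_var _ _ _ _ _ _); vt_tac
 | refine (@vt_oc_const _ _ _ _ _ _); vt_tac
 | refine (vt_cat _ _); vt_tac ].

Ltac dt_tac := lazy beta; first
 [ refine (dt_const _ _ _)
 | refine (dt_var _ _)
 | match goal with
   | H : dt _ ?f |- _ => refine (dt_app (f := f) H _); vt_tac
   | H : dt1 _ ?f |- _ => refine (dt_app1 (f := f) H _); dt_tac
   end ].

(* Definability of a predicate by recursion on its shape; the atoms are the
   order, equality and the relations with a definability hypothesis. *)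
Ltac dfn_tac := lazy beta; first
 [ assumption
 | refine (dfn_true _ _)
 | refine (dfn_false _ _)
 | refine (dfn_lt _ _); dt_tac
 | refine (dfn_eq _ _); dt_tac
 | match goal with
   | H : dfn _ ?P |- _ => refine (dfn_app (P := P) H _); vt_tac
   | H : dfn2 _ ?P |- _ => refine (dfn_app2 (S := P) H _ _); [vt_tac | dt_tac]
   | H : dfn1 _ ?P |- _ => refine (dfn_app1 (P := P) H _); dt_tac
   | H : dfnr _ ?P |- _ => refine (dfn_appr (R := P) H _ _); dt_tac
   end
 | refine (dfn_and _ _); dfn_tac
 | refine (dfn_or _ _); dfn_tac
 | refine (dfn_iff _ _); dfn_tac
 | refine (dfn_not _); dfn_tac
 | refine (dfn_imp _ _); dfn_tac
 | refine (dfn_ex _); dfn_tac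
 | refine (dfn_all _); dfn_tac
 | refine (dfn_exv _); dfn_tac
 | refine (dfn_allv _); dfn_tac
 | refine (dfn_allfin _); intro; dfn_tac ].

(** * One-variable o-minimality *)

(** A finite union of points and intervals, seen through its boundary points:
    [P] does not change along a segment that avoids the list. *)
Definition tame (T : Type) (O : dstr T) (P : T -> Prop) :=
  exists l : list T, forall x y, dlt O x y ->
    (forall z, List.In z l -> dlt O z x \/ dlt O y z) -> (P x <-> P y).

Definition omin (T : Type) (O : dstr T) := forall P, dfn1 O P -> tame O P.

Definition finite (T : Type) (P : T -> Prop) :=
  exists l : list T, forall x, P x -> List.In x l.

Definition is_sup (T : Type) (O : dstr T) (P : T -> Prop) (s : T) :=
  (forall x, P x -> ~ dlt O s x) /\
  (forall r, dlt O r s -> exists2 x, P x & dlt O r x).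

Lemma finite_inj (A B : Type) (P : A -> Prop) (Q : B -> Prop) (f : A -> B) :
  finite Q -> (forall x, P x -> Q (f x)) ->
  (forall x y, P x -> P y -> f x = f y -> x = y) -> finite P.
Proof.
move=> [l hl] PQ inj; case: (EM (exists a, P a)) => [[a0 _]|ne]; last first.
  by exists nil => x px; case: ne; exists x.
have /choice [g hg] : forall z, exists x, forall x', P x' -> f x' = z -> x' = x.
  move=> z; case: (EM (exists2 x, P x & f x = z)) => [[x px E]|n].
    by exists x => x' px' E'; apply: inj => //; rewrite E.
  by exists a0 => x' px' E'; case: n; exists x'.
exists (List.map g l) => x px; apply/List.in_map_iff; exists (f x); split.
  by symmetry; apply: hg.
by apply: hl; apply: PQ.
Qed.

Lemma omin_op T (O : dstr T) : omin O -> omin (op O).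
Proof.
move=> H P /H [l hl]; exists l => x y yx h; symmetry.
by apply: hl => // z /h; intuition.
Qed.

Section OneVar.
Variables (T : Type) (O : dstr T).
Local Notation "x ≺ y" := (dlt O x y) (at level 70).
Local Ltac ord := ord_with (dlo O) (dlt O).

Lemma tri x y : x ≺ y \/ x = y \/ y ≺ x. Proof. exact: lo_tri (dlo O) x y. Qed.

Lemma lt_common_right x a b : x ≺ a -> x ≺ b -> exists c, [/\ x ≺ c, c ≺ a & c ≺ b].
Proof.
move=> xa xb; case: (EM (b ≺ a)) => h.
  by have [c [? ?]] := dlt_dense xb; exists c; split=> //; ord.
by have [c [? ?]] := dlt_dense xa; exists c; split=> //; ord.
Qed.

Lemma avoid_right (l : list T) a b : a ≺ b ->
  exists c, [/\ a ≺ c, c ≺ b & forall z, List.In z l -> ~ (a ≺ z /\ z ≺ c)].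
Proof.
move=> ab; elim: l => [|z l [c [ac cb h]]].
  by have [c [ac cb]] := dlt_dense ab; exists c; split.
case: (EM (a ≺ z)) => az; last first.
  by exists c; split=> // w /= [<- [] //|]; apply: h.
have [d [ad dz dc]] := lt_common_right az ac.
exists d; split=> //; first by ord.
move=> w /= [<- [_ zd]|/h h' [aw wd]]; first by ord.
by apply: h'; split=> //; ord.
Qed.

Lemma itv_infinite a b : a ≺ b -> ~ finite (fun x => a ≺ x /\ x ≺ b).
Proof.
move=> ab [l hl]; have [c [ac cb h]] := avoid_right l ab.
have [d [ad dc]] := dlt_dense ac.
by apply: (h d) => //; apply: hl; split=> //; ord.
Qed.

Lemma finite_min (P : T -> Prop) : finite P -> (exists x, P x) ->
  exists2 m, P m & forall y, P y -> ~ y ≺ m.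
Proof.
move=> [l hl] [x px].
suff [m pm h] : exists2 m, P m & forall y, List.In y l -> P y -> ~ y ≺ m.
  by exists m => // y py; apply: h => //; apply: hl.
elim: l {hl} => [|z l [m pm h]]; first by exists x.
case: (EM (P z /\ z ≺ m)) => [[pz zm]|n].
  by exists z => // y [<-|yl] py; [ord | have := h y yl py => ?; ord].
exists m => // y [<-|yl] py; last exact: h.
by move=> zm; apply: n.
Qed.

Hypothesis OM : omin O.

(** A short enough interval to the right of [a] avoids all breakpoints. *)
Lemma germ_right P a b : dfn1 O P -> a ≺ b -> exists c, [/\ a ≺ c, c ≺ b &
  (forall x, a ≺ x -> x ≺ c -> P x) \/ (forall x, a ≺ x -> x ≺ c -> ~ P x)].
Proof.
move=> /OM [l hl] ab; have [c [ac cb h]] := avoid_right l ab.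
exists c; split=> //; have [m [am mc]] := dlt_dense ac.
have key x : a ≺ x -> x ≺ c -> (P x <-> P m).
  move=> ax xc; have out z u v : List.In z l -> a ≺ u -> v ≺ c -> z ≺ u \/ v ≺ z.
    move=> zl au vc; apply: contrapT => k; apply: (h z zl).
    have k1 : ~ z ≺ u by intuition. have k2 : ~ v ≺ z by intuition.
    by split; ord.
  case: (tri x m) => [xm|[->//|mx]]; last symmetry; apply: hl => // z zl; exact: out.
case: (EM (P m)) => pm; [left|right] => x ax xc; first by apply/key.
by move=> /(key x ax xc).
Qed.

Lemma tame_itv P : tame O P -> finite P \/
  exists a b, a ≺ b /\ forall x, a ≺ x -> x ≺ b -> P x.
Proof.
move=> [l hl]; case: (EM (exists2 x, P x & ~ List.In x l)) => [[x px xl]|h]; last first.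
  by left; exists l => x px; apply: contrapT => xl; apply: h; exists x.
right.
have [b [xb hb]] : exists b, x ≺ b /\ forall z, List.In z l -> ~ (x ≺ z /\ z ≺ b).
  have [b0 xb0] := dlt_nomax O x.
  by have [b [? ? ?]] := avoid_right l xb0; exists b.
exists x, b; split=> // y xy yb; apply/(hl x y) => // z zl.
case: (tri z x) => [|[E|xz]]; [by left | by subst | right].
by apply: contrapT => zy; apply: (hb z zl); split=> //; ord.
Qed.

(** The supremum is a breakpoint. A breakpoint that is not the supremum can be
    passed, by moving [x0] up or [u0] down inside or outside [Q]; if all were
    passed, [Q] would not change between [x0] and [u0]. *)
Lemma cut_sup (Q : T -> Prop) : tame O Q -> (forall x y, Q y -> x ≺ y -> Q x) ->
  (exists x, Q x) -> (exists x, ~ Q x) ->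
  exists s, (forall x, Q x -> ~ s ≺ x) /\ (forall x, x ≺ s -> Q x).
Proof.
move=> [l hl] down [x0 qx0] [u0 nu0]; apply: contrapT => nosup.
have step z : (exists2 x, Q x & z ≺ x) \/ (exists2 x, ~ Q x & x ≺ z).
  apply: contrapT => h; apply: nosup; exists z; split=> x.
    by move=> qx zx; apply: h; left; exists x.
  by move=> xz; apply: contrapT => qx; apply: h; right; exists x.
suff [x [u [qx nu h]]] : exists x u, [/\ Q x, ~ Q u &
    forall z, List.In z l -> z ≺ x \/ u ≺ z].
  apply: (nu); apply/(hl x u) => //; case: (tri x u) => [//|[E|ux]].
    by case: nu; rewrite -E.
  by case: nu; apply: down qx ux.
elim: l {hl} => [|z l [x [u [qx nu h]]]]; first by exists x0, u0; split.
have lt_QnQ v w : Q v -> ~ Q w -> v ≺ w.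
  move=> qv nw; case: (tri v w) => [//|[E|wv]]; first by case: nw; rewrite -E.
  by case: nw; apply: down qv wv.
case: (step z) => [[y qy zy]|[y qy yz]].
  case: (EM (x ≺ y)) => xy.
    exists y, u; split=> // w /= [<-|/h [?|?]]; [by left | left; ord | by right].
  exists x, u; split=> // w /= [<-|/h [?|?]]; [left; ord | by left | by right].
case: (EM (y ≺ u)) => yu.
  exists x, y; split=> // w /= [<-|/h [?|?]]; [by right | by left | right; ord].
exists x, u; split=> // w /= [<-|/h [?|?]]; [right; ord | by left | by right].
Qed.

Lemma sup_ex P : dfn1 O P -> (exists x, P x) -> (exists u, forall x, P x -> ~ u ≺ x) ->
  exists s, is_sup O P s.
Proof.
move=> HP [x0 p0] [u hu].
have HQ : dfn1 O (fun y => exists x, P x /\ ~ x ≺ y).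
  by rewrite /dfn1; dfn_tac.
have [||| s [s1 s2]] := cut_sup (OM HQ).
- by move=> x y [z [pz zy]] xy; exists z; split=> // zx; ord.
- by exists x0, x0; split=> //; ord.
- have [v uv] := dlt_nomax O u; exists v => -[x [px xv]].
  by have := hu x px; move=> ?; ord.
exists s; split=> [x px|r rs].
  by apply: s1; exists x; split=> //; ord.
have [r' [rr' r's]] := dlt_dense rs.
by have [x [px xr]] := s2 _ r's; exists x => //; ord.
Qed.

(** The initial segment of [[p, q]] on which [P] keeps its value at [p] is
    definable, and local constancy extends it beyond its supremum. *)
Lemma connected P p q : dfn1 O P -> p ≺ q ->
  (forall x, ~ x ≺ p -> ~ q ≺ x -> exists u v, [/\ u ≺ x, x ≺ v &
     forall y, u ≺ y -> y ≺ v -> (P y <-> P x)]) -> (P p <-> P q).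
Proof.
move=> HP pq loc; apply: contrapT => neq.
pose A s := ~ s ≺ p /\ forall z, ~ z ≺ p -> ~ s ≺ z -> (P z <-> P p).
have HA : dfn1 O A.
  by rewrite /dfn1 /A; dfn_tac.
have Ap : A p.
  split=> [|z zp pz]; first by ord.
  by have -> : z = p by ord.
have Aq s : A s -> ~ q ≺ s.
  by move=> [sp h] qs; apply: neq; symmetry; apply: h; ord.
have [|s [s1 s2]] := sup_ex HA (ex_intro _ p Ap); first by exists q.
have ps : ~ s ≺ p by apply: s1.
have sq : ~ q ≺ s.
  by move=> /s2 [x /Aq].
have [u [v [us sv uv]]] := loc s ps sq.
have below z : ~ z ≺ p -> z ≺ s -> (P z <-> P p).
  move=> zp /s2 [x [xp h] zx]; apply: h => //; ord.
have Ps : P s <-> P p.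
  case: (EM (p ≺ s)) => ps'; last first.
    by have -> : s = p by ord.
  have [w [ws wu wp]] : exists w, [/\ w ≺ s, u ≺ w & p ≺ w].
    case: (EM (u ≺ p)) => up.
      by have [w [? ?]] := dlt_dense ps'; exists w; split=> //; ord.
    by have [w [? ?]] := dlt_dense us; exists w; split=> //; ord.
  rewrite -(uv w) //; first by apply: below => //; ord.
  by ord.
have [w [sw wv]] := dlt_dense sv.
suff Aw : A w by apply: (s1 w Aw).
split=> [|z zp wz]; first by ord.
case: (EM (z ≺ s)) => zs; first exact: below.
by rewrite -Ps; apply: uv; ord.
Qed.

End OneVar.

(** * The monotonicity theorem *)

Definition holds_right (T : Type) (O : dstr T) (x : T) (P : T -> Prop) :=
  exists u, dlt O x u /\ forall y, dlt O x y -> dlt O y u -> P y.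

Definition holds_left (T : Type) (O : dstr T) (x : T) (P : T -> Prop) :=
  exists u, dlt O u x /\ forall y, dlt O y x -> dlt O u y -> P y.

Section Germs.
Variables (T : Type) (O : dstr T).
Local Notation "x ≺ y" := (dlt O x y) (at level 70).
Local Ltac ord := ord_with (dlo O) (dlt O).

Lemma holds_right_and x P Q : holds_right O x P -> holds_right O x Q ->
    holds_right O x (fun y => P y /\ Q y).
Proof.
move=> [u [xu hu]] [v [xv hv]]; have [c [xc cu cv]] := lt_common_right xu xv.
exists c; split=> // y xy yc; split; [apply: hu|apply: hv] => //; ord.
Qed.

Lemma holds_right_ex x b P : x ≺ b -> holds_right O x P -> exists y, [/\ x ≺ y, y ≺ b & P y].
Proof.
move=> xb [u [xu hu]]; have [c [xc cu cb]] := lt_common_right xu xb.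
by exists c; split=> //; apply: hu.
Qed.

Lemma holds_right_sub x (P Q : T -> Prop) : (forall y, P y -> Q y) -> holds_right O x P ->
    holds_right O x Q.
Proof. by move=> h [u [xu hu]]; exists u; split=> // y xy yu; apply: h; apply: hu. Qed.

Lemma holds_right_em x P : omin O -> dfn1 O P -> holds_right O x P \/
    holds_right O x (fun y => ~ P y).
Proof.
move=> OM HP; have [b xb] := dlt_nomax O x.
by have [c [xc cb [h|h]]] := germ_right OM HP xb; [left|right]; exists c.
Qed.

End Germs.

Section GermsLeft.
Variables (T : Type) (O : dstr T).
Local Notation "x ≺ y" := (dlt O x y) (at level 70).

Lemma holds_left_and x P Q : holds_left O x P -> holds_left O x Q -> holds_left O x (fun y =>
    P y /\ Q y).
Proof. exact: (@holds_right_and T (op O) x P Q). Qed.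

Lemma holds_left_ex x b P : b ≺ x -> holds_left O x P -> exists y, [/\ y ≺ x, b ≺ y & P y].
Proof. exact: (@holds_right_ex T (op O) x b P). Qed.

Lemma holds_left_sub x (P Q : T -> Prop) : (forall y, P y -> Q y) -> holds_left O x P ->
    holds_left O x Q.
Proof. exact: (@holds_right_sub T (op O) x P Q). Qed.

Lemma holds_left_em x P : omin O -> dfn1 O P -> holds_left O x P \/ holds_left O x (fun y => ~ P y).
Proof. by move=> OM; exact: (@holds_right_em T (op O) x P (omin_op OM)). Qed.

End GermsLeft.

Lemma subitv_em T (O : dstr T) P a b : omin O -> dfn1 O P -> dlt O a b ->
  exists c, dlt O a c /\ ~ dlt O b c /\
    ((forall x, dlt O a x -> dlt O x c -> P x) \/
     (forall x, dlt O a x -> dlt O x c -> ~ P x)).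
Proof.
move=> OM HP ab; have [c [ac cb h]] := germ_right OM HP ab.
by exists c; split=> //; split=> // bc; apply: (lo_irr (dlo O)); apply: (lo_trans (dlo O)) bc cb.
Qed.

Definition injective_on (T C : Type) (f : T -> C) (O : dstr T) a b :=
  forall x y, dlt O a x -> dlt O x b -> dlt O a y -> dlt O y b -> f x = f y -> x = y.

Definition incr_on (T C : Type) (f : T -> C) (lo : C -> C -> Prop) (O : dstr T) a b :=
  forall x y, dlt O a x -> dlt O x y -> dlt O y b -> lo (f x) (f y).

Section Mono.
Variables (T C : Type) (f : T -> C).

(** If every point of [(a, b)] is a strict local minimum of [f], then [f]
    crosses from above to below some level at each point near [b]: follow
    from [c] the last point up to which [f] exceeds [f c]. *)
Lemma local_min_crossing (O : dstr T) (lo : C -> C -> Prop) a b :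
  omin O -> linord lo -> dfnr O (fun x y => lo (f x) (f y)) ->
  dlt O a b -> injective_on f O a b ->
  (forall x, dlt O a x -> dlt O x b -> holds_right O x (fun y => lo (f x) (f y)) /\
                                       holds_left O x (fun y => lo (f x) (f y))) ->
  exists a', [/\ dlt O a a', dlt O a' b & forall s, dlt O a' s -> dlt O s b ->
    exists c, holds_right O s (fun y => lo (f y) (f c)) /\ holds_left O s (fun y =>
        lo (f c) (f y))].
Proof.
move=> OM L Hf ab inj lmin.
have ord := dlo O.
have low x y : lo (f x) (f y) -> x <> y.
  by move=> h E; rewrite E in h; exact: (lo_irr L h).
have inj' x y : dlt O a x -> dlt O x b -> dlt O a y -> dlt O y b -> x <> y ->
    ~ lo (f x) (f y) -> lo (f y) (f x).
  move=> ax xb ay yb xy h; case: (lo_tri L (f x) (f y)) => [//|[/inj E|//]].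
  by case: xy; apply: E.
(* Near [b] every value is undercut later: otherwise [f] would increase on an
   interval. *)
have [a1 [aa1 a1b drop]] : exists a1, [/\ dlt O a a1, dlt O a1 b & forall x,
    dlt O a1 x -> dlt O x b -> exists y, [/\ dlt O x y, dlt O y b & lo (f y) (f x)]].
  pose B x := forall y, dlt O x y -> dlt O y b -> lo (f x) (f y).
  have HB : dfn1 O B by rewrite /dfn1 /B; dfn_tac.
  have [c [cb ac h]] := germ_right (omin_op OM) HB ab; rewrite /= in cb ac h.
  case: h => h.
    have [x [cx xb]] := dlt_dense cb.
    have [_ lx] := lmin x (lo_trans ord ac cx) xb.
    have [y [yx cy l1]] := holds_left_ex cx lx.
    have l2 : lo (f y) (f x) by apply: (h y (lo_trans ord yx xb) cy).
    by case: (lo_irr L (lo_trans L l1 l2)).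
  exists c; split=> // x cx xb; apply: contrapT => h'; apply: (h x xb cx) => y xy yb.
  have ax := lo_trans ord ac cx.
  apply: inj' => //; try exact: (lo_trans ord ax xy).
    by move=> E; rewrite E in xy; case: (lo_irr ord xy).
  by move=> l; apply: h'; exists y.
have below c : dlt O a1 c -> dlt O c b -> holds_left O b (fun y => lo (f y) (f c)).
  move=> a1c cb.
  have HP : dfn1 O (fun y => lo (f y) (f c)) by rewrite /dfn1; dfn_tac.
  case: (holds_left_em b OM HP) => // -[e [eb he]].
  have [y0 [cy0 y0b ly0]] := drop c a1c cb.
  have [|||s [s1 s2]] := @sup_ex _ O OM
     (fun y => dlt O c y /\ (dlt O y b /\ lo (f y) (f c))).
  - by rewrite /dfn1; dfn_tac.
  - by exists y0.
  exists e => x [_ [xb lx]] ex; exact: (he x xb ex lx).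
  have cs : dlt O c s by apply: (lo_lt_le ord cy0); apply: s1.
  have sb' : dlt O s b.
    apply: (lo_le_lt ord) (eb) => es.
    by have [x [_ [xb lx]] ex] := s2 e es; apply: (he x xb ex lx).
  have as_ : dlt O a s by apply: (lo_trans ord aa1 _); apply: (lo_trans ord a1c cs).
  case: (EM (lo (f s) (f c))) => lsc.
    have [y [sy yb ly]] := drop s (lo_trans ord a1c cs) sb'.
    by case: (s1 y) => //; split; [exact: (lo_trans ord cs sy)|split=> //;
        apply: (lo_trans L ly lsc)].
  have lcs : lo (f c) (f s).
    apply: inj' => //; first exact: (lo_trans ord aa1 a1c).
    by move=> E; rewrite E in cs; case: (lo_irr ord cs).
  have [_ [u [us hu]]] := lmin s as_ sb'.
  have [x [cx [xb lx]] ux] := s2 u us.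
  case: (tri O x s) => [xs|[E|sx]].
  - by case: (lo_irr L (lo_trans L lcs (lo_trans L (hu x xs ux) lx))).
  - by subst x.
  - by case: (s1 x).
have crossing c : dlt O a1 c -> dlt O c b -> exists s, [/\ dlt O c s, dlt O s b,
    holds_right O s (fun y => lo (f y) (f c)) & holds_left O s (fun y => lo (f c) (f y))].
  move=> a1c cb; have ac := lo_trans ord aa1 a1c.
  have [e [eb he]] := below c a1c cb.
  have [rc _] := lmin c ac cb.
  have [y0 [cy0 y0b ly0]] := holds_right_ex cb rc.
  have HP : dfn1 O (fun y => lo (f c) (f y)) by rewrite /dfn1; dfn_tac.
  have [|||s [s1 s2]] := @sup_ex _ O OM
     (fun y => dlt O c y /\ (dlt O y b /\ lo (f c) (f y))).
  - by rewrite /dfn1; dfn_tac.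
  - by exists y0.
  exists e => x [_ [xb lx]] ex.
    by case: (lo_irr L (lo_trans L lx (he x xb ex))).
  have cs : dlt O c s by apply: (lo_lt_le ord cy0); apply: s1.
  have sb' : dlt O s b.
    apply: (lo_le_lt ord) (eb) => es.
    have [x [_ [xb lx]] ex] := s2 e es.
    by case: (lo_irr L (lo_trans L lx (he x xb ex))).
  exists s; split=> //.
    exists b; split=> // y sy yb; have cy := lo_trans ord cs sy.
    apply: inj' => //; try exact: (lo_trans ord ac cy).
      by move=> E; rewrite E in cy; case: (lo_irr ord cy).
    by move=> l; apply: (s1 y).
  case: (holds_left_em s OM HP) => // -[u [us hu]].
  have [x [cx [xb lx]] ux] := s2 u us.
  case: (tri O x s) => [xs|[E|sx]].
  - by case: (hu x xs ux).
  - subst x; have [_ [u' [u's hu']]] := lmin s (lo_trans ord ac cx) xb.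
    have [z [zs uz]] := @holds_left_ex _ O s u _ us (ex_intro _ u' (conj u's hu')).
    by move=> lz; case: (hu z zs uz); apply: (lo_trans L lx lz).
  - by case: (s1 x).
pose W s := exists c, holds_right O s (fun y => lo (f y) (f c)) /\ holds_left O s (fun y =>
    lo (f c) (f y)).
have HW : dfn1 O W by rewrite /dfn1 /W /holds_right /holds_left; dfn_tac.
have [a2 [a2b a1a2 h]] := germ_right (omin_op OM) HW a1b.
rewrite /= in a2b a1a2 h; exists a2; split=> //; first exact: (lo_trans ord aa1).
case: h => [h s a2s sb'|h]; first exact: h.
have [c [a2c cb]] := dlt_dense a2b.
have [s [cs sb' r l]] := crossing c (lo_trans ord a1a2 a2c) cb.
by case: (h s sb' (lo_trans ord a2c cs)); exists c.
Qed.

(** By the crossing lemma for both orientations of the domain, some point would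
    be a crossing from above to below one level and from below to above
    another one. *)
Lemma no_local_min_itv (O : dstr T) (lo : C -> C -> Prop) a b :
  omin O -> linord lo -> dfnr O (fun x y => lo (f x) (f y)) ->
  dlt O a b -> injective_on f O a b ->
  ~ (forall x, dlt O a x -> dlt O x b -> holds_right O x (fun y => lo (f x) (f y)) /\
                                         holds_left O x (fun y => lo (f x) (f y))).
Proof.
move=> OM L Hf ab inj lmin; have ord := dlo O.
have [a' [aa' a'b h]] := local_min_crossing OM L Hf ab inj lmin.
have [x y xb ax|x xb a'x|b' [/= bb' b'a h']] :=
  @local_min_crossing (op O) lo b a' (omin_op OM) L Hf a'b.
- by move=> /= yb ay; apply: inj => //; apply: (lo_trans ord aa' _).
- by have [r l] := lmin x (lo_trans ord aa' a'x) xb; split; [exact: l|exact: r].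
have [s [a's sb']] := dlt_dense b'a.
have [c [r l]] := h s a's (lo_trans ord sb' bb').
have [d [l' r']] := h' s sb' a's.
have [y1 [_ _ [h3 h4]]] := holds_right_ex (lo_trans ord sb' bb') (holds_right_and r r').
have [y2 [_ _ [h5 h6]]] := holds_left_ex a's (holds_left_and l l').
suff /(lo_irr L) : lo (f c) (f c) by [].
apply: (lo_trans L h5 _).
apply: (lo_trans L h6 _); exact: (lo_trans L h4 h3).
Qed.

(** Consider the supremum of the segment to the right of [x] on which [f]
    exceeds [f x]: the behaviour of [f] on its two sides extends the segment. *)
Lemma incr_of_local (O : dstr T) (lo : C -> C -> Prop) a b :
  omin O -> linord lo -> dfnr O (fun x y => lo (f x) (f y)) ->
  (forall x, dlt O a x -> dlt O x b -> holds_right O x (fun y => lo (f x) (f y)) /\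
                                       holds_left O x (fun y => lo (f y) (f x))) ->
  incr_on f lo O a b.
Proof.
move=> OM L Hf loc x y ax xy yb; have ord := dlo O.
apply: contrapT => nlo.
pose P s := dlt O x s /\ (dlt O s b /\ forall z, dlt O x z -> ~ dlt O s z -> lo (f x) (f z)).
have HP : dfn1 O P by rewrite /dfn1 /P; dfn_tac.
have [[u [xu hu]] _] := loc x ax (lo_trans ord xy yb).
have [w [xw wu wb]] := lt_common_right xu (lo_trans ord xy yb).
have Pw : P w.
  by split=> //; split=> // z xz wz; apply: hu => //; apply: (lo_le_lt ord wz wu).
have Py s : P s -> dlt O s y.
  move=> [xs [sb' h]]; apply: contrapT => sy; apply: nlo; exact: h.
have [|s [s1 s2]] := sup_ex OM HP (ex_intro _ w Pw).
  by exists y => s /Py sy ys; case: (lo_irr ord (lo_trans ord sy ys)).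
have xs : dlt O x s by apply: (lo_lt_le ord xw); apply: s1.
have sy : ~ dlt O y s by move=> /s2 [r /Py ry yr]; case: (lo_irr ord (lo_trans ord ry yr)).
have sb' := lo_le_lt ord sy yb.
have below z : dlt O x z -> dlt O z s -> lo (f x) (f z).
  move=> xz /s2 [r [_ [_ h]] zr]; apply: h => // rz; exact: (lo_irr ord (lo_trans ord rz zr)).
have [rs ls] := loc s (lo_trans ord ax xs) sb'.
have fxs : lo (f x) (f s).
  have [z [zs xz lz]] := holds_left_ex xs ls; exact: (lo_trans L (below z xz zs) lz).
have [v [sv hv]] := rs.
have [v' [sv' v'v v'b]] := lt_common_right sv sb'.
apply: (s1 v') => //; split; first exact: (lo_trans ord xs sv').
split=> // z xz zv'; case: (tri O z s) => [zs|[->//|sz]]; first exact: below.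
apply: (lo_trans L fxs _); apply: hv => //; exact: (lo_le_lt ord zv' v'v).
Qed.

(** The classical monotonicity argument: make [f] constant or injective, then
    make the two comparisons of [f x] with the nearby values constant in [x];
    only the two combinations that yield a monotone function can occur. *)
Theorem monotone_subitv (O : dstr T) (lo : C -> C -> Prop) a b :
  omin O -> linord lo -> dfnr O (fun x y => lo (f x) (f y)) -> dlt O a b ->
  exists a' b', [/\ dlt O a' b', ~ dlt O a' a, ~ dlt O b b' &
    (forall x y, dlt O a' x -> dlt O x b' -> dlt O a' y -> dlt O y b' -> f x = f y) \/
    incr_on f lo O a' b' \/ incr_on f (fun u v => lo v u) O a' b'].
Proof.
move=> OM L Hf ab; have ord := dlo O.
have Hg : dfnr O (fun x y => lo (f y) (f x)).
  by rewrite /dfnr; dfn_tac.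
have feq x y : f x = f y <-> (~ lo (f x) (f y) /\ ~ lo (f y) (f x)).
  split=> [->|[h1 h2]]; first by split; apply: lo_irr L _.
  by case: (lo_tri L (f x) (f y)) => [/h1|[|/h2]].
have He : dfnr O (fun x y => f x = f y).
  rewrite /dfnr; apply: dfn_ext => [e|]; first by symmetry; exact: feq.
  by dfn_tac.
case: (EM (exists z, exists a' b', [/\ dlt O a' b', ~ dlt O a' a, ~ dlt O b b' &
    forall x, dlt O a' x -> dlt O x b' -> f x = f z])) => [[z [a' [b' [h1 h2 h3 h4]]]]|nconst].
  by exists a', b'; split=> //; left => x y *; rewrite !h4.
have fibfin z : finite (fun x => dlt O a x /\ (dlt O x b /\ f x = f z)).
  have HP : dfn1 O (fun x => dlt O a x /\ (dlt O x b /\ f x = f z)).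
    by rewrite /dfn1; dfn_tac.
  case: (tame_itv (OM _ HP)) => // -[a' [b' [a'b' h]]].
  case: nconst; exists z, a', b'; split=> //.
  - move=> a'a; have [c [a'c ca cb']] := lt_common_right a'a a'b'.
    by have [ac _] := h c a'c cb'; case: (lo_irr ord (lo_trans ord ac ca)).
  - move=> bb'; have [c [cb' bc]] := @holds_right_ex _ (op O) b' b (fun x => dlt O a' x) bb'
       (ex_intro _ a' (conj a'b' (fun _ _ h => h))).
    by move=> a'c; have [_ [cb _]] := h c a'c cb'; case: (lo_irr ord (lo_trans ord cb bc)).
  - by move=> x h1 h2; have [_ []] := h x h1 h2.
(* The least points of the fibres are infinitely many; f is injective there. *)
pose M x := dlt O a x /\ (dlt O x b /\ forall y, dlt O a y -> dlt O y x -> f y <> f x).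
have HM : dfn1 O M.
  by rewrite /dfn1 /M; refine (dfn_and _ _); [dfn_tac|]; refine (dfn_and _ _); dfn_tac.
have [a1 [b1 [a1b1 hM]]] : exists a' b', dlt O a' b' /\ forall x, dlt O a' x -> dlt O x b' -> M x.
  case: (tame_itv (OM _ HM)) => // -[l hl]; exfalso.
  apply: (itv_infinite ab).
  have hx x : dlt O a x -> dlt O x b -> exists2 r, M r & f r = f x.
    move=> ax xb; have [l' hl'] := fibfin x.
    have [m [am [mb Em]] hm] := @finite_min _ O _ (fibfin x)
      (ex_intro _ x (conj ax (conj xb erefl))).
    exists m => //; split=> //; split=> // y ay ym E; apply: (hm y) => //.
    by split=> //; split; [exact: (lo_trans ord ym mb)| rewrite E].
  have [g hg] : exists g : T -> list T, forall r x, dlt O a x -> dlt O x b -> f x = f r ->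
      List.In x (g r).
    have : forall r, exists l, forall x, dlt O a x -> dlt O x b -> f x = f r -> List.In x l.
      by move=> r; have [l' hl'] := fibfin r; exists l' => x *; apply: hl'.
    by move=> /choice [g hg]; exists g => r x; apply: hg.
  exists (List.flat_map g l) => x [ax xb].
  have [r Mr Er] := hx x ax xb; apply/List.in_flat_map; exists r; split.
    exact: hl.
  exact: hg.
have a1a : ~ dlt O a1 a.
  move=> a1a; have [c [a1c ca cb]] := lt_common_right a1a a1b1.
  by have [ac _] := hM c a1c cb; case: (lo_irr ord (lo_trans ord ac ca)).
have bb1 : ~ dlt O b b1.
  move=> bb'; have [c [cb' bc a'c]] := @holds_right_ex _ (op O) b1 b (fun x => dlt O a1 x) bb'
     (ex_intro _ a1 (conj a1b1 (fun _ _ h => h))).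
  by have [_ [cb _]] := hM c a'c cb'; case: (lo_irr ord (lo_trans ord cb bc)).
have inj : injective_on f O a1 b1.
  move=> x y a1x xb a1y yb E; have [ax [_ hx]] := hM x a1x xb.
  have [ay [_ hy]] := hM y a1y yb.
  by case: (tri O x y) => [xy|[//|yx]]; [case: (hy x)|case: (hx y)].
pose RP x := holds_right O x (fun y => lo (f x) (f y)).
pose LP x := holds_left O x (fun y => lo (f x) (f y)).
have HR : dfn1 O RP by rewrite /dfn1 /RP /holds_right; dfn_tac.
have HL : dfn1 O LP by rewrite /dfn1 /LP /holds_left; dfn_tac.
have [b2 [a1b2 [b21 h2]]] := subitv_em OM HR a1b1.
have [b3 [a1b3 [b32 h3]]] := subitv_em OM HL a1b2.
have b31 : ~ dlt O b1 b3 by apply: (lo_le_le ord b32 b21).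
have inj3 : injective_on f O a1 b3.
  by move=> x y h4 h5 h6 h7; apply: inj => //; apply: (lo_lt_le ord _ b31).
have h2' : (forall x, dlt O a1 x -> dlt O x b3 -> RP x) \/
           (forall x, dlt O a1 x -> dlt O x b3 -> ~ RP x).
  by case: h2 => h2; [left|right] => x h4 h5; apply: h2 => //; exact: (lo_lt_le ord _ b32).
have nR x : dlt O a1 x -> dlt O x b3 -> ~ RP x -> holds_right O x (fun y => lo (f y) (f x)).
  move=> a1x xb n.
  have HP : dfn1 O (fun y => lo (f x) (f y)) by rewrite /dfn1; dfn_tac.
  case: (holds_right_em x OM HP) => // h.
  have ib : holds_right O x (fun y => dlt O x y /\ dlt O y b3) by exists b3.
  apply: holds_right_sub (holds_right_and h ib) => y [nl [xy yb]].
  case: (lo_tri L (f x) (f y)) => [/nl//|[E|//]].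
  have E' := inj3 x y a1x xb (lo_trans ord a1x xy) yb E.
  by rewrite E' in xy; case: (lo_irr ord xy).
have nL x : dlt O a1 x -> dlt O x b3 -> ~ LP x -> holds_left O x (fun y => lo (f y) (f x)).
  move=> a1x xb n.
  have HP : dfn1 O (fun y => lo (f x) (f y)) by rewrite /dfn1; dfn_tac.
  case: (holds_left_em x OM HP) => // h.
  have ib : holds_left O x (fun y => dlt O y x /\ dlt O a1 y) by exists a1.
  apply: holds_left_sub (holds_left_and h ib) => y [nl [yx ay]].
  case: (lo_tri L (f x) (f y)) => [/nl//|[E|//]].
  have E' := inj3 x y a1x xb ay (lo_trans ord yx xb) E.
  by rewrite E' in yx; case: (lo_irr ord yx).
have Lf := linord_flip L.
exists a1, b3; split=> //; first exact: (lo_le_le ord b31 bb1).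
right; case: h2' => hR; case: h3 => hL.
- by case: (no_local_min_itv OM L Hf a1b3 inj3) => x h4 h5; split; [apply: hR|apply: hL].
- left; apply: incr_of_local OM L Hf _ => x h4 h5; split; first exact: hR.
  by apply: nL => //; apply: hL.
- right; apply: incr_of_local OM Lf Hg _ => x h4 h5; split; last exact: hL.
  by apply: nR => //; apply: hR.
- case: (no_local_min_itv OM Lf Hg a1b3 inj3) => x h4 h5; split.
    by apply: nR => //; apply: hR.
  by apply: nL => //; apply: hL.
Qed.

End Mono.

(** * Continuity of definable functions of one variable *)

Definition cont1 (T : Type) (O : dstr T) (f : T -> T) x :=
  forall c d, dlt O c (f x) -> dlt O (f x) d -> exists u v,
    [/\ dlt O u x, dlt O x v &
        forall y, dlt O u y -> dlt O y v -> dlt O c (f y) /\ dlt O (f y) d].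

Section Cont1.
Variables (T : Type) (O : dstr T) (f : T -> T).
Hypotheses (OM : omin O) (Hf : dt1 O f).
Local Notation "x ≺ y" := (dlt O x y) (at level 70).
Local Ltac ord := ord_with (dlo O) (dlt O).

(** The image of a monotone function is infinite, hence contains an interval,
    over which the function is an order isomorphism. *)
Lemma cont_of_incr (lo : T -> T -> Prop) a b :
  (lo = dlt O \/ lo = fun x y => y ≺ x) -> a ≺ b -> incr_on f lo O a b ->
  exists a' b', [/\ a' ≺ b', ~ a' ≺ a, ~ b ≺ b' &
    forall x, a' ≺ x -> x ≺ b' -> cont1 O f x].
Proof.
move=> Elo ab inc.
have L : linord lo by case: Elo => ->; [exact: dlo | exact: linord_flip (dlo O)].
have inj x y : a ≺ x -> x ≺ b -> a ≺ y -> y ≺ b -> lo (f x) (f y) -> x ≺ y.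
  move=> ax xb ay yb h; case: (tri O x y) => [//|[E|yx]].
    by rewrite E in h; case: (lo_irr L h).
  by case: (lo_irr L (lo_trans L h (inc y x ay yx xb))).
pose I z := exists x, [/\ a ≺ x, x ≺ b & f x = z].
have HI : dfn1 O I.
  rewrite /dfn1; apply: (@dfn_ext _ O _ (fun e : unit -> T => exists x, a ≺ x /\ (x ≺ b /\
      f x = e tt))).
    by move=> e; split=> [[x [? [? ?]]]|[x [? ? ?]]]; exists x.
  by dfn_tac.
have [u [v [uv hI]]] : exists u v, u ≺ v /\ forall z, u ≺ z -> z ≺ v -> I z.
  case: (tame_itv (OM HI)) => // fin; exfalso; apply: (itv_infinite ab).
  apply: (finite_inj (f := f) fin) => [x [ax xb]|x y [ax xb] [ay yb] E].
    by exists x.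
  case: (tri O x y) => [h|[//|h]].
    by have := inc x y ax h yb; rewrite E => h'; case: (lo_irr L h').
  by have := inc y x ay h xb; rewrite E => h'; case: (lo_irr L h').
have [r [ur rv]] := dlt_dense uv; have [s [rs sv]] := dlt_dense rv.
have [x1 [ax1 x1b E1]] := hI r ur rv.
have us : u ≺ s by ord.
have [x2 [ax2 x2b E2]] := hI s us sv.
(* Name the two points so that the first one is smaller for [lo], whichever
   order this is. *)
suff key r' s' y1 y2 : lo r' s' -> u ≺ r' -> r' ≺ v -> u ≺ s' -> s' ≺ v ->
    a ≺ y1 -> y1 ≺ b -> a ≺ y2 -> y2 ≺ b -> f y1 = r' -> f y2 = s' ->
    exists a' b', [/\ a' ≺ b', ~ a' ≺ a, ~ b ≺ b' &
      forall x, a' ≺ x -> x ≺ b' -> cont1 O f x].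
  by case: Elo => E; subst lo; [apply: (key r s x1 x2)|apply: (key s r x2 x1)].
move=> lrs ur' rv' us' sv' ay1 y1b ay2 y2b F1 F2.
have y12 : y1 ≺ y2 by apply: inj => //; rewrite F1 F2.
exists y1, y2; split=> //; [by move=> ?; ord | by move=> ?; ord | move=> x y1x xy2].
have ax : a ≺ x by ord.
have xb : x ≺ b by ord.
have l1 := inc y1 x ay1 y1x xb. have l2 := inc x y2 ax xy2 y2b.
rewrite F1 in l1; rewrite F2 in l2.
have between z : lo r' z -> lo z s' -> u ≺ z /\ z ≺ v.
  by case: Elo => -> h h'; split; ord.
have loc c d : lo c (f x) -> lo (f x) d -> exists u v, [/\ u ≺ x, x ≺ v &
    forall y, u ≺ y -> y ≺ v -> lo c (f y) /\ lo (f y) d].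
  move=> lc ld.
  have [c' [lc' c'c c'r]] : exists c', [/\ lo c' (f x), ~ lo c' c & ~ lo c' r'].
    case: (EM (lo r' c)) => h; last by exists r'; split=> //; exact: (lo_irr L).
    exists c; split=> //; [exact: (lo_irr L)|].
    by move=> h'; case: (lo_irr L (lo_trans L h h')).
  have [d' [ld' dd' sd']] : exists d', [/\ lo (f x) d', ~ lo d d' & ~ lo s' d'].
    case: (EM (lo d s')) => h; last by exists s'; split=> //; exact: (lo_irr L).
    exists d; split=> //; [exact: (lo_irr L)|].
    by move=> h'; case: (lo_irr L (lo_trans L h h')).
  have [m1 [am1 m1b G1]] : I c'.
    case: (EM (lo r' c')) => h.
      by have [? ?] := between c' h (lo_trans L lc' l2); apply: hI.
    have -> : c' = r' by case: (lo_tri L c' r') => [/c'r//|[//|//]].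
    exact: hI.
  have [m2 [am2 m2b G2]] : I d'.
    case: (EM (lo d' s')) => h.
      by have [? ?] := between d' (lo_trans L l1 ld') h; apply: hI.
    have -> : d' = s' by case: (lo_tri L d' s') => [//|[//|/sd']].
    exact: hI.
  have m1x : m1 ≺ x by apply: inj => //; rewrite G1.
  have xm2 : x ≺ m2 by apply: inj => //; rewrite G2.
  exists m1, m2; split=> // y m1y ym2.
  have h1 : lo c' (f y) by rewrite -G1; apply: inc => //; ord.
  have h2 : lo (f y) d' by rewrite -G2; apply: inc => //; ord.
  by split; [exact: (lo_le_lt L c'c h1) | exact: (lo_lt_le L h2 dd')].
move=> c d hc hd; case: Elo => E; rewrite E in loc; first exact: loc.
have [u' [v' [h1 h2 h3]]] := loc d c hd hc.
by exists u', v'; split=> // y h4 h5; have [] := h3 y h4 h5.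
Qed.

Definition wmono a b :=
  (forall x y, a ≺ x -> x ≺ y -> y ≺ b -> ~ f y ≺ f x) \/
  (forall x y, a ≺ x -> x ≺ y -> y ≺ b -> ~ f x ≺ f y).

(** Being locally constant, increasing or decreasing, and continuous, are
    definable properties of a point, and one of them holds throughout an
    interval to the right of [p]; there the local behaviour is global. *)
Lemma cont_mono_right p :
  exists s, [/\ p ≺ s, forall x, p ≺ x -> x ≺ s -> cont1 O f x & wmono p s].
Proof.
pose nice (R : T -> T -> Prop) x := exists u v, u ≺ x /\ (x ≺ v /\
  ((forall y, u ≺ y -> y ≺ v -> cont1 O f y) /\
   (forall y z, u ≺ y -> y ≺ z -> z ≺ v -> R y z))).
have Hcont : dfn1 O (cont1 O f).
  rewrite /dfn1; apply: (@dfn_ext _ O _ (fun e : unit -> T => forall c d, c ≺ f (e tt) ->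
      f (e tt) ≺ d ->
    exists u v, u ≺ e tt /\ (e tt ≺ v /\ forall y, u ≺ y -> y ≺ v -> c ≺ f y /\ f y ≺ d))).
    by move=> e; split=> h c d hc hd; have [u [v h']] := h c d hc hd; exists u, v;
       [case: h' => ? [? ?] | case: h' => ? ? ?].
  by dfn_tac.
have HF : dfnr O (fun x y => f x ≺ f y) by rewrite /dfnr; dfn_tac.
have HF' : dfnr O (fun x y => f y ≺ f x) by rewrite /dfnr; dfn_tac.
have HE : dfnr O (fun x y => f x = f y) by rewrite /dfnr; dfn_tac.
have Hn R : dfnr O R -> dfn1 O (nice R).
  by move=> HR; rewrite /dfn1 /nice; dfn_tac.
case: (holds_right_em p OM (Hn _ HE)) => hE.
  have [s [ps hs]] := hE; exists s; split=> //.
    by move=> x px xs; have [u [v [ux [xv [h _]]]]] := hs x px xs; apply: h.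
  left => x y px xy ys; suff -> : f x = f y by apply: (lo_irr (dlo O)).
  have HP : dfn1 O (fun z => f z = f x) by rewrite /dfn1; dfn_tac.
  suff <- : f y = f x by []; apply/(connected OM HP xy) => //.
  move=> z zx yz; have [||u [v [uz [zv [_ h]]]]] := hs z; try by ord.
  exists u, v; split=> // w uw wv.
  by case: (tri O z w) => [zw|[->//|wz]]; [rewrite (h z w) | rewrite (h w z)].
case: (holds_right_em p OM (Hn _ HF)) => hF.
  have [s [ps hs]] := hF; exists s; split=> //.
    by move=> x px xs; have [u [v [ux [xv [h _]]]]] := hs x px xs; apply: h.
  left => x y px xy ys.
  have h : incr_on f (dlt O) O p s.
    apply: (incr_of_local OM (dlo O) HF) => z pz zs.
    have [u [v [uz [zv [_ h]]]]] := hs z pz zs.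
    by split; [exists v | exists u]; split=> // w h1 h2; apply: h.
  by have ? := h x y px xy ys; ord.
case: (holds_right_em p OM (Hn _ HF')) => hF'.
  have [s [ps hs]] := hF'; exists s; split=> //.
    by move=> x px xs; have [u [v [ux [xv [h _]]]]] := hs x px xs; apply: h.
  right => x y px xy ys.
  have h : incr_on f (fun u v => v ≺ u) O p s.
    apply: (incr_of_local OM (linord_flip (dlo O)) HF') => z pz zs.
    have [u [v [uz [zv [_ h]]]]] := hs z pz zs.
    by split; [exists v | exists u]; split=> // w h1 h2; apply: h.
  by have ? := h x y px xy ys; ord.
exfalso; have [s [ps hs]] := holds_right_and hE (holds_right_and hF hF').
have [a [b [ab ap bs mono]]] := monotone_subitv OM (dlo O) HF ps.
suff [x [px [xs [R [hR nx]]]]] : exists x, p ≺ x /\ (x ≺ s /\ exists R, (R = (fun x y =>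
    f x = f y) \/
    R = (fun x y => f x ≺ f y) \/ R = (fun x y => f y ≺ f x)) /\ nice R x).
  have [h1 [h2 h3]] := hs x px xs.
  by case: hR => [E|[E|E]]; rewrite E in nx.
case: mono => [cst|mono].
  have [x [ax xb]] := dlt_dense ab.
  exists x; split; [by ord|split; [by ord|exists (fun x y => f x = f y); split; [by left|]]].
  exists a, b; split=> //; split=> //; split=> [y ay yb c d hc hd|y z ay yz zb].
    exists a, b; split=> // z az zb; suff -> : f z = f y by [].
    exact: cst.
  by apply: cst => //; ord.
have [lo [Elo inc]] : exists lo, (lo = dlt O \/ lo = fun x y => y ≺ x) /\ incr_on f lo O a b.
  by case: mono => h; [exists (dlt O)|exists (fun x y => y ≺ x)]; split=> //; [left|right].
have [a' [b' [a'b' aa' bb' hc]]] := cont_of_incr Elo ab inc.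
have [x [ax xb]] := dlt_dense a'b'.
exists x; split; [by ord|split; [by ord|exists (fun x y => lo (f x) (f y)); split]].
  by case: Elo => ->; right; [left|right].
exists a', b'; split=> //; split=> //; split=> // y z h1 h2 h3.
by apply: inc => //; ord.
Qed.

End Cont1.

(** * Boxes and generic behaviour in several variables *)

Section Boxes.
Variables (T : Type) (O : dstr T).
Local Notation "x ≺ y" := (dlt O x y) (at level 70).
Local Ltac ord := ord_with (dlo O) (dlt O).

Definition box_ok n (a b : fin n -> T) := forall i, a i ≺ b i.

Definition in_box n (a b y : fin n -> T) := forall i, a i ≺ y i /\ y i ≺ b i.

Definition subbox n (a' b' a b : fin n -> T) := forall y, in_box a' b' y -> in_box a b y.

Definition on_subbox n (a b : fin n -> T) (P : (fin n -> T) -> Prop) :=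
  exists a' b', [/\ box_ok a' b', subbox a' b' a b & forall y, in_box a' b' y -> P y].

Definition cont_at n (f : (fin n -> T) -> T) y :=
  forall c d, c ≺ f y -> f y ≺ d -> exists a b : fin n -> T,
    in_box a b y /\ forall z, in_box a b z -> c ≺ f z /\ f z ≺ d.

(** [box_em] and [box_cont] are proved together, by induction on the dimension. *)
Definition box_em n := forall X, dfn O X -> forall a b : fin n -> T, box_ok a b ->
  on_subbox a b X \/ on_subbox a b (fun y => ~ X y).

Definition box_cont n := forall f, dt O f -> forall a b : fin n -> T, box_ok a b ->
  on_subbox a b (cont_at f).

Lemma subbox_trans n (a b c d e f : fin n -> T) :
  subbox a b c d -> subbox c d e f -> subbox a b e f.
Proof. by move=> h1 h2 y /h1 /h2. Qed.

Lemma in_box_ok n (a b y : fin n -> T) : in_box a b y -> box_ok a b.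
Proof. by move=> h i; have [? ?] := h i; ord. Qed.

Lemma box_ok_in n (a b : fin n -> T) : box_ok a b -> exists y, in_box a b y.
Proof. by move=> h; have /choice [y hy] := fun i => dlt_dense (h i); exists y. Qed.

Lemma in_box_meet n (a b c d y : fin n -> T) : in_box a b y -> in_box c d y ->
  exists a' b', [/\ in_box a' b' y, subbox a' b' a b & subbox a' b' c d].
Proof.
move=> h1 h2.
have /choice [a' ha'] : forall i, exists z, [/\ z ≺ y i, ~ z ≺ a i & ~ z ≺ c i].
  move=> i; have [? ?] := h1 i; have [? ?] := h2 i.
  by case: (EM (a i ≺ c i)) => h; [exists (c i)|exists (a i)]; split=> //; ord.
have /choice [b' hb'] : forall i, exists z, [/\ y i ≺ z, ~ b i ≺ z & ~ d i ≺ z].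
  move=> i; have [? ?] := h1 i; have [? ?] := h2 i.
  by case: (EM (b i ≺ d i)) => h; [exists (b i)|exists (d i)]; split=> //; ord.
exists a', b'; split=> [i|z hz i|z hz i]; have [? ? ?] := ha' i; have [? ? ?] := hb' i => //.
  by have [? ?] := hz i; split; ord.
by have [? ?] := hz i; split; ord.
Qed.

Lemma on_subbox_sub n (a b a' b' : fin n -> T) P : subbox a' b' a b ->
  on_subbox a' b' P -> on_subbox a b P.
Proof.
by move=> s [c [d [h1 h2 h3]]]; exists c, d; split=> //; apply: subbox_trans h2 s.
Qed.

Lemma on_subbox_imp n (a b : fin n -> T) (P Q : (fin n -> T) -> Prop) :
  (forall y, in_box a b y -> P y -> Q y) -> on_subbox a b P -> on_subbox a b Q.
Proof.
move=> h [c [d [h1 h2 h3]]]; exists c, d; split=> // y hy.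
by apply: h; [exact: h2 | exact: h3].
Qed.

Lemma on_subbox_bind n (a b : fin n -> T) (P Q : (fin n -> T) -> Prop) :
  on_subbox a b P ->
  (forall a' b', box_ok a' b' -> subbox a' b' a b -> (forall y, in_box a' b' y -> P y) ->
     on_subbox a' b' Q) -> on_subbox a b Q.
Proof.
move=> [c [d [h1 h2 h3]]] h; by apply: (on_subbox_sub h2); apply: h.
Qed.

Lemma in_box_oc n p q (a b : fin n -> T) x y :
  @in_box n.+1 (oc p a) (oc q b) (oc x y) <-> ((p ≺ x /\ x ≺ q) /\ in_box a b y).
Proof.
split=> [h|[[h1 h2] h3]]; last by case=> [i|]; [exact: h3|].
by split=> [|i]; [exact: (h None) | exact: (h (Some i))].
Qed.

Lemma in_box_S n (a b : fin n.+1 -> T) e : in_box a b e <->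
  ((a None ≺ e None /\ e None ≺ b None) /\
   @in_box n (fun i => a (Some i)) (fun i => b (Some i)) (fun i => e (Some i))).
Proof.
split=> [h|[h1 h2]]; last by case=> [i|]; [exact: h2|].
by split=> [|i]; [exact: (h None) | exact: (h (Some i))].
Qed.

Lemma on_subbox_S n (a b : fin n.+1 -> T) p q (P : (fin n.+1 -> T) -> Prop) :
  ~ p ≺ a None -> ~ b None ≺ q -> p ≺ q ->
  on_subbox (fun i : fin n => a (Some i)) (fun i => b (Some i))
    (fun y => forall x, p ≺ x -> x ≺ q -> P (oc x y)) -> on_subbox a b P.
Proof.
move=> h1 h2 pq [c [d [h3 h4 h5]]].
exists (oc p c), (oc q d); split=> [[i|] //=|e|e].
- rewrite [e]oc_eta => /in_box_oc [[? ?] /h4 h].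
  by case=> [i|] /=; [exact: h | split; ord].
- by rewrite [e]oc_eta => /in_box_oc [[? ?] /h5]; apply.
Qed.

(** The supremum of the admissible values is a definable function of [y], hence
    continuous somewhere; near a point of continuity any value slightly below
    the supremum is admissible. *)
Lemma uniform_threshold n (beta : (fin n -> T) -> T) (R : (fin n -> T) -> T -> Prop) a b :
  omin O -> box_cont n -> dt O beta -> dfn2 O R ->
  (forall y s s', s ≺ s' -> R y s' -> R y s) -> box_ok a b ->
  (forall y, in_box a b y -> exists2 v, beta y ≺ v & R y v) ->
  exists u v, u ≺ v /\ on_subbox a b (fun y => beta y ≺ u /\ R y v).
Proof.
move=> OM C Hb HR down ok hR.
have [a1 [b1 [ok1 s1 c1]]] := C beta Hb a b ok.
have [y1 hy1] := box_ok_in ok1.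
have [q bq] := dlt_nomax O (beta y1); have [q0 q0b] := dlt_nomin O (beta y1).
have [a2 [b2 [hy2 hq]]] := c1 y1 hy1 _ _ q0b bq.
have [a3 [b3 [hy3 s31 s32]]] := in_box_meet hy1 hy2.
pose A y v := ~ q ≺ v /\ R y v.
have HA : dfn2 O A by rewrite /dfn2 /A; dfn_tac.
pose G y s := (forall v, A y v -> ~ s ≺ v) /\
  (forall r, r ≺ s -> exists v, A y v /\ r ≺ v).
have HG : dfn2 O G by rewrite /dfn2 /G; dfn_tac.
have [|lam Hl hl] := definable_choice HG.
  move=> y s s' [h1 h2] [h3 h4]; case: (tri O s s') => [|[//|]].
    by move=> /h4 [v [av sv]]; case: (h1 v av sv).
  by move=> /h2 [v [av sv]]; case: (h3 v av sv).
have lamP y : in_box a3 b3 y -> G y (lam y) /\ beta y ≺ lam y.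
  move=> hy; have yab : in_box a b y by apply: s1; apply: s31.
  have [v bv Rv] := hR y yab; have [_ byq] := hq y (s32 y hy).
  have [v0 [Av0 bv0]] : exists v0, A y v0 /\ beta y ≺ v0.
    case: (EM (q ≺ v)) => qv; last by exists v.
    by exists q; split=> //; split; [ord | exact: down Rv].
  have HAy : dfn1 O (A y) by rewrite /dfn1; dfn_tac.
  have [|s [s2 s3]] := sup_ex OM HAy (ex_intro _ v0 Av0); first by exists q => x [].
  have Gl : G y (lam y).
    by apply: hl; exists s; split=> // r /s3 [x ax rx]; exists x.
  by split=> //; have /= ? := Gl.1 v0 Av0; ord.
have [a4 [b4 [ok4 s4 c4]]] := C lam Hl a3 b3 (in_box_ok hy3).
have [y4 hy4] := box_ok_in ok4.
have [_ bl4] := lamP y4 (s4 _ hy4).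
have [u [bu ul]] := dlt_dense bl4; have [v [uv vl]] := dlt_dense ul.
have [w lw] := dlt_nomax O (lam y4); have [w' w'b] := dlt_nomin O (beta y4).
have [a5 [b5 [hy5 h5]]] := c4 y4 hy4 _ _ vl lw.
have [a6 [b6 [hy6 h6]]] := c1 y4 (s31 _ (s4 _ hy4)) _ _ w'b bu.
have [a7 [b7 [hy7 s75 s76]]] := in_box_meet hy5 hy6.
have [a8 [b8 [hy8 s87 s84]]] := in_box_meet hy7 hy4.
exists u, v; split=> //; exists a8, b8; split; first exact: in_box_ok hy8.
  by move=> y /s84 /s4 /s31 /s1.
move=> y hy; have [_ h] := h6 y (s76 _ (s87 _ hy)); split=> //.
have [vl' _] := h5 y (s75 _ (s87 _ hy)).
have [[_ g] _] := lamP y (s4 _ (s84 _ hy)).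
have [v' [[_ Rv'] vv']] := g v vl'; exact: down vv' Rv'.
Qed.

(** Near the left end of each fibre [X] is constant, and by
    [uniform_threshold] uniformly so over a subbox. *)
Lemma box_emS n : omin O -> box_em n -> box_cont n -> box_em n.+1.
Proof.
move=> OM E C X HX a b ok.
pose p := a None; pose q := b None.
pose R y s := (forall x, p ≺ x -> x ≺ s -> X (oc x y)) \/
              (forall x, p ≺ x -> x ≺ s -> ~ X (oc x y)).
have HR : dfn2 O R by rewrite /dfn2 /R; dfn_tac.
have ok' : box_ok (fun i : fin n => a (Some i)) (fun i => b (Some i)) by move=> i; apply: ok.
have [|y s s' ss' Rs'|y _|u [v [uv h]]] := @uniform_threshold n (fun _ =>
    p) R _ _ OM C _ HR _ ok' _.
- by rewrite /dt; dfn_tac.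
- by case: Rs' => h; [left|right] => x px xs; apply: h => //; ord.
- have HP : dfn1 O (fun x => X (oc x y)) by rewrite /dfn1; dfn_tac.
  have [c [pc _ hc]] := germ_right OM HP (ok None : p ≺ q).
  by exists c.
have pu : p ≺ u.
  have [c [d [okc _ hcd]]] := h; have [y hy] := box_ok_in okc; by have [] := hcd y hy.
have pq : p ≺ q := ok None.
have [w [pw wv wq]] := lt_common_right (lo_trans (dlo O) pu uv) pq.
pose X1 (y : fin n -> T) := forall x, p ≺ x -> x ≺ w -> X (oc x y).
have HX1 : dfn O X1 by rewrite /X1; dfn_tac.
have [c [d [okc scd hcd]]] := h.
have lift P : on_subbox c d (fun y => forall x, p ≺ x -> x ≺ w -> P (oc x y)) ->
    on_subbox a b P.
  move=> h'; apply: (@on_subbox_S n a b p w) => //; first by rewrite -/p; ord.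
    by rewrite -/q; ord.
  exact: on_subbox_sub scd h'.
case: (E X1 HX1 c d okc) => h1; [left|right]; apply: lift => //.
apply: on_subbox_imp h1 => y hy nX1 x px xw Xx; case: (hcd y hy) => _ [h1|h1].
  by apply: nX1 => z pz zw; apply: h1 => //; ord.
by apply: (h1 x) => //; ord.
Qed.

(** On a suitable box [f] is monotone and continuous in the new variable and
    continuous in the others, so its values near a point are squeezed between
    its values on two nearby horizontal slices. *)
Lemma box_contS n : omin O -> box_em n -> box_cont n -> box_cont n.+1.
Proof.
move=> OM E C f Hf a b ok.
pose p := a None; pose q := b None.
have pq : p ≺ q := ok None.
have ok' : box_ok (fun i : fin n => a (Some i)) (fun i => b (Some i)) by move=> i; apply: ok.
pose up y s := forall x x', p ≺ x -> x ≺ x' -> x' ≺ s -> ~ f (oc x' y) ≺ f (oc x y).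
pose dn y s := forall x x', p ≺ x -> x ≺ x' -> x' ≺ s -> ~ f (oc x y) ≺ f (oc x' y).
pose ct (y : fin n -> T) x := forall c d, c ≺ f (oc x y) -> f (oc x y) ≺ d -> exists u v,
  u ≺ x /\ (x ≺ v /\ forall z, u ≺ z -> z ≺ v -> c ≺ f (oc z y) /\ f (oc z y) ≺ d).
pose R y s := (forall x, p ≺ x -> x ≺ s -> ct y x) /\ (up y s \/ dn y s).
have Hup : dfn2 O up by rewrite /dfn2 /up; dfn_tac.
have Hdn : dfn2 O dn by rewrite /dfn2 /dn; dfn_tac.
have Hct : dfn2 O ct by rewrite /dfn2 /ct; dfn_tac.
have HR : dfn2 O R by rewrite /dfn2 /R; dfn_tac.
have [|y s s' ss' [h1 h2]|y _|u [v [uv h]]] := @uniform_threshold n (fun _ =>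
    p) R _ _ OM C _ HR _ ok' _.
- by rewrite /dt; dfn_tac.
- split=> [x px xs|]; first by apply: h1 => //; ord.
  by case: h2 => h2; [left|right] => x x' px xx' xs; apply: h2 => //; ord.
- have Hg : dt1 O (fun x => f (oc x y)) by rewrite /dt1; dt_tac.
  have [s [ps hc hm]] := cont_mono_right OM Hg p.
  exists s => //; split=> // x px xs c d hcx hdx.
  by have [u [v [? ? ?]]] := hc x px xs c d hcx hdx; exists u, v.
have pu : p ≺ u.
  have [c [d [okc _ hcd]]] := h; have [y hy] := box_ok_in okc; by have [] := hcd y hy.
have [w [pw wv wq]] := lt_common_right (lo_trans (dlo O) pu uv) pq.
have [c [d [okc scd hcd]]] := h.
have Hupw : dfn O (fun y => up y w) by dfn_tac.
have [c1 [d1 [okc1 scd1 mono]]] : exists c' d', [/\ box_ok c' d', subbox c' d' c d &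
    (forall y, in_box c' d' y -> up y w) \/ (forall y, in_box c' d' y -> dn y w)].
  have dnw y : in_box c d y -> ~ up y w -> dn y w.
    move=> hy nup; have [_ [_ [h2|h2]]] := hcd y hy.
      by case: nup => x x' px xx' xw; apply: h2 => //; ord.
    by move=> x x' px xx' xw; apply: h2 => //; ord.
  case: (E _ Hupw c d okc) => -[c' [d' [h1 h2 h3]]]; exists c', d'; split=> //.
    by left.
  by right => y hy; apply: dnw; [exact: h2|exact: h3].
pose Y (e : fin n.+1 -> T) := forall lo hi, lo ≺ f e -> f e ≺ hi -> exists a b : fin n -> T,
  in_box a b (fun i => e (Some i)) /\ forall z, in_box a b z -> lo ≺ f (oc (e None) z) /\
      f (oc (e None) z) ≺ hi.
have HY : dfn O Y by rewrite /Y /in_box; dfn_tac.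
have ok1 : @box_ok n.+1 (oc p c1) (oc w d1) by case=> [i|] //=; apply: okc1.
have sub1 : @subbox n.+1 (oc p c1) (oc w d1) a b.
  move=> e; rewrite [e]oc_eta => /in_box_oc [[? ?] /scd1 /scd h'].
  by case=> [i|] /=; [exact: h' | rewrite -/p -/q; split; ord].
apply: (on_subbox_sub sub1).
case: (@box_emS n OM E C Y HY _ _ ok1) => -[c2 [d2 [ok2 sub2 h2]]]; last first.
  have [e he] := box_ok_in ok2; have [_ hrest] := (in_box_S c2 d2 e).1 he.
  have Hg : dt O (fun y : fin n -> T => f (oc (e None) y)) by dt_tac.
  have ok2' : box_ok (fun i : fin n => c2 (Some i)) (fun i => d2 (Some i)) by move=> i; apply: ok2.
  have [c3 [d3 [ok3 sub3 h3]]] := C _ Hg _ _ ok2'.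
  have [y hy] := box_ok_in ok3.
  case: (h2 (oc (e None) y)).
    by apply/in_box_S; split; [exact: (he None)|exact: sub3].
  by move=> lo hi hlo hhi; exact: h3 y hy lo hi hlo hhi.
exists c2, d2; split=> // e he lo hi hlo hhi.
pose x0 := e None; pose y0 := fun i : fin n => e (Some i).
have eE : e = oc x0 y0 by exact: oc_eta.
have he1 := sub2 e he; move: (he1); rewrite {1}eE => /in_box_oc [[px0 x0w] hy0].
have [_ [hct _]] := hcd y0 (scd1 _ hy0).
have x0v : x0 ≺ v by ord.
rewrite eE in hlo hhi.
have [x1 [x2 [x1x0 [x0x2 hx]]]] := hct x0 px0 x0v lo hi hlo hhi.
have [[c2x0 x0d2] hy2] := (in_box_S c2 d2 e).1 he; rewrite -/x0 -/y0 in c2x0 x0d2 hy2.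
have [z1 [z1x0 x1z1 c2z1]] := @lt_common_right _ (op O) x0 x1 (c2 None) x1x0 c2x0.
have [z2 [x0z2 z2x2 z2d2]] := lt_common_right x0x2 x0d2.
rewrite /= in z1x0 x1z1 c2z1.
have Yz z : c2 None ≺ z -> z ≺ d2 None -> Y (oc z y0).
  by move=> hz1 hz2; apply: h2; apply/in_box_S; split.
have [l1 l1'] : lo ≺ f (oc z1 y0) /\ f (oc z1 y0) ≺ hi by apply: hx; ord.
have [l2 l2'] : lo ≺ f (oc z2 y0) /\ f (oc z2 y0) ≺ hi by apply: hx; ord.
have [a3 [b3 [hy3 hn3]]] := Yz z1 c2z1 (ltac:(ord)) lo hi l1 l1'.
have [a4 [b4 [hy4 hn4]]] := Yz z2 (ltac:(ord)) z2d2 lo hi l2 l2'.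
have [a5 [b5 [hy5 s53 s54]]] := in_box_meet hy3 hy4.
have [a6 [b6 [hy6 s65 s62]]] := in_box_meet hy5 hy2.
exists (oc z1 a6), (oc z2 b6); split; first by rewrite eE; apply/in_box_oc.
move=> g; rewrite [g]oc_eta; move: (g None) (fun v => g (Some v)) => x y.
move=> /in_box_oc [[z1x xz2] hy].
have hy62 := s62 y hy.
have hb : in_box c1 d1 y.
  have /sub2 : in_box c2 d2 (oc x0 y) by apply/in_box_S; split.
  by case/in_box_oc.
have [g1 g1'] := hn3 y (s53 _ (s65 _ hy)).
have [g2 g2'] := hn4 y (s54 _ (s65 _ hy)).
rewrite /= in g1 g1' g2 g2'.
have [pz1 z2w] : p ≺ z1 /\ z2 ≺ w.
  have /sub2 /in_box_oc [[? _] _] : in_box c2 d2 (oc z1 y) by apply/in_box_S; split=> //;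
      split=> //=; ord.
  by have /sub2 /in_box_oc [[_ ?] _] : in_box c2 d2 (oc z2 y) by apply/in_box_S; split=> //;
      split=> //=; ord.
have xw : x ≺ w by ord.
have px : p ≺ x by ord.
case: mono => m; have k1 := m y hb z1 x pz1 z1x xw; have k2 := m y hb x z2 px xz2 z2w.
  by split; ord.
by split; ord.
Qed.

End Boxes.

Theorem box_generic T (O : dstr T) n : omin O -> box_em O n /\ box_cont O n.
Proof.
move=> OM; elim: n => [|n [E C]].
  have triv (a b : fin 0 -> T) (P : _ -> Prop) : P a -> on_subbox O a b P.
    by move=> pa; exists a, b; split=> [[]|//|y _]; rewrite (fin0_eq y a).
  split=> [X HX a b _|f Hf a b _].
    by case: (EM (X a)) => h; [left|right]; apply: triv.
  apply: triv => c d hc hd; exists a, b; split=> [[]|z _].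
  by rewrite (fin0_eq z a).
by split; [exact: box_emS | exact: box_contS].
Qed.


(** * Generic fibres *)

Lemma in_box_op T (O : dstr T) n (a b y : fin n -> T) :
  in_box (op O) b a y <-> in_box O a b y.
Proof. by split=> h i; have [] := h i. Qed.

Lemma on_subbox_op T (O : dstr T) n (a b : fin n -> T) P :
  on_subbox (op O) b a P -> on_subbox O a b P.
Proof.
move=> [c [d [h1 h2 h3]]]; exists d, c; split=> // y /in_box_op; last exact: h3.
by move=> /h2 /in_box_op.
Qed.

Lemma box_of_fibres_above T (O : dstr T) n c0 (X : (fin n.+1 -> T) -> Prop) a b :
  omin O -> dfn O X -> box_ok O a b ->
  (forall y : fin n -> T, in_box O a b y -> exists u v, ~ dlt O u c0 /\ (dlt O u v /\
     forall x, dlt O u x -> dlt O x v -> X (oc x y))) ->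
  exists u v, dlt O u v /\ on_subbox O a b
    (fun y => forall x, dlt O u x -> dlt O x v -> X (oc x y)).
Proof.
move=> OM HX ok hX; have [_ C] := box_generic n OM.
pose A (y : fin n -> T) u := ~ dlt O u c0 /\ exists v, dlt O u v /\
     forall x, dlt O u x -> dlt O x v -> X (oc x y).
have HA : dfn2 O A by rewrite /dfn2 /A; dfn_tac.
pose G y s := (forall v, A y v -> ~ dlt O v s) /\
  (forall r, dlt O s r -> exists v, A y v /\ dlt O v r).
have HG : dfn2 O G by rewrite /dfn2 /G; dfn_tac.
have [|al Hal hal] := definable_choice HG.
  move=> y s s' [h1 h2] [h3 h4]; case: (tri O s s') => [|[//|]].
    by move=> /h2 [v [av sv]]; case: (h3 v av sv).
  by move=> /h4 [v [av sv]]; case: (h1 v av sv).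
pose R (y : fin n -> T) v := forall x, dlt O (al y) x -> dlt O x v -> X (oc x y).
have HR : dfn2 O R by rewrite /dfn2 /R; dfn_tac.
have [|y hy|u [v [uv h]]] := uniform_threshold OM C Hal HR _ ok.
- move=> y s s' ss' h x ax xs; apply: h => //; exact: (lo_trans (dlo O) xs ss').
- have [u0 [v0 [cu0 [uv0 hX0]]]] := hX y hy.
  have Au0 : A y u0 by split=> //; exists v0.
  have HAy : dfn1 (op O) (A y) by have H : dfn1 O (A y) by [rewrite /dfn1; dfn_tac]; exact: H.
  have [|s [s1 s2]] := sup_ex (omin_op OM) HAy (ex_intro _ u0 Au0).
    by exists c0 => x [].
  have [g1 g2] : G y (al y).
    by apply: hal; exists s; split=> // r /s2 [x ax rx]; exists x.
  have HXy : dfn1 O (fun x => X (oc x y)) by rewrite /dfn1; dfn_tac.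
  case: (holds_right_em (al y) OM HXy) => [[v [av hv]]|[v [av hv]]]; first by exists v.
  exfalso; have [u1 [[cu1 [v1 [uv1 hv1]]] u1v]] := g2 v av.
  have [x [u1x xv xv1]] := lt_common_right u1v uv1.
  apply: (hv x) => //; last exact: hv1.
  apply: (lo_le_lt (dlo O)) u1x; apply: g1; split=> //; by exists v1.
exists u, v; split=> //; apply: on_subbox_imp h => y hy [au Rv] x ux xv.
by apply: Rv => //; exact: (lo_trans (dlo O) au ux).
Qed.

(** The left end of the first interval in the fibre that lies on a given side of
    a fixed point is a definable function of [y], to which [uniform_threshold]
    applies. *)
Lemma box_of_fibres T (O : dstr T) n (X : (fin n.+1 -> T) -> Prop) a b :
  omin O -> dfn O X -> box_ok O a b ->
  (forall y : fin n -> T, in_box O a b y -> exists u v, dlt O u v /\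
     forall x, dlt O u x -> dlt O x v -> X (oc x y)) ->
  exists u v, dlt O u v /\ on_subbox O a b
    (fun y => forall x, dlt O u x -> dlt O x v -> X (oc x y)).
Proof.
move=> OM HX ok hX; have [E _] := box_generic n OM; have [c0 _] := dpt O.
pose Z (y : fin n -> T) := exists u v, ~ dlt O u c0 /\ (dlt O u v /\
     forall x, dlt O u x -> dlt O x v -> X (oc x y)).
have HZ : dfn O Z by rewrite /Z; dfn_tac.
case: (E Z HZ a b ok) => -[a1 [b1 [ok1 s1 h1]]].
  have [u [v [uv h]]] := box_of_fibres_above OM HX ok1 h1.
  by exists u, v; split=> //; apply: on_subbox_sub h.
have [y hy|u [v [vu h]]] := @box_of_fibres_above T (op O) n c0 X b1 a1 (omin_op OM) HX ok1.
  have {}hy : in_box O a1 b1 y by exact/in_box_op.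
  have [u [v [uv hx]]] := hX y (s1 _ hy).
  exists v, u; split=> [/= cv|]; last by split=> // x xv ux; apply: hx.
  apply: (h1 y hy); case: (EM (dlt O u c0)) => uc; last by exists u, v.
  exists c0, v; split; first exact: (lo_irr (dlo O)).
  by split=> // x cx xv; apply: hx => //; exact: (lo_trans (dlo O) uc cx).
exists v, u; split=> //; apply: (on_subbox_sub s1); apply: on_subbox_op.
by apply: on_subbox_imp h => y _ h x vx xu; apply: h.
Qed.

Section Dense.
Variables (T : Type) (O : dstr T).
Hypothesis OM : omin O.
Local Notation "x ≺ y" := (dlt O x y) (at level 70).
Local Ltac ord := ord_with (dlo O) (dlt O).

(** For a definable set: its complement contains no box. *)
Definition dense n (P : (fin n -> T) -> Prop) :=
  forall a b, box_ok O a b -> on_subbox O a b P.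

Definition nearby n (y : fin n -> T) (P : (fin n -> T) -> Prop) :=
  exists a b : fin n -> T, in_box O a b y /\ forall z, in_box O a b z -> P z.

Lemma nearby_self n (y : fin n -> T) P : nearby y P -> P y.
Proof. by move=> [a [b [h1 h2]]]; apply: h2. Qed.

Lemma nearby_imp n (y : fin n -> T) (P Q : _ -> Prop) :
  (forall z, P z -> Q z) -> nearby y P -> nearby y Q.
Proof. by move=> h [a [b [h1 h2]]]; exists a, b; split=> // z /h2 /h. Qed.

Lemma nearby_and n (y : fin n -> T) P Q : nearby y P -> nearby y Q ->
  nearby y (fun z => P z /\ Q z).
Proof.
move=> [a [b [h1 h2]]] [c [d [h3 h4]]]; have [a' [b' [h5 h6 h7]]] := in_box_meet h1 h3.
by exists a', b'; split=> // z hz; split; [apply: h2; apply: h6 | apply: h4; apply: h7].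
Qed.

Lemma nearby_true n (y : fin n -> T) (P : _ -> Prop) : (forall z, P z) -> nearby y P.
Proof.
move=> h.
have /choice [a ha] := fun i => dlt_nomin O (y i).
have /choice [b hb] := fun i => dlt_nomax O (y i).
by exists a, b; split.
Qed.

Lemma nearby_nearby n (y : fin n -> T) P : nearby y P -> nearby y (fun z => nearby z P).
Proof. by move=> [a [b [h1 h2]]]; exists a, b; split=> // z hz; exists a, b. Qed.

Lemma nearby_list n (y : fin n -> T) (l : list T) (P : T -> (fin n -> T) -> Prop) :
  (forall t, List.In t l -> nearby y (P t)) ->
  nearby y (fun z => forall t, List.In t l -> P t z).
Proof.
elim: l => [|t l IH] h; first by apply: nearby_true.
apply: nearby_imp (nearby_and (h t (or_introl erefl)) (IH (fun s hs => h s (or_intror hs)))).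
by move=> z [h1 h2] s [<-|/h2].
Qed.

Lemma dense_imp n (P Q : (fin n -> T) -> Prop) :
  (forall y, P y -> Q y) -> dense P -> dense Q.
Proof. by move=> h D a b ok; apply: on_subbox_imp (D a b ok) => y _; apply: h. Qed.

Lemma dense_and n (P Q : (fin n -> T) -> Prop) :
  dense P -> dense Q -> dense (fun y => P y /\ Q y).
Proof.
move=> DP DQ a b ok; apply: (on_subbox_bind (DP a b ok)) => c d ok' s h.
by apply: on_subbox_imp (DQ c d ok') => y hy qy; split=> //; apply: h.
Qed.

Lemma dense_near n (P : (fin n -> T) -> Prop) : dense P -> dense (fun y => nearby y P).
Proof.
move=> D a b ok; have [c [d [h1 h2 h3]]] := D a b ok.
by exists c, d; split=> // y hy; exists c, d.
Qed.

Lemma dense_ex n (P : (fin n -> T) -> Prop) a b : dense P -> box_ok O a b ->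
  exists2 y, in_box O a b y & P y.
Proof.
move=> D ok; have [c [d [h1 h2 h3]]] := D a b ok.
by have [y hy] := box_ok_in h1; exists y; [exact: h2 | exact: h3].
Qed.

Lemma dense_lift n (P : (fin n -> T) -> Prop) : dense P ->
  @dense n.+1 (fun e => P (fun i => e (Some i))).
Proof.
move=> D a b ok; have ok' : box_ok O (fun i : fin n => a (Some i)) (fun i => b (Some i)).
  by move=> i; apply: ok.
apply: (@on_subbox_S T O n a b (a None) (b None)).
- exact: (lo_irr (dlo O)).
- exact: (lo_irr (dlo O)).
- exact: ok.
by apply: on_subbox_imp (D _ _ ok') => y _ py x _ _.
Qed.

Lemma dense_contra n (P : (fin n -> T) -> Prop) : dfn O P ->
  (forall a b, box_ok O a b -> ~ forall y, in_box O a b y -> ~ P y) -> dense P.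
Proof.
move=> HP h a b ok; have [E _] := box_generic n OM.
by case: (E P HP a b ok) => // -[c [d [h1 h2 h3]]]; case: (h c d h1).
Qed.

Lemma dense_cont n (f : (fin n -> T) -> T) : dt O f -> dense (cont_at O f).
Proof. by move=> Hf a b ok; have [_ C] := box_generic n OM; exact: C. Qed.

(** For definable sets this means being finite, in first-order terms. *)
Definition noitv (P : T -> Prop) :=
  forall u v, u ≺ v -> exists x, u ≺ x /\ (x ≺ v /\ ~ P x).

Lemma noitv_finite P : dfn1 O P -> noitv P -> finite P.
Proof.
move=> HP n; case: (tame_itv (OM HP)) => // -[a [b [ab h]]].
by have [x [ax [xb nx]]] := n a b ab; case: nx; apply: h.
Qed.

Lemma noitv_sub (P Q : T -> Prop) : (forall x, Q x -> P x) -> noitv P -> noitv Q.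
Proof.
by move=> h n u v /n [x [ux [xv nx]]]; exists x; split=> //; split=> // /h.
Qed.

Lemma noitv0 P : (forall x, ~ P x) -> noitv P.
Proof.
by move=> h u v uv; have [x [ux xv]] := dlt_dense uv; exists x; split=> //; split.
Qed.

Lemma noitv_right P x : dfn1 O P -> noitv P -> holds_right O x (fun y => ~ P y).
Proof.
move=> HP n; case: (holds_right_em x OM HP) => // -[u [xu hu]].
by have [y [xy [yu ny]]] := n x u xu; case: ny; apply: hu.
Qed.

Lemma noitv_left P x : dfn1 O P -> noitv P -> holds_left O x (fun y => ~ P y).
Proof.
move=> HP n; case: (holds_left_em x OM HP) => // -[u [xu hu]].
by have [y [xy [yu ny]]] := n u x xu; case: ny; apply: hu.
Qed.

(** A Fubini principle: otherwise [box_of_fibres] would find a box outside [G]. *)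
Lemma dense_fibres n (G : (fin n.+1 -> T) -> Prop) : dfn O G -> dense G ->
  dense (fun y => noitv (fun x => ~ G (oc x y))).
Proof.
move=> HG D; apply: dense_contra; first by rewrite /noitv; dfn_tac.
move=> a b ok h.
have HnG : dfn O (fun e => ~ G e) by dfn_tac.
have [y hy|u [v [uv [c [d [okc scd hcd]]]]]] := box_of_fibres OM HnG ok.
  apply: contrapT => nx; apply: (h y hy) => u v uv; apply: contrapT => nu.
  apply: nx; exists u, v; split=> // x ux xv gx; apply: nu.
  by exists x; split=> //; split=> // ngx.
have ok1 : @box_ok T O n.+1 (oc u c) (oc v d) by case=> [i|] //=; exact: okc.
have [e he ge] := dense_ex D ok1; rewrite [e]oc_eta in he ge.
move: he => /in_box_oc [[h1 h2] h3]; exact: (hcd _ h3 _ h1 h2 ge).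
Qed.

End Dense.

Arguments nearby {T} O {n}.
Arguments dense {T} O {n}.
Arguments noitv {T} O.

(** * Families of finite sets are locally trivial at generic parameters *)

Section Good.
Variables (T : Type) (O : dstr T).
Local Notation "x ≺ y" := (dlt O x y) (at level 70).
Local Ltac ord := ord_with (dlo O) (dlt O).
Variables (n : nat) (S : (fin n -> T) -> T -> Prop).

Definition vacant y x := exists u v, u ≺ x /\ (x ≺ v /\
  nearby O y (fun z => forall w, u ≺ w -> w ≺ v -> ~ S z w)).

(** Near [(y, x)], [S] is the graph of a function, with values as close to [x]
    as desired. *)
Definition graphlike y x := S y x /\ forall u v, u ≺ x -> x ≺ v ->
  exists u' v', ~ u' ≺ u /\ (~ v ≺ v' /\ (u' ≺ x /\ (x ≺ v' /\
    nearby O y (fun z => (exists w, u' ≺ w /\ (w ≺ v' /\ S z w)) /\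
      forall w w', u' ≺ w -> w ≺ v' -> S z w -> u' ≺ w' -> w' ≺ v' -> S z w' -> w = w')))).

Definition normal y x := vacant y x \/ graphlike y x.

Definition bdd_below y := exists u, nearby O y (fun z => forall w, w ≺ u -> ~ S z w).

Definition bdd_above y := exists u, nearby O y (fun z => forall w, u ≺ w -> ~ S z w).

Definition good y := bdd_below y /\ (bdd_above y /\ forall x, normal y x).

Hypotheses (OM : omin O) (HS : dfn2 O S) (fibS : forall y, noitv O (S y)).

Lemma normal_dfn : dfn2 O normal.
Proof. by rewrite /dfn2 /normal /graphlike /vacant /nearby /in_box; dfn_tac. Qed.

Lemma bdd_below_dfn : dfn O bdd_below.
Proof. by rewrite /bdd_below /nearby /in_box; dfn_tac. Qed.

Lemma bdd_above_dfn : dfn O bdd_above.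
Proof. by rewrite /bdd_above /nearby /in_box; dfn_tac. Qed.

Lemma good_dfn : dfn O good.
Proof.
have ? := normal_dfn; have ? := bdd_below_dfn; have ? := bdd_above_dfn.
by rewrite /good; dfn_tac.
Qed.

Lemma fib_dfn y : dfn1 O (S y). Proof. by rewrite /dfn1; dfn_tac. Qed.

(** The least point of the fibre is a generically continuous function. *)
Lemma bdd_below_dense : dense O bdd_below.
Proof.
have [||f Hf hf] := @definable_choice T O (fin n)
    (fun y m => S y m /\ forall x, S y x -> ~ x ≺ m).
- by rewrite /dfn2; dfn_tac.
- by move=> y s s' [s1 s2] [s3 s4]; have h1 := s2 s' s3; have h2 := s4 s s1; ord.
apply: dense_imp (dense_cont OM Hf) => y fc.
have [u uf] := dlt_nomin O (f y); have [v fv] := dlt_nomax O (f y).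
exists u; apply: nearby_imp (fc u v uf fv) => z [ufz _] w wu Szw.
have [m Sm hm] := finite_min O (noitv_finite OM (fib_dfn z) (@fibS z)) (ex_intro _ w Szw).
have [_ h] : S z (f z) /\ forall x, S z x -> ~ x ≺ f z by apply: hf; exists m.
by have h' := h w Szw; ord.
Qed.

End Good.

Lemma nearby_op T (O : dstr T) n (y : fin n -> T) P : nearby (op O) y P <-> nearby O y P.
Proof.
split=> -[a [b [h1 h2]]]; exists b, a; split=> [|z hz].
- exact/in_box_op.
- by apply: h2; exact/in_box_op.
- exact/in_box_op.
- by apply: h2; exact/in_box_op.
Qed.

Section GoodDense.
Variables (T : Type) (O : dstr T).
Local Notation "x ≺ y" := (dlt O x y) (at level 70).
Local Ltac ord := ord_with (dlo O) (dlt O).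
Variables (n : nat) (S : (fin n -> T) -> T -> Prop).
Hypotheses (OM : omin O) (HS : dfn2 O S) (fibS : forall y, noitv O (S y)).

Lemma dense_op (P : (fin n -> T) -> Prop) : dense (op O) P -> dense O P.
Proof. by move=> D a b ok; apply: on_subbox_op; apply: D. Qed.

Lemma noitv_op P : noitv O P -> noitv (op O) P.
Proof. by move=> h u v vu; have [x [? [? ?]]] := h v u vu; exists x. Qed.

Lemma bdd_above_dense : dense O (bdd_above O S).
Proof.
apply: dense_op; apply: dense_imp (bdd_below_dense (omin_op OM) HS _) => [y [u h]|y].
  by exists u; apply/nearby_op.
exact: noitv_op.
Qed.

(** Otherwise the least abnormal point [beta y] is a definable function on some
    box. Generically [beta] is continuous and separated, uniformly, from the
    other points of [S], and it lies always or never in [S]: so [beta y] is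
    normal after all. *)
Lemma normal_dense : dense O (fun y => forall x, normal O S y x).
Proof.
have HN := normal_dfn HS.
apply: (dense_contra OM); first by dfn_tac.
move=> a b ok h.
pose NN y x := ~ normal O S y x.
have HNN : dfn2 O NN by rewrite /dfn2 /NN; dfn_tac.
have NNex y : in_box O a b y -> exists x, NN y x.
  move=> hy; apply: contrapT => nx; apply: (h y hy) => x; apply: contrapT => k.
  by apply: nx; exists x.
have [E C] := box_generic n OM; have [E1 _] := box_generic n.+1 OM.
have HI : dfn O (fun y => noitv O (NN y)) by rewrite /noitv; dfn_tac.
case: (E _ HI a b ok) => -[a1 [b1 [ok1 s1 h1]]]; last first.
  pose X (e : fin n.+1 -> T) := NN (fun i => e (Some i)) (e None).
  have HX : dfn O X by rewrite /X; dfn_tac.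
  have [y hy|u [v [uv [a2 [b2 [ok2 s2 h2]]]]]] := box_of_fibres OM HX ok1.
    apply: contrapT => nx; apply: (h1 y hy) => u v uv; apply: contrapT => nu.
    apply: nx; exists u, v; split=> // x ux xv; apply: contrapT => ngx; apply: nu.
    by exists x.
  have okX : @box_ok T O n.+1 (oc u a2) (oc v b2) by case=> [i|] //=; exact: ok2.
  pose Y (e : fin n.+1 -> T) := S (fun i => e (Some i)) (e None).
  have HY : dfn O Y by rewrite /Y; dfn_tac.
  case: (E1 Y HY _ _ okX) => -[a3 [b3 [ok3 s3 h3]]].
    have [e he] := box_ok_in ok3; have [_ hy] := (in_box_S O a3 b3 e).1 he.
    have [x [ux [xv nS]]] := @fibS (fun i => e (Some i)) _ _ (ok3 None).
    by apply: nS; apply: (h3 (oc x (fun i => e (Some i)))); apply/in_box_S.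
  have [e he] := box_ok_in ok3; have [[l1 l2] hy] := (in_box_S O a3 b3 e).1 he.
  have /s3 : in_box O a3 b3 e by [].
  rewrite [e]oc_eta => /in_box_oc [[ue ev] hy2].
  apply: (h2 _ hy2 _ ue ev); left; exists (a3 None), (b3 None); split=> //; split=> //.
  exists (fun i : fin n => a3 (Some i)), (fun i => b3 (Some i)); split=> // z hz w aw wb.
  by apply: (h3 (oc w z)); apply/in_box_S.
have [||beta Hb hb] := @definable_choice T O (fin n)
    (fun y m => NN y m /\ forall x, NN y x -> ~ x ≺ m).
- by rewrite /dfn2; dfn_tac.
- by move=> y s s' [q1 q2] [q3 q4]; have k1 := q2 s' q3; have k2 := q4 s q1; ord.
have bNN y : in_box O a1 b1 y -> NN y (beta y).
  move=> hy; have HNy : dfn1 O (NN y) by rewrite /dfn1; dfn_tac.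
  have [m Sm hm] := finite_min O (noitv_finite OM HNy (h1 y hy)) (NNex y (s1 y hy)).
  by apply: (hb y _).1; exists m.
pose Ru y v := forall w, beta y ≺ w -> w ≺ v -> ~ S y w.
have HRu : dfn2 O Ru by rewrite /dfn2 /Ru; dfn_tac.
have [|y hy|u1 [v0 [u1v0 [a2 [b2 [ok2 s2 h2]]]]]] := uniform_threshold OM C Hb HRu _ ok1.
- by move=> y s s' ss' k w bw ws; apply: k => //; ord.
- have [v [bv hv]] := noitv_right OM (beta y) (fib_dfn HS y) (@fibS y).
  by exists v.
pose Rd y v := forall w, w ≺ beta y -> v ≺ w -> ~ S y w.
have HRd : dfn2 (op O) Rd by have HRd : dfn2 O Rd by rewrite /dfn2 /Rd; dfn_tac.
have [_ Cop] := box_generic n (omin_op OM).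
have [|y hy|w1 [u0 [/= u0w1 k2]]] :=
    @uniform_threshold T (op O) n beta Rd b2 a2 (omin_op OM) Cop Hb HRd _ ok2.
- move=> y s s' /= ss' k w bw ws; apply: k => //; ord.
- have [v [bv hv]] := noitv_left OM (beta y) (fib_dfn HS y) (@fibS y).
  by exists v.
have [a3 [b3 [ok3 s3 h3]]] := on_subbox_op k2.
have HSb : dfn O (fun y => S y (beta y)) by dfn_tac.
have contra a4 b4 : box_ok O a4 b4 -> subbox O a4 b4 a3 b3 ->
    (forall y, in_box O a4 b4 y -> S y (beta y)) \/ (forall y, in_box O a4 b4 y ->
        ~ S y (beta y)) -> False.
  move=> ok4 s4 hS.
  have [y hy by_] := dense_ex (dense_cont OM Hb) ok4.
  have hy3 := s4 y hy; have hy2 := s3 y hy3; have hy1 := s2 y hy2.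
  apply: (bNN y hy1).
  have tail z : in_box O a4 b4 z -> forall w, u0 ≺ w -> w ≺ v0 -> S z w -> w = beta z.
    move=> hz w uw wv Sw; have hz3 := s4 z hz.
    have [_ hu] := h3 z hz3; have [_ hv] := h2 z (s3 z hz3).
    case: (tri O w (beta z)) => [wb|[//|bw]]; first by case: (hu w wb uw Sw).
    by case: (hv w bw wv Sw).
  have rng z : in_box O a4 b4 z -> u0 ≺ beta z /\ beta z ≺ v0.
    move=> hz; have hz3 := s4 z hz.
    have [/= ? _] := h3 z hz3; have [? _] := h2 z (s3 z hz3).
    by split; ord.
  have [ub bv] := rng y hy.
  have here P : (forall z, in_box O a4 b4 z -> P z) -> nearby O y P by exists a4, b4.
  case: hS => hS.
    right; split=> [|u v uy yv]; first exact: hS.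
    have [u' [u'b uu' u0u']] := @lt_common_right _ (op O) (beta y) u u0 uy ub.
    have [v' [bv' v'v v'v0]] := lt_common_right yv bv; rewrite /= in u'b uu' u0u'.
    exists u', v'; split; [by move=> ?; ord|split; [by move=> ?; ord|split=> //; split=> //]].
    apply: nearby_imp (nearby_and (here _ (fun z hz => hz)) (by_ u' v' u'b bv')) => z [hz [h4 h5]].
    split=> [|w w' k4 k5 k6 k7 k8 k9]; first by exists (beta z); split=> //; split=> //; exact: hS.
    have kw : u0 ≺ w /\ w ≺ v0 by clear -k4 k5 u0u' v'v0; split; ord.
    have kw' : u0 ≺ w' /\ w' ≺ v0 by clear -k7 k8 u0u' v'v0; split; ord.
    by rewrite (tail z hz w kw.1 kw.2 k6) (tail z hz w' kw'.1 kw'.2 k9).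
  left; exists u0, v0; split=> //; split=> //; apply: here => z hz w k4 k5 Sw.
  by apply: (hS z hz); rewrite -(tail z hz w).
case: (E _ HSb _ _ ok3) => -[a4 [b4 [ok4 s4 h4]]].
  by apply: (contra a4 b4) => //; left.
by apply: (contra a4 b4) => //; right.
Qed.

Theorem good_dense : dense O (good O S).
Proof.
apply: dense_and (bdd_below_dense OM HS fibS) _.
by apply: dense_and bdd_above_dense normal_dense.
Qed.

End GoodDense.

(** * Counting points *)

Section Count.
Variables (T : Type) (O : dstr T).
Local Notation "x ≺ y" := (dlt O x y) (at level 70).
Local Ltac ord := ord_with (dlo O) (dlt O).

(** Counting from the top down, so that for fixed [k] the condition is first
    order in a family of sets. *)
Fixpoint below (P : T -> Prop) k v :=
  if k is k'.+1 then exists x, x ≺ v /\ (P x /\ below P k' x) else True.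

Definition atleast (P : T -> Prop) k := exists v, below P k v.

Lemma below_dfn (V : Set) (S : (V -> T) -> T -> Prop) k : dfn2 O S ->
  dfn2 O (fun y => below (S y) k).
Proof.
move=> HS; elim: k => [|k IH] /=; rewrite /dfn2; first by dfn_tac.
by dfn_tac.
Qed.

Lemma atleast_dfn (V : Set) (S : (V -> T) -> T -> Prop) k : dfn2 O S ->
  dfn O (fun y => atleast (S y) k).
Proof. by move=> /(below_dfn k) H; rewrite /atleast; dfn_tac. Qed.

Lemma below_mono P k v v' : v ≺ v' -> below P k v -> below P k v'.
Proof.
by case: k => [//|k] vv' [x [xv h]]; exists x; split=> //; ord.
Qed.

Lemma below_pred P k v : below P k.+1 v -> below P k v.
Proof.
elim: k v => [//|k IH] v [x [xv [px h]]].
by exists x; split=> //; split=> //; exact: IH.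
Qed.

Lemma below_leq P k k' v : k <= k' -> below P k' v -> below P k v.
Proof.
move=> /subnK <-; elim: (k' - k) => [//|d IH] h; apply: IH.
exact: below_pred.
Qed.

Lemma below_gap P k p q : (forall x, ~ x ≺ p -> x ≺ q -> ~ P x) ->
  below P k q -> below P k p.
Proof.
case: k => [//|k] gap [x [xq [px h]]]; exists x; split=> //.
by apply: contrapT => xp; apply: (gap x).
Qed.

Lemma below_sub (P Q : T -> Prop) k v : (forall x, P x -> Q x) ->
  below P k v -> below Q k v.
Proof.
move=> h; elim: k v => [//|k IH] v [x [xv [px hx]]].
by exists x; split=> //; split; [exact: h | exact: IH].
Qed.

Lemma atleast_sub (P Q : T -> Prop) k : (forall x, P x -> Q x) ->
  atleast P k -> atleast Q k.
Proof. by move=> h [v hv]; exists v; exact: below_sub hv. Qed.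

Lemma atleast_leq P k k' : k <= k' -> atleast P k' -> atleast P k.
Proof. by move=> h [v hv]; exists v; exact: below_leq hv. Qed.

Lemma below_size P k v (l : list T) :
  (forall x, x ≺ v -> P x -> List.In x l) -> below P k v -> k <= size l.
Proof.
elim: k v l => [//|k IH] v l hl [x [xv [px h]]].
have [l1 [l2 E]] := List.in_split _ _ (hl x xv px).
suff : k <= size (l1 ++ l2) by rewrite E !size_cat /= addnS.
apply: IH h => y yx py; have := hl y (lo_trans (dlo O) yx xv) py.
rewrite E !List.in_app_iff /= => -[?|[E'|?]]; [by left| |by right].
by rewrite E' in yx; case: (lo_irr (dlo O) yx).
Qed.

Lemma finite_atleast P : finite P -> exists k, ~ atleast P k.
Proof.
move=> [l hl]; exists (size l).+1 => -[v /below_size h].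
by have := h l (fun x _ => hl x); rewrite ltnn.
Qed.

(** Induction on [k], taking away the largest point of [P] below [v]. *)
Lemma below_list P k v : finite P -> ~ below P k.+1 v ->
  exists l : list T, size l <= k /\ forall x, x ≺ v -> P x -> List.In x l.
Proof.
move=> F; elim: k v => [|k IH] v nb.
  by exists nil; split=> // x xv px; case: nb; exists x.
case: (EM (exists x, P x /\ x ≺ v)) => [ne|e]; last first.
  by exists nil; split=> // x xv px; case: e; exists x.
have [m [pm mv] hm] : exists2 m, P m /\ m ≺ v & forall x, P x /\ x ≺ v -> ~ m ≺ x.
  by apply: (@finite_min T (op O)) => //; case: F => l hl; exists l => x [/hl].
have [|l [sl hl]] := IH m; first by move=> h; apply: nb; exists m.
exists (m :: l); split=> // x xv px; case: (tri O x m) => [xm|[->|mx]].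
- by right; apply: hl.
- by left.
- by case: (hm x).
Qed.

Lemma atleast_list P k : finite P -> ~ atleast P k.+1 ->
  exists l : list T, size l <= k /\ forall x, P x -> List.In x l.
Proof.
move=> F na.
have [v hv] : exists v, forall x, P x -> x ≺ v.
  have [l hl] := F; suff [v hv] : exists v, forall x, List.In x l -> x ≺ v.
    by exists v => x /hl /hv.
  elim: l {hl} => [|z l [v hv]]; first by have [v _] := dpt O; exists v.
  case: (EM (z ≺ v)) => zv; first by exists v => x [<-|/hv].
  have [w zw] := dlt_nomax O z; exists w => x [<-//|/hv xv]; ord.
have [|l [sl hl]] := @below_list P k v F; first by move=> b; apply: na; exists v.
by exists l; split=> // x px; apply: hl => //; exact: hv.
Qed.

End Count.

Definition between T (O : dstr T) x t w :=
  (~ dlt O w x /\ ~ dlt O t w) \/ (~ dlt O w t /\ ~ dlt O x w).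

Section Local.
Variables (T : Type) (O : dstr T).
Local Notation "x ≺ y" := (dlt O x y) (at level 70).
Local Ltac ord := ord_with (dlo O) (dlt O).
Variables (n : nat) (S : (fin n -> T) -> T -> Prop) (y0 : fin n -> T).
Hypotheses (OM : omin O) (HS : dfn2 O S) (fibS : forall y, noitv O (S y)).

(** Definable compactness of the vertical line through [y0], the two infinite
    ends included. *)
Lemma vertical_compact (E : (fin n -> T) -> T -> Prop) : dfn2 O E ->
  (exists u, nearby O y0 (fun z => forall w, w ≺ u -> ~ E z w)) ->
  (exists u, nearby O y0 (fun z => forall w, u ≺ w -> ~ E z w)) ->
  (forall x, exists u v, u ≺ x /\ (x ≺ v /\
     nearby O y0 (fun z => forall w, u ≺ w -> w ≺ v -> ~ E z w))) ->
  nearby O y0 (fun z => forall w, ~ E z w).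
Proof.
move=> HE [lo hlo] [hi hhi] loc.
pose L v := nearby O y0 (fun z => forall w, w ≺ v -> ~ E z w).
have HL : dfn1 O L by rewrite /dfn1 /L /nearby /in_box; dfn_tac.
case: (EM (exists v, ~ L v)) => [[v0 nL]|all]; last first.
  have [v hv] := dlt_nomax O hi.
  have Lv : L v by apply: contrapT => nL; apply: all; exists v.
  apply: nearby_imp (nearby_and Lv hhi) => z [h1 h2] w.
  by case: (EM (w ≺ v)) => wv; [exact: h1 | apply: h2; ord].
have [|s [s1 s2]] := sup_ex OM HL (ex_intro _ lo hlo).
  exists v0 => x Lx v0x; apply: nL; apply: nearby_imp Lx => z h w wv; apply: h; ord.
have [u [v [us [sv huv]]]] := loc s.
have [x Lx ux] := s2 u us.
have [t [st tv]] := dlt_dense sv.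
case: (s1 t) => //; apply: nearby_imp (nearby_and Lx huv) => z [h1 h2] w wt.
by case: (EM (w ≺ x)) => wx; [exact: h1 | apply: h2; ord].
Qed.

Hypothesis G : good O S y0.

Lemma good_vacant x : ~ S y0 x -> vacant O S y0 x.
Proof. by move=> nS; case: G => _ [_ /(_ x) [//|[]]]. Qed.

Lemma local_triviality_empty v : (forall x, x ≺ v -> ~ S y0 x) -> ~ S y0 v ->
  nearby O y0 (fun z => forall k, below O (S z) k v <-> below O (S y0) k v) /\
  exists ts : list T, (forall t, List.In t ts -> ~ S y0 t) /\
    nearby O y0 (fun z => forall x, ~ v ≺ x -> ~ S z x ->
      exists2 t, List.In t ts & forall w, between O x t w -> ~ S z w).
Proof.
move=> emp nSv.
have H : nearby O y0 (fun z => forall w, ~ (S z w /\ ~ v ≺ w)).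
  apply: vertical_compact; first by rewrite /dfn2; dfn_tac.
  - by case: G => -[u hu] _; exists u; apply: nearby_imp hu => z h w wu [/(h w wu)].
  - by exists v; apply: nearby_true => z w vw [_].
  move=> x; case: (EM (v ≺ x)) => vx.
    have [x' xx'] := dlt_nomax O x; exists v, x'; split=> //; split=> //.
    by apply: nearby_true => z w vw _ [_].
  have nSx : ~ S y0 x.
    by move=> Sx; case: (tri O x v) => [/emp|[E|//]] //; rewrite E in Sx.
  have [u [u' [ux [xu' h]]]] := good_vacant nSx; exists u, u'; split=> //; split=> //.
  by apply: nearby_imp h => z h w uw wu' [/(h w uw wu')].
split.
  apply: nearby_imp H => z h [//|k] /=; split=> -[x [xv [Sx _]]]; last by case: (emp x).
  by case: (h x); split=> // vx; ord.
exists [:: v]; split; first by move=> t [<-|].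
apply: nearby_imp H => z h x vx nSx; exists v; first by left.
by move=> w [[wx vw]|[wv xw]] Sw; apply: (h w); split=> //; ord.
Qed.

(** Induction on the number of points of the fibre over [y0] below [v]: peel
    off the largest one, around which [S] is the graph of a function. *)
Lemma local_triviality_below (l : list T) v :
  (forall x, x ≺ v -> S y0 x -> List.In x l) -> ~ S y0 v ->
  nearby O y0 (fun z => forall k, below O (S z) k v <-> below O (S y0) k v) /\
  exists ts : list T, (forall t, List.In t ts -> ~ S y0 t) /\
    nearby O y0 (fun z => forall x, ~ v ≺ x -> ~ S z x ->
      exists2 t, List.In t ts & forall w, between O x t w -> ~ S z w).
Proof.
move En: (size l) => N; elim: N l v En => [|N IH] l v En hl nSv.
  apply: local_triviality_empty => // x xv Sx.
  by have := hl x xv Sx; case: l En {hl}.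
case: (EM (exists x, x ≺ v /\ S y0 x)) => ne; last first.
  by apply: local_triviality_empty => // x xv Sx; apply: ne; exists x.
have [m [mv Sm] hm] : exists2 m, m ≺ v /\ S y0 m & forall x, x ≺ v /\ S y0 x -> ~ m ≺ x.
  by apply: (@finite_min T (op O)) => //; exists l => x [? ?]; apply: hl.
have [u [um hu]] := noitv_left OM m (fib_dfn HS y0) (@fibS y0).
have [x1 [ux1 x1m]] := dlt_dense um.
have nSx1 : ~ S y0 x1 by apply: hu.
have [l1 [l2 El]] := List.in_split _ _ (hl m mv Sm).
have [||] := IH (l1 ++ l2) x1 _ _ nSx1.
- by move: En; rewrite El !size_cat /= addnS => -[].
- move=> x xx1 Sx; have xv : x ≺ v by ord.
  have := hl x xv Sx.
  rewrite El !List.in_app_iff /= => -[?|[E'|?]]; [by left| |by right].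
  by subst x; ord.
move=> C1 [ts [nts T1]].
have [_ gl] : graphlike O S y0 m.
  by case: G => _ [_ /(_ m) [[p [q [pm [mq h]]]]|//]]; case: (nearby_self h _ pm mq).
have [u' [v' [u'x1 [vv' [u'm [mv' U]]]]]] := gl x1 v x1m mv.
have H : nearby O y0 (fun z => forall w,
    ~ (S z w /\ (~ w ≺ x1 /\ (~ v ≺ w /\ ~ (u' ≺ w /\ w ≺ v'))))).
  apply: vertical_compact; first by rewrite /dfn2; dfn_tac.
  - by exists x1; apply: nearby_true => z w wx1 [_ [/(_ wx1)]].
  - by exists v; apply: nearby_true => z w vw [_ [_ [/(_ vw)]]].
  move=> x; case: (EM (x ≺ x1)) => xx1.
    have [x' x'x] := dlt_nomin O x; exists x', x1; split=> //; split=> //.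
    by apply: nearby_true => z w _ wx1 [_ [/(_ wx1)]].
  case: (EM (v ≺ x)) => vx.
    have [x' xx'] := dlt_nomax O x; exists v, x'; split=> //; split=> //.
    by apply: nearby_true => z w vw _ [_ [_ [/(_ vw)]]].
  case: (EM (u' ≺ x /\ x ≺ v')) => [[u'x xv']|nuv].
    by exists u', v'; split=> //; split=> //; apply: nearby_true => z w h1 h2 [_ [_ [_ []]]].
  have nSx : ~ S y0 x.
    move=> Sx; have xv : x ≺ v by case: (tri O x v) => [//|[E|//]]; rewrite E in Sx.
    have := hm x (conj xv Sx) => mx.
    case: (tri O x m) => [xm|[E|//]]; last by apply: nuv; rewrite E.
    by apply: (hu x xm) => //; ord.
  have [p [q [px [xq h]]]] := good_vacant nSx; exists p, q; split=> //; split=> //.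
  by apply: nearby_imp h => z h w pw wq [/(h w pw wq)].
have K : nearby O y0 (fun z => forall k, below O (S z) k.+1 v <-> below O (S z) k x1).
  apply: nearby_imp (nearby_and U H) => z [[[w0 [u'w0 [w0v' Sw0]]] uni] emp] k.
  have only x : S z x -> ~ x ≺ x1 -> ~ v ≺ x -> x = w0.
    move=> Sx xx1 vx; apply: contrapT => ne0; apply: (emp x).
    split=> //; split=> //; split=> // -[u'x xv']; apply: ne0; exact: uni.
  split=> [[x [xv [Sx h]]]|h].
    case: (EM (x ≺ x1)) => xx1; first exact: below_mono h.
    apply: below_gap h => w wx1 wx Sw.
    have E1 : x = w0 by apply: only => //; ord.
    have E2 : w = w0 by apply: only => //; ord.
    by rewrite E1 E2 in wx; ord.
  by exists w0; split; [ord|split=> //; apply: below_mono h; ord].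
split.
  apply: nearby_imp (nearby_and K C1) => z [h1 h2] [//|k].
  by rewrite h1 (nearby_self K) h2.
exists (x1 :: v :: ts); split; first by move=> t [<-|[<-|/nts]].
apply: nearby_imp (nearby_and T1 (nearby_and U H)) =>
    z [h [[[w0 [u'w0 [w0v' Sw0]]] uni] emp]] x vx nSx.
case: (EM (x1 ≺ x)) => x1x; last first.
  by have [t ht1 ht2] := h x x1x nSx; exists t => //; right; right.
have only w : S z w -> ~ w ≺ x1 -> ~ v ≺ w -> w = w0.
  move=> Sw wx1 vw; apply: contrapT => ne0; apply: (emp w).
  split=> //; split=> //; split=> // -[u'x xv']; apply: ne0; exact: uni.
case: (tri O x w0) => [xw0|[E|w0x]].
- exists x1; first by left.
  move=> w bw Sw; have [? ?] : ~ w ≺ x1 /\ ~ x ≺ w by case: bw => -[? ?]; split; ord.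
  by have E : w = w0 by [apply: only => //; ord]; ord.
- by case: nSx; rewrite E.
exists v; first by right; left.
move=> w bw Sw; have [? ?] : ~ w ≺ x /\ ~ v ≺ w by case: bw => -[? ?]; split; ord.
by have E : w = w0 by [apply: only => //; ord]; ord.
Qed.

Lemma local_count :
  nearby O y0 (fun z => forall k, atleast O (S z) k <-> atleast O (S y0) k).
Proof.
have [_ [[u hu] _]] := G; have [v uv] := dlt_nomax O u.
have nSv : ~ S y0 v by apply: (nearby_self hu).
have [l hl] := noitv_finite OM (fib_dfn HS y0) (@fibS y0).
have [C _] := local_triviality_below (fun x _ => hl x) nSv.
have top : nearby O y0 (fun z => forall k, atleast O (S z) k <-> below O (S z) k v).
  apply: nearby_imp hu => z h k; split=> [[v' b]|b]; last by exists v.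
  case: (EM (v' ≺ v)) => v'v; first exact: below_mono b.
  by apply: below_gap b => x xv _; apply: h; ord.
apply: nearby_imp (nearby_and top C) => z [h1 h2] k.
by rewrite h1 (nearby_self top) h2.
Qed.

(** Take one sample point in each gap of the fibre over [y0]: the points of the
    nearby fibres move so little that each sample point stays in its gap. *)
Lemma local_samples : exists ts : list T,
  nearby O y0 (fun z => (forall t, List.In t ts -> ~ S z t) /\
    forall x, ~ S z x ->
      exists2 t, List.In t ts & forall w, between O x t w -> ~ S z w).
Proof.
have [_ [[u hu] _]] := G; have [v uv] := dlt_nomax O u.
have nSv : ~ S y0 v by apply: (nearby_self hu).
have [l hl] := noitv_finite OM (fib_dfn HS y0) (@fibS y0).
have [_ [ts [nts T1]]] := local_triviality_below (fun x _ => hl x) nSv.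
exists (v :: ts).
have away : nearby O y0 (fun z => forall t, List.In t (v :: ts) -> ~ S z t).
  apply: nearby_list => t ht.
  have /good_vacant [p [q [pt [tq h]]]] : ~ S y0 t by case: ht => [<-|/nts].
  by apply: nearby_imp h => z; apply.
apply: nearby_imp (nearby_and away (nearby_and hu T1)) => z [h1 [h2 h3]]; split=> // x nSx.
case: (EM (v ≺ x)) => vx; last by have [t ? ?] := h3 x vx nSx; exists t => //; right.
exists v; first by left.
by move=> w [[? ?]|[? ?]]; apply: h2; ord.
Qed.

End Local.

(** * Uniform finiteness *)

(** The number in question is given by the sets [E k] where it is at least [k].
    The proof is by induction on the dimension: a generic fibre splits into finitely many
        intervals on which the number is
    constant, and the largest value along the fibre is again generically
    locally constant, because locally it is attained at sample points. *)
Lemma locally_constant_bounded T (O : dstr T) n (G : (fin n -> T) -> Prop)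
    (E : nat -> (fin n -> T) -> Prop) :
  omin O -> dfn O G -> dense O G -> (forall k, dfn O (E k)) ->
  (forall k y, E k.+1 y -> E k y) ->
  (forall y, G y -> nearby O y (fun z => forall k, E k z <-> E k y)) ->
  (forall y, G y -> exists k, ~ E k y) ->
  exists k, dense O (fun y => ~ E k y).
Proof.
move=> OM; elim: n G E => [|n IH] G E HG DG HE dec loc wf.
  have [y _ Gy] := @dense_ex T O 0 G (@fin0_elim T) (@fin0_elim T) DG (fun i => fin0_elim _ i).
  have [k nk] := wf y Gy; exists k => a b ok; exists a, b; split=> // z _.
  by rewrite (fin0_eq z y).
have decl k k' y : k <= k' -> E k' y -> E k y.
  move=> /subnK <-; elim: (k' - k) => [//|d IHd] h; apply: IHd; exact: dec.
pose H (y : fin n -> T) := noitv O (fun x => ~ G (oc x y)).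
have HH : dfn O H by rewrite /H /noitv; dfn_tac.
have DH : dense O H by exact: dense_fibres.
pose Z (y : fin n -> T) x := H y /\ ~ G (oc x y).
have HZ : dfn2 O Z by rewrite /dfn2 /Z; dfn_tac.
have fibZ y : noitv O (Z y).
  case: (EM (H y)) => hy; first by apply: noitv_sub hy => x [].
  by apply: noitv0 => x [].
have Hgood := good_dfn HZ.
pose G' (y : fin n -> T) := nearby O y (fun z => H z /\ good O Z z).
have HG' : dfn O G' by rewrite /G' /nearby /in_box; dfn_tac.
have DG' : dense O G' by apply: dense_near; apply: dense_and DH (good_dense OM HZ fibZ).
pose E' k (y : fin n -> T) := G' y /\ exists x, G (oc x y) /\ E k (oc x y).
have HE' k : dfn O (E' k) by have ? := HE k; rewrite /E'; dfn_tac.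
have samples y : G' y -> exists ts : list T,
    (forall t, List.In t ts -> G (oc t y)) /\ nearby O y (fun z => forall k,
    E' k z <-> exists2 t, List.In t ts & E k (oc t y)).
  move=> Gy; have [Hy gy] := nearby_self Gy.
  have [ts hts] := local_samples OM HZ fibZ gy; exists ts.
  have Gts t : List.In t ts -> G (oc t y).
    by move=> ht; apply: contrapT => nG; case: (nearby_self hts) => /(_ t ht) h _; apply: h.
  split=> //.
  have near_t t : List.In t ts -> nearby O y (fun z => forall k, E k (oc t z) <-> E k (oc t y)).
    move=> /Gts Gt.
    have [a [b [h1 h2]]] := loc _ Gt; move: (h1) => /in_box_S [[h3 h4] h5].
    by eexists; eexists; split; [exact: h5|] => z hz; apply: h2; apply/in_box_S.
  apply: nearby_imp (nearby_and (nearby_nearby Gy) (nearby_and hts (nearby_list near_t))).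
  move=> z [Gz [[off cov] same]] k; have [Hz _] := nearby_self Gz.
  split=> [[_ [x [Gx Ex]]]|[t ht Et]]; last first.
    split=> //; exists t; split; last by apply/same.
    by apply: contrapT => nG; apply: (off t ht).
  have [|t ht hbetween] := cov x; first by case.
  exists t => //; apply/(same t ht).
  have Gb w : between O x t w -> G (oc w z).
    by move=> /hbetween nZ; apply: contrapT => nG; apply: nZ.
  have HEk : dfn1 O (fun w => E k (oc w z)) by have ? := HE k; rewrite /dfn1; dfn_tac.
  have lc w : between O x t w -> exists u v, [/\ dlt O u w, dlt O w v &
      forall y, dlt O u y -> dlt O y v -> (E k (oc y z) <-> E k (oc w z))].
    move=> /Gb /loc [a [b [h1 h2]]]; move: (h1) => /in_box_S [[h3 h4] h5].
    by exists (a None), (b None); split=> // w' h6 h7; apply: h2; apply/in_box_S.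
  case: (tri O x t) => [xt|[<-//|tx]].
    by apply/(connected OM HEk xt) => // w wx tw; apply: lc; left.
  by apply/(connected OM HEk tx) => // w wt xw; apply: lc; right.
have [|||k hk] := IH G' E' HG' DG' HE'.
- by move=> k y [Gy [x [Gx Ex]]]; split=> //; exists x; split=> //; exact: dec.
- move=> y Gy; have [ts [Gts h]] := samples y Gy.
  apply: nearby_imp (h) => z hz k; rewrite hz.
  by have := nearby_self h k => ->.
- move=> y Gy; have [ts [Gts h]] := samples y Gy.
  suff [k nk] : exists k, forall t, List.In t ts -> ~ E k (oc t y).
    by exists k => /(nearby_self h k) [t /nk].
  elim: ts Gts {h} => [|t ts IHt] Gts; first by exists 0.
  have [s hs|k1 h1] := IHt; first by apply: Gts; right.
  have [k2 h2] := wf _ (Gts t (or_introl erefl)).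
  exists (maxn k1 k2) => s [<-|/h1 h] e.
    by apply: h2; exact: decl (leq_maxr _ _) e.
  by apply: h; exact: decl (leq_maxl _ _) e.
exists k; apply: dense_imp (dense_and DG (dense_and (dense_lift DG') (dense_lift hk))).
move=> e [Ge [G'e nE]] Ee; apply: nE; split=> //; exists (e None).
by rewrite -oc_eta.
Qed.

Section UniformFiniteness.
Variables (T : Type) (O : dstr T).
Hypothesis OM : omin O.

Definition uniformly_finite (V : Set) := forall S : (V -> T) -> T -> Prop, dfn2 O S ->
  (forall y, noitv O (S y)) -> exists k, forall y, ~ atleast O (S y) k.

(** The cardinality of the fibres is locally constant at good parameters. *)
Lemma generic_bound n (S : (fin n -> T) -> T -> Prop) : dfn2 O S ->
  (forall y, noitv O (S y)) -> exists k, dense O (fun y => ~ atleast O (S y) k).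
Proof.
move=> HS fibS.
apply: (locally_constant_bounded (G := good O S)) => //.
- exact: good_dfn.
- exact: good_dense.
- by move=> k; apply: atleast_dfn.
- by move=> k y; apply: atleast_leq.
- by move=> y gy; exact: local_count.
- by move=> y _; apply: finite_atleast; apply: noitv_finite (fibS y) => //; exact: fib_dfn.
Qed.

Lemma uniformly_finite_inj (V W : Set) (r : V -> W) :
  (forall y : V -> T, exists e : W -> T, (fun v => e (r v)) = y) -> uniformly_finite W ->
      uniformly_finite V.
Proof.
move=> h U S HS fibS.
have [||k hk] := U (fun e => S (fun v => e (r v))).
- by rewrite /dfn2; dfn_tac.
- by move=> e; apply: fibS.
by exists k => y; have [e <-] := h y; apply: hk.
Qed.

Lemma fin_sum m r : exists f : fin m + fin r -> fin (m + r),
  forall y : fin m + fin r -> T, exists e, (fun v => e (f v)) = y.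
Proof.
elim: m => [|m [f hf]].
  exists (fun s => match s with inl i => fin0_elim _ i | inr i => i end) => y.
  by exists (fun i => y (inr i)); apply: funext => -[[]|].
exists (fun s => match s with
  | inl None => None | inl (Some i) => Some (f (inl i)) | inr i => Some (f (inr i)) end) => y.
have [e he] := hf (fun s => match s with inl i => y (inl (Some i)) | inr i => y (inr i) end).
exists (oc (y (inl None)) e); apply: funext => -[[i|]|i] //=.
  by have := congr1 (fun g => g (inl i)) he.
by have := congr1 (fun g => g (inr i)) he.
Qed.

(** A nowhere dense set [H] of parameters has smaller dimension: apart from a
    nowhere dense set of [y], its fibres are finite, of bounded size, so that
    the last coordinate is one of finitely many definable functions of [y] and
    can be eliminated. The [r] parameters [z] are those eliminated from [H], but
    not from [S], along the exceptional sets. *)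
Lemma thin_bound N : (forall m r, m + r <= N -> uniformly_finite (fin m + fin r)) ->
  forall m r, m + r <= N.+1 -> forall H : (fin m -> T) -> Prop, dfn O H ->
  dense O (fun y => ~ H y) -> forall S : (fin m + fin r -> T) -> T -> Prop,
  dfn2 O S -> (forall e, noitv O (S e)) ->
  exists k, forall y z, H y -> ~ atleast O (S (vcat y z)) k.
Proof.
move=> U; elim=> [|m IH] r hN H HH DH S HS fibS.
  have [y _ nH] := dense_ex DH (fun i => fin0_elim _ i : dlt O (fin0_elim T i) (fin0_elim T i)).
  by exists 0 => y' z; rewrite (fin0_eq y' y).
pose H2 (y : fin m -> T) := ~ noitv O (fun x => H (oc x y)).
have HH2 : dfn O H2 by rewrite /H2 /noitv; dfn_tac.
have DH2 : dense O (fun y => ~ H2 y).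
  have HnH : dfn O (fun y => ~ H y) by dfn_tac.
  apply: dense_imp (dense_fibres OM HnH DH) => y h; apply.
  by apply: noitv_sub h => x hx nx; apply: nx.
pose S1 (e : fin m + fin r.+1 -> T) := S (@vcat T (fin m.+1) (fin r)
  (oc (e (inr None)) (fun i => e (inl i))) (fun i => e (inr (Some i)))).
have [|||k1 hk1] := IH r.+1 _ H2 HH2 DH2 S1.
- by rewrite addnS -addSn.
- by rewrite /dfn2 /S1; dfn_tac.
- by move=> e; apply: fibS.
pose X (y : fin m -> T) x := ~ H2 y /\ H (oc x y).
have HX : dfn2 O X by rewrite /dfn2 /X; dfn_tac.
have fibX y : noitv O (X y).
  case: (EM (H2 y)) => h2; last by apply: contrapT => nX; apply: h2 => h3; apply: nX;
      apply: noitv_sub h3 => x [].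
  by apply: noitv0 => x [].
have leN : m + r <= N by rewrite -ltnS -addSn.
have [|||k2 hk2] := U m 0 _ (fun e => X (fun i => e (inl i))).
- by rewrite addn0; apply: leq_trans leN; exact: leq_addr.
- by rewrite /dfn2; dfn_tac.
- by move=> e; apply: fibX.
pose Sj j (e : fin m + fin r -> T) w := exists x,
  (X (fun i => e (inl i)) x /\ (below O (X (fun i => e (inl i))) j x /\
     ~ below O (X (fun i => e (inl i))) j.+1 x)) /\
  S (@vcat T (fin m.+1) (fin r) (oc x (fun i => e (inl i))) (fun i => e (inr i))) w.
have HSj j : dfn2 O (Sj j).
  have h1 := below_dfn j HX; have h2 := below_dfn j.+1 HX.
  by rewrite /dfn2 /Sj; move: h1 h2; move: (below O) => B h1 h2; dfn_tac.
have fibj j e : noitv O (Sj j e).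
  case: (EM (exists x, X (fun i => e (inl i)) x /\ (below O (X (fun i => e (inl i))) j x /\
     ~ below O (X (fun i => e (inl i))) j.+1 x))) => [[x [Xx [b1 nb1]]]|no]; last first.
    by apply: noitv0 => w [x [h _]]; apply: no; exists x.
  apply: noitv_sub (fibS (@vcat T (fin m.+1) (fin r) (oc x (fun i => e (inl i))) (fun i =>
      e (inr i)))).
  move=> w [x' [[Xx' [b2 nb2]] Sw]]; case: (tri O x x') => [xx'|[->//|x'x]].
    by case: nb2; exists x.
  by case: nb1; exists x'.
have [k3 hk3] : exists k, forall j, j < k2 -> forall e, ~ atleast O (Sj j e) k.
  elim: k2 {hk2} => [|k2 [k hk]]; first by exists 0.
  have [k' hk'] := U m r leN _ (HSj k2) (fibj k2).
  exists (maxn k k') => j; rewrite ltnS leq_eqVlt => /orP [/eqP ->|jk] e h.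
    by apply: (hk' e); exact: atleast_leq (leq_maxr _ _) h.
  by apply: (hk j jk e); exact: atleast_leq (leq_maxl _ _) h.
exists (maxn k1 k3) => y' z; rewrite [y']oc_eta.
move: (y' None) (fun i => y' (Some i)) => x y Hxy h.
case: (EM (H2 y)) => h2.
  apply: (hk1 y (oc x z) h2); exact: atleast_leq (leq_maxl _ _) h.
have Xx : X y x by split.
have [j [jk [bj nbj]]] : exists j, j < k2 /\ (below O (X y) j x /\ ~ below O (X y) j.+1 x).
  have : ~ below O (X y) k2 x.
    move=> b; apply: (hk2 (vcat y (@fin0_elim T))); by exists x.
  elim: k2 {hk2 hk3} => [/(_ I)//|k2 IHk] nb.
  case: (EM (below O (X y) k2 x)) => b; first by exists k2.
  by have [j [jk h']] := IHk b; exists j; split=> //; exact: ltnW.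
apply: (hk3 j jk (vcat y z)); apply: atleast_leq (leq_maxr k1 _) _.
by apply: atleast_sub h => w Sw; exists x.
Qed.

(** Induction on the number of parameters: [generic_bound] bounds the fibres
    outside a nowhere dense set, and [thin_bound] bounds them over that set. *)
Theorem uniform_finiteness n : uniformly_finite (fin n).
Proof.
suff : forall m r, m + r <= n -> uniformly_finite (fin m + fin r).
  move=> /(_ n 0); rewrite addn0 => /(_ (leqnn n)).
  apply: (@uniformly_finite_inj _ _ inl) => y; exists (vcat y (@fin0_elim T)).
  by apply: funext.
elim: n => [|N U] m r.
  rewrite leqn0 addn_eq0 => /andP [/eqP -> /eqP ->] S HS fibS.
  have [k hk] := finite_atleast O (noitv_finite OM (P :=
      S (vcat (@fin0_elim T) (@fin0_elim T))) (ltac:(rewrite /dfn1; dfn_tac)) (fibS _)).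
  exists k => y; suff -> : y = vcat (@fin0_elim T) (@fin0_elim T) by [].
  by apply: funext => -[[]|[]].
rewrite leq_eqVlt => /orP [/eqP E|]; last by rewrite ltnS; exact: U.
have [f hf] := fin_sum m r; apply: (uniformly_finite_inj hf); rewrite E => S HS fibS.
have [k0 D] := generic_bound HS fibS.
have HA := atleast_dfn k0 HS.
have [|||k1 hk1] := @thin_bound N U N.+1 0 _ (fun y => atleast O (S y) k0) HA D (fun e =>
    S (fun i => e (inl i))).
- by rewrite addn0.
- by rewrite /dfn2; dfn_tac.
- by move=> e; apply: fibS.
exists (maxn k0 k1) => y h; apply: (hk1 y (@fin0_elim T)).
  exact: atleast_leq (leq_maxl _ _) h.
exact: atleast_leq (leq_maxr _ _) h.
Qed.

(** The boundary points of the fibres of [X] form a family of finite sets. *)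
Lemma uniform_breakpoints n (X : (fin n.+1 -> T) -> Prop) : dfn O X ->
  exists k, forall y : fin n -> T, exists l : list T, size l <= k /\
    forall x x', dlt O x x' -> (forall z, List.In z l -> dlt O z x \/ dlt O x' z) ->
      (X (oc x y) <-> X (oc x' y)).
Proof.
move=> HX.
pose S (y : fin n -> T) x := ~ exists u v, dlt O u x /\ (dlt O x v /\
  forall w, dlt O u w -> dlt O w v -> (X (oc w y) <-> X (oc x y))).
have HS : dfn2 O S by rewrite /dfn2 /S; dfn_tac.
have HXy y : dfn1 O (fun x => X (oc x y)) by rewrite /dfn1; dfn_tac.
have fibS y : noitv O (S y).
  move=> u v uv; have [c [uc cv h]] := germ_right OM (HXy y) uv.
  have [x [ux xc]] := dlt_dense uc; exists x; split=> //; split.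
    exact: (lo_trans (dlo O) xc cv).
  apply; exists u, c; split=> //; split=> // w uw wc.
  by case: h => h; [have := h w uw wc; have := h x ux xc | have := h w uw wc; have := h x ux xc].
have [k hk] := uniform_finiteness HS fibS; exists k => y.
have fin : finite (S y).
  apply: (noitv_finite OM) (fibS y); exact: fib_dfn.
have [|l [sl hl]] := @atleast_list _ O (S y) k fin.
  by move=> h; apply: (hk y); exact: atleast_leq h.
exists l; split=> // x x' xx' av; apply: (connected OM (HXy y) xx') => w wx x'w.
suff /contrapT [u [v [uw [wv h]]]] : ~ S y w by exists u, v.
by move=> /hl /av [].
Qed.

End UniformFiniteness.

(** * Tame convex subsets of a locally tame structure *)

Record open_convex (T : Type) (O : dstr T) (J : T -> Prop) : Prop := OpenConvex {
  open_convex_dfn : dfn1 O J;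
  open_convex_convex : forall x y z, J x -> J z -> dlt O x y -> dlt O y z -> J y;
  open_convex_nomin : forall x, J x -> exists2 y, J y & dlt O y x;
  open_convex_nomax : forall x, J x -> exists2 y, J y & dlt O x y;
  open_convex_ex : exists x, J x }.

Lemma open_convex_op T (O : dstr T) J : open_convex O J -> open_convex (op O) J.
Proof.
move=> [h1 h2 h3 h4 h5]; split=> // x y z Jx Jz yx zy; exact: (h2 z y x).
Qed.

Section Sub.
Variables (T : Type) (O : dstr T) (J : T -> Prop) (HJ : open_convex O J).
Local Notation TJ := {x : T | J x}.
Local Notation pr := (fun (x : TJ) => proj1_sig x).

Lemma sig_inj (x y : TJ) : proj1_sig x = proj1_sig y -> x = y.
Proof. by case: x y => [x hx] [y hy] /= E; apply: eq_exist. Qed.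

Lemma sub_linord : linord (fun x y : TJ => dlt O (proj1_sig x) (proj1_sig y)).
Proof.
split=> [x|x y z|x y]; first exact: (lo_irr (dlo O)).
  exact: (lo_trans (dlo O)).
by case: (tri O (proj1_sig x) (proj1_sig y)) => [|[/sig_inj|]]; intuition.
Qed.

(** The structure induced on a definable convex set without endpoints. *)
Definition sub : dstr TJ.
Proof.
refine (@DStr TJ (fun x y => dlt O (proj1_sig x) (proj1_sig y)) sub_linord _ _ _ _
  (fun V P => exists2 Q, dfn O Q & forall e : V -> TJ, P e <-> Q (fun v => proj1_sig (e v)))
  _ _ _ _ _ _ _).
- move=> [x hx] [y hy] /= /(dlt_dense (d:=O)) [z [xz zy]].
  by exists (exist _ z (open_convex_convex HJ hx hy xz zy)).
- by move=> [x hx]; have [y hy yx] := open_convex_nomin HJ hx; exists (exist _ y hy).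
- by move=> [x hx]; have [y hy yx] := open_convex_nomax HJ hx; exists (exist _ y hy).
- by have [x hx] := open_convex_ex HJ; exists (exist _ x hx).
- by move=> V P Q PQ [R HR h]; exists R => // e; rewrite -PQ.
- by move=> V; exists (fun _ => False); [exact: dfn_false|].
- move=> V P Q [P' HP hP] [Q' HQ hQ]; exists (fun e => P' e -> Q' e).
    exact: dfn_imp.
  by move=> e; rewrite hP hQ.
- move=> V P [Q HQ h]; exists (fun e => forall x, J x -> Q (oc x e)).
    by have HJ1 := open_convex_dfn HJ; dfn_tac.
  move=> e.
  have E (x : TJ) : (fun v => proj1_sig (oc x e v)) = oc (proj1_sig x) (fun v => proj1_sig (e v)).
    by apply: funext => -[].
  split=> [H x hx|H x]; last by apply/h; rewrite E; apply: H; exact: proj2_sig.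
  by have := H (exist _ x hx); rewrite h E.
- move=> V W s P [Q HQ h].
  exists (fun e => Q (sb (fun w => match s w with inl v => inl v | inr m =>
      inr (proj1_sig m) end) e)).
    exact: dfn_sb.
  move=> e; rewrite h; suff -> : (fun v => proj1_sig (sb s e v)) = sb (fun w =>
    match s w with inl v => inl v | inr m => inr (proj1_sig m) end) (fun v =>
        proj1_sig (e v)) by [].
  by apply: funext => w; rewrite /sb; case: (s w).
- by exists (fun e => dlt O (e true) (e false)); [exact: dfn_lt0|].
- exists (fun e => e true = e false); first exact: dfn_eq0.
  by move=> e; split=> [->//|]; exact: sig_inj.
Defined.

Lemma sub_dfn (V : Set) (Q : (V -> T) -> Prop) : dfn O Q ->
  dfn sub (fun e : V -> TJ => Q (fun v => proj1_sig (e v))).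
Proof. by move=> HQ; exists Q. Qed.

Definition tame_on (P : T -> Prop) := exists l : list T, forall x y, J x -> J y ->
  dlt O x y -> (forall z, List.In z l -> dlt O z x \/ dlt O y z) -> (P x <-> P y).

Lemma omin_sub : (forall P, dfn1 O P -> tame_on P) -> omin sub.
Proof.
move=> tm P [Q HQ hQ].
have HP : dfn1 O (fun x => Q (fun _ => x)) by rewrite /dfn1; dfn_tac.
have [l hl] := tm _ HP.
have [l' hl'] : exists l' : list TJ, forall z hz, List.In z l -> List.In (exist _ z hz) l'.
  elim: l {hl} => [|z l [l' IH]]; first by exists nil.
  case: (pselect (J z)) => Jz.
    exists (exist _ z Jz :: l') => w hw [E|/IH]; last by move=> h; right.
    by left; subst w; apply: sig_inj.
  by exists l' => w hw [E|/IH //]; subst w.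
exists l' => x y xy av; have := hl _ _ (proj2_sig x) (proj2_sig y) xy.
have hP (t : TJ) : P t <-> Q (fun _ => proj1_sig t).
  exact: (hQ (fun _ => t)).
rewrite !hP; apply=> z zl.
case: (EM (J z)) => [Jz|nJ]; first exact: (av (exist _ z Jz) (hl' z Jz zl)).
case: (tri O z (proj1_sig x)) => [zx|[E|xz]]; first by left.
  by case: nJ; rewrite E; exact: proj2_sig.
case: (tri O z (proj1_sig y)) => [zy|[E|yz]]; last by right.
  by case: nJ; exact: (open_convex_convex HJ (proj2_sig x) (proj2_sig y) xz zy).
by case: nJ; rewrite E; exact: proj2_sig.
Qed.

End Sub.

(** For a first-order structure this is almost o-minimality, apart from the
    conditions on the order. *)
Definition locally_tame (T : Type) (O : dstr T) := forall P, dfn1 O P ->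
  forall c d, tame_on O (fun x => dlt O c x /\ dlt O x d) P.

Definition tame_at_top (T : Type) (O : dstr T) := forall P, dfn1 O P ->
  exists c, forall x y, dlt O c x -> dlt O c y -> (P x <-> P y).

Definition tame_at_bottom (T : Type) (O : dstr T) := tame_at_top (op O).

(** The interval [(c, d)], extended up to infinity on the sides where nothing can
    oscillate. The induced structure is o-minimal, and on the remaining sides
    there is a cofinal discrete definable set. *)
Definition ext_itv (T : Type) (O : dstr T) c d x :=
  (tame_at_bottom O \/ dlt O c x) /\ (tame_at_top O \/ dlt O x d).

Section LocTame.
Variables (T : Type) (O : dstr T).
Local Notation "x ≺ y" := (dlt O x y) (at level 70).
Local Ltac ord := ord_with (dlo O) (dlt O).

Lemma dfn_cst (V : Set) (A : Prop) : dfn O (fun _ : V -> T => A).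
Proof.
case: (EM A) => a.
  by apply: dfn_ext (dfn_true O V).
by apply: dfn_ext (dfn_false O V).
Qed.

Lemma open_convex_ext_itv c d : c ≺ d -> open_convex O (ext_itv O c d).
Proof.
move=> cd; split.
- by rewrite /dfn1 /ext_itv; refine (dfn_and _ _); refine (dfn_or _ _);
    first [exact: dfn_cst | dfn_tac].
- move=> x y z [hx _] [_ hz] xy yz; split.
    by case: hx => hx; [left|right; ord].
  by case: hz => hz; [left|right; ord].
- move=> x [h1 h2]; have [x' x'x] := dlt_nomin O x.
  have h2' y : y ≺ x -> tame_at_top O \/ y ≺ d by move=> yx; case: h2 => h2; [left|right; ord].
  case: h1 => h1; first by exists x' => //; split; [left | exact: h2'].
  by have [y [cy yx]] := dlt_dense h1; exists y => //; split; [right | exact: h2'].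
- move=> x [h1 h2]; have [x' x'x] := dlt_nomax O x.
  have h1' y : x ≺ y -> tame_at_bottom O \/ c ≺ y by move=> yx; case: h1 => h1; [left|right; ord].
  case: h2 => h2; first by exists x' => //; split; [exact: h1' | left].
  by have [y [xy yd]] := dlt_dense h2; exists y => //; split; [exact: h1' | right].
- by have [x [cx xd]] := dlt_dense cd; exists x; split; right.
Qed.

Lemma open_convex_itv c d : c ≺ d -> open_convex O (fun x => c ≺ x /\ x ≺ d).
Proof.
move=> cd; split.
- by rewrite /dfn1; dfn_tac.
- by move=> x y z [? ?] [? ?] ? ?; split; ord.
- by move=> x [cx xd]; have [y [? ?]] := dlt_dense cx; exists y => //; split=> //; ord.
- by move=> x [cx xd]; have [y [? ?]] := dlt_dense xd; exists y => //; split=> //; ord.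
- by have [x ?] := dlt_dense cd; exists x.
Qed.

Lemma ext_itv_sub c d c' d' x : ~ c ≺ c' -> ~ d' ≺ d -> ext_itv O c d x -> ext_itv O c' d' x.
Proof.
by move=> cc dd [[?|?] [?|?]]; split; (try by left); right; ord.
Qed.

Lemma ext_itv_join c d c' d' : c ≺ d -> c' ≺ d' -> exists a b, [/\ a ≺ b,
  (forall x, ext_itv O c d x -> ext_itv O a b x) & forall x, ext_itv O c' d' x -> ext_itv O a b x].
Proof.
move=> cd cd'.
have [a [ca ca']] : exists a, ~ c ≺ a /\ ~ c' ≺ a.
  by case: (EM (c ≺ c')) => h; [exists c|exists c']; split; ord.
have [b [db db']] : exists b, ~ b ≺ d /\ ~ b ≺ d'.
  by case: (EM (d ≺ d')) => h; [exists d'|exists d]; split; ord.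
exists a, b; split; first ord; move=> x; exact: ext_itv_sub.
Qed.

Lemma ext_itv_in x : exists c d, c ≺ d /\ ext_itv O c d x.
Proof.
have [c cx] := dlt_nomin O x; have [d xd] := dlt_nomax O x.
by exists c, d; split; [ord | split; right].
Qed.

Hypothesis LT : locally_tame O.

(** Below and above the points [c1] and [d1] from which on [P] is constant,
    there is nothing to do; between them almost o-minimality applies. *)
Lemma omin_ext_itv c d (cd : c ≺ d) : omin (sub (open_convex_ext_itv cd)).
Proof.
apply: omin_sub => P HP.
have [c1 hc1] : exists c1, forall x y, ext_itv O c d x -> x ≺ y -> y ≺ c1 -> (P x <-> P y).
  case: (EM (tame_at_bottom O)) => tL; last first.
    by exists c => x y [[//|cx] _] xy yc; ord.
  have [c1 h] := tL P HP; exists c1 => x y _ xy yc; apply: h => //=; ord.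
have [d1 hd1] : exists d1, forall x y, ext_itv O c d y -> x ≺ y -> d1 ≺ x -> (P x <-> P y).
  case: (EM (tame_at_top O)) => tR; last first.
    by exists d => x y [_ [//|yd]] xy dx; ord.
  have [d1 h] := tR P HP; exists d1 => x y _ xy dx; apply: h => //; ord.
have [l hl] := LT HP c1 d1.
exists (c1 :: d1 :: l) => x y Jx Jy xy av.
case: (av c1 (or_introl erefl)) => h1; last exact: hc1.
case: (av d1 (or_intror (or_introl erefl))) => h2; first exact: hd1.
by apply: hl => //; [split=> //; ord | split=> //; ord | move=> z zl; apply: av; right; right].
Qed.

(** The boundary points of a definable set that oscillates at plus infinity form
    a sequence of order type omega. *)
Lemma cofinal_discrete : ~ tame_at_top O -> exists D, [/\ dfn1 O D,
  forall d, finite (fun x => D x /\ x ≺ d) & forall c, exists2 x, D x & c ≺ x].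
Proof.
move=> nt.
have [P HP osc] : exists2 P, dfn1 O P &
    forall c, exists x y, [/\ c ≺ x, x ≺ y & ~ (P x <-> P y)].
  apply: contrapT => no; apply: nt => P HP; apply: contrapT => nc; apply: no.
  exists P => // c; apply: contrapT => nx; apply: nc; exists c => x y cx cy.
  case: (tri O x y) => [xy|[->//|yx]].
    by apply: contrapT => h; apply: nx; exists x, y.
  by symmetry; apply: contrapT => h; apply: nx; exists y, x.
have [c0 _] := dpt O.
pose lc x := exists u v, u ≺ x /\ (x ≺ v /\ forall y, u ≺ y -> y ≺ v -> (P y <-> P x)).
exists (fun x => c0 ≺ x /\ ~ lc x); split; first by rewrite /dfn1 /lc; dfn_tac.
  move=> d; have [l hl] := LT HP c0 d.
  exists l => x [[c0x nlc] xd]; apply: contrapT => xl; apply: nlc.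
  have [v [xv vd hv]] := avoid_right l xd.
  have [u [ux c0u hu]] := @avoid_right _ (op O) l x c0 c0x; rewrite /= in ux c0u hu.
  exists u, v; split=> //; split=> // y uy yv; case: (tri O x y) => [xy|[->//|yx]].
    symmetry; apply: hl => //; first by split=> //; ord.
    move=> z zl; case: (tri O z x) => [?|[E|xz]]; [by left | by subst z | right].
    by apply: contrapT => yz; apply: (hv z zl); split=> //; ord.
  apply: hl => //; first by split=> //; ord.
  move=> z zl; case: (tri O x z) => [?|[E|zx]]; [by right | by subst z | left].
  by apply: contrapT => yz; apply: (hu z zl); split=> //; ord.
move=> c; apply: contrapT => no.
have [e [ce c0e]] : exists e, ~ e ≺ c /\ ~ e ≺ c0.
  by case: (EM (c ≺ c0)) => h; [exists c0|exists c]; split; ord.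
have [x [y [ex xy neq]]] := osc e; apply: neq.
have [d yd] := dlt_nomax O y.
have ed : e ≺ d by ord.
have OMs : omin (sub (open_convex_itv ed)) by apply: omin_sub => Q HQ; exact: LT.
have xB : e ≺ x /\ x ≺ d by split=> //; ord.
have yB : e ≺ y /\ y ≺ d by split=> //; ord.
have HPs : dfn1 (sub (open_convex_itv ed)) (fun t =>
    P (proj1_sig t)) by exact: (sub_dfn (open_convex_itv ed) HP).
apply: (connected OMs HPs (p := exist _ x xB) (q := exist _ y yB)) => // -[s [es sd]] /= sx ys.
have [u [v [us [sv huv]]]] : lc s.
  by apply: contrapT => nl; apply: no; exists s; [split=> //; ord | ord].
have [u' [u's uu' eu']] := @lt_common_right _ (op O) s u e us es; rewrite /= in u's uu' eu'.
have [v' [sv' v'v v'd]] := lt_common_right sv sd.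
have Bu : e ≺ u' /\ u' ≺ d by split=> //; ord.
have Bv : e ≺ v' /\ v' ≺ d by split=> //; ord.
exists (exist _ u' Bu), (exist _ v' Bv); split=> // -[w [ew wd]] /= uw wv.
by apply: huv; ord.
Qed.

End LocTame.

Section Bounding.
Variables (T : Type) (O : dstr T) (K D : T -> Prop) (HK : open_convex O K).
Hypotheses (OM : omin (sub HK)) (HD : dfn1 O D).
Hypothesis fD : forall d, finite (fun x => D x /\ dlt O x d).
Hypothesis cD : forall c, exists2 x, D x & dlt O c x.
Local Notation "x ≺ y" := (dlt O x y) (at level 70).
Local Ltac ord := ord_with (dlo O) (dlt O).

(** A definable function from the o-minimal [K] to [D] is nowhere strictly
    monotone, because initial segments of [D] are finite: so it is piecewise
    constant, and bounded. *)
Lemma bound_one (r : T -> T -> Prop) : dfnr O r ->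
  (forall x d d', d ≺ d' -> r x d -> r x d') -> (forall x, K x -> exists d, r x d) ->
  exists d0, forall x, K x -> r x d0.
Proof.
move=> Hr up hr; set OK := sub HK.
have /choice [f hf] : forall x : {x | K x}, exists m, (D m /\ r (proj1_sig x) m) /\
    forall m', D m' -> r (proj1_sig x) m' -> ~ m' ≺ m.
  move=> [x Kx] /=; have [d rd] := hr x Kx; have [m0 Dm0 dm0] := cD d.
  have [m1 Dm1 m01] := cD m0.
  have rm0 : r x m0 by exact: up rd.
  have [|m [Dm [rm mm1]] hm] := @finite_min T O (fun m => D m /\ (r x m /\
      m ≺ m1)) _ (ex_intro _ m0 (conj Dm0 (conj rm0 m01))).
    by have [l hl] := fD m1; exists l => z [? [? ?]]; apply: hl.
  exists m; split=> // m' Dm' rm' m'm; apply: (hm m') => //; split=> //; split=> //; ord.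
have Hf : dfnr OK (fun x y => f x ≺ f y).
  have HQ : dfn O (fun e : bool -> T => exists d, D d /\ (r (e true) d /\ ~ r (e false) d)).
    by dfn_tac.
  exists (fun e : bool -> T => exists d, D d /\ (r (e true) d /\ ~ r (e false) d)) => // e.
  have [[D1 r1] m1] := hf (e true); have [[D2 r2] m2] := hf (e false).
  split=> [lt|[d [Dd [rd nrd]]]].
    by exists (f (e true)); split=> //; split=> // r3; case: (m2 _ D1 r3).
  apply: contrapT => nlt; apply: nrd.
  have h1 := m1 d Dd rd; case: (tri O (f (e false)) d) => [h|[<-//|h]]; first exact: up h r2.
  by ord.
have He : dfnr OK (fun x y => f x = f y).
  rewrite /dfnr; apply: (@dfn_ext _ OK _ (fun e : bool -> {x | K x} =>
     ~ f (e true) ≺ f (e false) /\ ~ f (e false) ≺ f (e true))).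
    by move=> e; split=> [[h1 h2]|->]; [ord | split; apply: (lo_irr (dlo O))].
  by dfn_tac.
pose lc x := exists u v, dlt OK u x /\ (dlt OK x v /\
  forall y, dlt OK u y -> dlt OK y v -> f y = f x).
have Hlc : dfn1 OK (fun x => ~ lc x) by rewrite /dfn1 /lc; dfn_tac.
have mono_false lo a b : (lo = dlt O \/ lo = fun x y => y ≺ x) -> dlt OK a b ->
    incr_on f lo OK a b -> False.
  move=> Elo ab inc; have [t [at_ tb]] := dlt_dense ab.
  case: Elo => E; subst lo.
    apply: (itv_infinite at_); apply: (finite_inj (f := f) (fD (f t))).
      by move=> x [ax xt]; have [[Dx _] _] := hf x; split=> //; exact: inc.
    move=> x y [ax xt] [ay yt] E; case: (tri OK x y) => [xy|[//|yx]].
      have := inc x y ax xy (lo_trans (dlo OK) yt tb); rewrite E => h; case: (lo_irr (dlo O) h).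
    by have := inc y x ay yx (lo_trans (dlo OK) xt tb); rewrite E => h; case: (lo_irr (dlo O) h).
  apply: (itv_infinite tb); apply: (finite_inj (f := f) (fD (f t))).
    by move=> x [tx xb]; have [[Dx _] _] := hf x; split=> //; exact: inc.
  move=> x y [tx xb] [ty yb] E; case: (tri OK x y) => [xy|[//|yx]].
    have := inc x y (lo_trans (dlo OK) at_ tx) xy yb; rewrite E => h; case: (lo_irr (dlo O) h).
  by have := inc y x (lo_trans (dlo OK) at_ ty) yx xb; rewrite E => h; case: (lo_irr (dlo O) h).
have nlc : noitv OK (fun x => ~ lc x).
  move=> u v uv; have [a [b [ab au vb]]] := monotone_subitv OM (dlo O) Hf uv.
  case=> [cst|[inc|inc]].
  - have [x [ax xb]] := dlt_dense ab; exists x; split.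
      exact: (lo_le_lt (dlo OK) au ax).
    split; first exact: (lo_lt_le (dlo OK) xb vb).
    by apply; exists a, b; split=> //; split=> // y ay yb; apply: cst.
  - by case: (mono_false (dlt O) a b) => //; left.
  - by case: (mono_false (fun x y => y ≺ x) a b) => //; right.
have [l hl] := noitv_finite OM Hlc nlc.
have [e0 _] := dpt O.
suff key (C : {x | K x} -> Prop) : (forall x y z, C x -> C z -> dlt OK x y -> dlt OK y z -> C y) ->
    (forall x, C x -> ~ lc x -> List.In x l) -> exists d0, forall x, C x -> r (proj1_sig x) d0.
  have [||d0 h] := key (fun _ => True) => //; first by move=> x _; exact: hl.
  by exists d0 => x Kx; exact: (h (exist _ x Kx)).
elim: l C {hl} => [|z l IH] C conv hC.
  case: (EM (exists x, C x)) => [[x0 Cx0]|no]; last by exists e0 => x Cx; case: no; exists x.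
  have feq x y : C x -> C y -> dlt OK x y -> f x = f y.
    move=> Cx Cy xy; have HP : dfn1 OK (fun t => f t = f x) by rewrite /dfn1; dfn_tac.
    suff <- : f y = f x by []; apply/(connected OM HP xy) => // t tx yt.
    have Ct : C t.
      case: (tri OK x t) => [xt|[<-//|tx']] //.
      by case: (tri OK t y) => [ty|[->//|//]]; exact: conv xt ty.
    have [u [v [ut [tv h]]]] : lc t by apply: contrapT => nl; case: (hC t Ct nl).
    by exists u, v; split=> // w uw wv; rewrite (h w).
  exists (f x0) => x Cx; have [[_ rx] _] := hf x.
  suff <- : f x = f x0 by [].
  case: (tri OK x x0) => [h|[->//|h]]; first exact: feq.
  by symmetry; apply: feq.
have [||d1 h1] := IH (fun x => C x /\ dlt OK x z).
- by move=> x y w [Cx _] [Cw wz] xy yw; split;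
    [exact: conv xy yw | exact: (lo_trans (dlo OK) yw wz)].
- by move=> x [Cx xz] nl; case: (hC x Cx nl) => // E; subst x; case: (lo_irr (dlo OK) xz).
have [||d2 h2] := IH (fun x => C x /\ dlt OK z x).
- by move=> x y w [Cx zx] [Cw _] xy yw; split;
    [exact: conv xy yw | exact: (lo_trans (dlo OK) zx xy)].
- by move=> x [Cx xz] nl; case: (hC x Cx nl) => // E; subst x; case: (lo_irr (dlo OK) xz).
have [d3 h3] := hr _ (proj2_sig z).
have join (d d' : T) : exists e, (forall x, r x d -> r x e) /\ forall x, r x d' -> r x e.
  case: (tri O d d') => [h|[->|h]]; [exists d'|exists d'|exists d]; split=> // x; exact: up.
have [d4 [h41 h42]] := join d1 d2; have [d5 [h54 h53]] := join d4 d3.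
exists d5 => x Cx; case: (tri OK x z) => [xz|[->|zx]].
- by apply: h54; apply: h41; apply: h1.
- exact: h53.
- by apply: h54; apply: h42; apply: h2.
Qed.

Lemma bound_many n (R : (fin n -> T) -> T -> Prop) : dfn2 O R ->
  (forall y d d', d ≺ d' -> R y d -> R y d') ->
  (forall y, (forall i, K (y i)) -> exists d, R y d) ->
  exists d0, forall y, (forall i, K (y i)) -> R y d0.
Proof.
elim: n R => [|n IH] R HR up hR.
  have [|d hd] := hR (@fin0_elim T); first by case.
  by exists d => y _; rewrite (fin0_eq y (@fin0_elim T)).
have HK1 := open_convex_dfn HK.
have [|||d0 h] := IH (fun y d => forall x, K x -> R (oc x y) d).
- by rewrite /dfn2; dfn_tac.
- by move=> y d d' dd h x Kx; apply: up dd _; exact: h.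
- move=> y Ky; apply: (bound_one (r := fun x d => R (oc x y) d)).
  + by rewrite /dfnr; dfn_tac.
  + by move=> x d d' dd; exact: up.
  + by move=> x Kx; apply: hR => -[i|] /=.
by exists d0 => y Ky; rewrite (oc_eta y); apply: h => // i; exact: Ky.
Qed.

End Bounding.

Lemma bounded_witness_right T (O : dstr T) (K : T -> Prop) (HK : open_convex O K) n
    (X : (fin n.+1 -> T) -> Prop) : locally_tame O -> omin (sub HK) -> dfn O X ->
  exists d0, forall y : fin n -> T, (forall i, K (y i)) -> (exists x, X (oc x y)) ->
    exists x, (tame_at_top O \/ dlt O x d0) /\ X (oc x y).
Proof.
move=> LT OM HX; have [c0 _] := dpt O; case: (EM (tame_at_top O)) => tR.
  by exists c0 => y _ [x Xx]; exists x; split=> //; left.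
have [D [HD fD cD]] := cofinal_discrete LT tR.
have [|||d0 h] := bound_many OM HD fD cD (R := fun y : fin n -> T => fun d =>
    (exists x, X (oc x y)) -> exists x, dlt O x d /\ X (oc x y)).
- by rewrite /dfn2; dfn_tac.
- move=> y d d' dd h /h [x [xd Xx]]; exists x; split=> //; exact: (lo_trans (dlo O) xd dd).
- move=> y _; case: (EM (exists x, X (oc x y))) => [[x Xx]|no]; last by exists c0.
  by have [d xd] := dlt_nomax O x; exists d => _; exists x.
by exists d0 => y Ky /(h y Ky) [x [xd Xx]]; exists x; split=> //; right.
Qed.

Lemma locally_tame_op T (O : dstr T) : locally_tame O -> locally_tame (op O).
Proof.
move=> LT P HP c d; have [l hl] := LT P HP d c; exists l => x y [cx xd] [cy yd] yx av.
symmetry; apply: hl => // z zl; by case: (av z zl) => ?; [right|left].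
Qed.

(** This makes the elements of an ultrapower that lie in some interval
    [ext_itv c d] an elementary substructure. *)
Lemma bounded_witness T (O : dstr T) n (X : (fin n.+1 -> T) -> Prop) c d :
  locally_tame O -> dfn O X -> dlt O c d -> exists c' d', dlt O c' d' /\
  forall y : fin n -> T, (forall i, ext_itv O c d (y i)) -> (exists x, X (oc x y)) ->
    exists x, ext_itv O c' d' x /\ X (oc x y).
Proof.
move=> LT HX cd; have OM := @omin_ext_itv T O LT c d cd.
have [d0 h] := bounded_witness_right LT OM HX.
pose X2 (e : fin n.+1 -> T) := (tame_at_top O \/ dlt O (e None) d0) /\ X e.
have HX2 : dfn O X2.
  rewrite /X2; refine (dfn_and _ _); last exact: HX.
  by refine (dfn_or _ _); [exact: dfn_cst | dfn_tac].
have OM' : omin (sub (open_convex_op (open_convex_ext_itv cd))) by exact: (omin_op OM).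
have [c0 h'] := @bounded_witness_right T (op O) _ (open_convex_op (open_convex_ext_itv cd)) n X2
    (locally_tame_op LT) OM' HX2.
have [d' d0d'] := dlt_nomax O d0.
have [e ec] := dlt_nomin O c0; have [e' ed] := dlt_nomin O d'.
have [c' [c'd' c'c0]] : exists c', dlt O c' d' /\ dlt O c' c0.
  case: (tri O e e') => [ee|[E|ee]].
  - by exists e; split; [exact: (lo_trans (dlo O) ee ed)|].
  - by exists e; split; [rewrite E|].
  - by exists e'; split=> //; exact: (lo_trans (dlo O) ee ec).
exists c', d'; split=> // y Jy ex.
have [x [xl [xr Xx]]] := h' y Jy (h y Jy ex).
exists x; split=> //; split.
  by case: xl => [?|xl]; [left | right; exact: (lo_trans (dlo O) c'c0 xl)].
by case: xr => [?|xr]; [left | right; exact: (lo_trans (dlo O) xr d0d')].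
Qed.

(** * The definability structure of a first-order structure *)

Section Renaming.
Variables (L : language) (M : structure L).

Fixpoint tren (r : nat -> nat) (t : term L) : term L :=
  match t with
  | tVar k => tVar L (r k)
  | tApp n f ts => tApp f (fun i => tren r (ts i))
  end.

Definition lift_ren (r : nat -> nat) k := if k is k'.+1 then (r k').+1 else 0.

Fixpoint fren (r : nat -> nat) (p : formula L) : formula L :=
  match p with
  | fFalse => fFalse L
  | fEq t u => fEq (tren r t) (tren r u)
  | fRel n s ts => fRel s (fun i => tren r (ts i))
  | fImp p q => fImp (fren r p) (fren r q)
  | fAll p => fAll (fren (lift_ren r) p)
  end.

Lemma eval_tren r (v : nat -> M) t : eval v (tren r t) = eval (fun k => v (r k)) t.
Proof.
elim: t => [//|n f ts IH] /=; congr fun_interp.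
by apply: eq_mktuple => i; exact: IH.
Qed.

Lemma sat_fren r (v : nat -> M) p : sat v (fren r p) <-> sat (fun k => v (r k)) p.
Proof.
elim: p r v => [|t u|n s ts|p IHp q IHq|p IH] r v //=.
- by rewrite !eval_tren.
- rewrite (eq_mktuple (fun i => eval (fun k => v (r k)) (ts i))) // => i.
  exact: eval_tren.
- by rewrite IHp IHq.
have E x : (fun k => scons x v (lift_ren r k)) = scons x (fun k => v (r k)).
  by apply: funext => -[].
by split=> h x; [have := h x; rewrite IH E | rewrite IH E].
Qed.

Lemma eval_fv (t : term L) : exists n, forall v w : nat -> M,
  (forall k, k < n -> v k = w k) -> eval v t = eval w t.
Proof.
elim: t => [k|n f ts IH]; first by exists k.+1 => v w h /=; apply: h.
have /choice [g hg] := IH; exists (\max_i g i) => v w h /=; congr fun_interp.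
apply: eq_mktuple => i; apply: hg => k kg; apply: h.
exact: leq_trans kg (leq_bigmax i).
Qed.

Lemma sat_fv (p : formula L) : exists n, forall v w : nat -> M,
  (forall k, k < n -> v k = w k) -> (sat v p <-> sat w p).
Proof.
elim: p => [|t u|n s ts|p [n hn] q [m hm]|p [n hn]].
- by exists 0.
- have [n hn] := eval_fv t; have [m hm] := eval_fv u; exists (maxn n m) => v w h /=.
  rewrite (hn v w) ?(hm v w) // => k hk; apply: h; apply: leq_trans hk _.
    exact: leq_maxr.
  exact: leq_maxl.
- have /choice [g hg] := fun i => eval_fv (ts i); exists (\max_i g i) => v w h /=.
  rewrite (eq_mktuple (fun i => eval w (ts i))) // => i.
  by apply: hg => k kg; apply: h; exact: leq_trans kg (leq_bigmax i).
- exists (maxn n m) => v w h /=; rewrite (hn v w) ?(hm v w) // => k hk; apply: h;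
    apply: leq_trans hk _; [exact: leq_maxr | exact: leq_maxl].
- exists n => v w h /=.
  suff E x : sat (scons x v) p <-> sat (scons x w) p by split=> h' x; apply/E.
  by apply: hn => -[//|k] /ltnW; exact: h.
Qed.

End Renaming.

Section StructDefinable.
Variables (L : language) (M : structure L).
Hypothesis DLO : dense_linear_order_without_endpoints M.

Lemma lt_linord : linord (@lt L M).
Proof.
split; [exact: dlo_irreflexive | exact: dlo_transitive | exact: dlo_total].
Qed.

Lemma tuple2E (v : nat -> M) :
  [tuple eval v (tVar L i) | i < 2] = [tuple v 0; v 1].
Proof.
by apply: eq_from_tnth => i; rewrite tnth_mktuple; case: i => -[|[|//]] hi /=;
  rewrite (tnth_nth (v 0)).
Qed.

Definition struct_dstr : dstr M.
Proof.
refine (@DStr M (@lt L M) lt_linord (dlo_dense DLO) (dlo_no_min DLO) (dlo_no_max DLO)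
  (dlo_nonempty DLO)
  (fun V P => exists (p : formula L) (s : nat -> V + M), forall e, P e <-> sat (sb s e) p)
  _ _ _ _ _ _ _).
- by move=> V P Q PQ [p [s h]]; exists p, s => e; rewrite -PQ.
- by move=> V; have [m _] := dlo_nonempty DLO; exists (fFalse L), (fun _ => inr m) => e.
- move=> V P Q [p [s h]] [q [s' h']].
  exists (fImp (fren double p) (fren (fun k => k.*2.+1) q)).
  exists (fun k => if odd k then s' k./2 else s k./2) => e /=.
  have E1 : (fun k => sb (fun k => if odd k then s' k./2 else s k./2) e k.*2) = sb s e.
    by apply: funext => k; rewrite /sb odd_double doubleK.
  have E2 : (fun k => sb (fun k => if odd k then s' k./2 else s k./2) e k.*2.+1) = sb s' e.
    by apply: funext => k; rewrite /sb /= odd_double /= uphalf_double.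
  by rewrite !sat_fren E1 E2 -h -h'.
- move=> V P [p [s h]]; have [m _] := dlo_nonempty DLO.
  exists (fAll (fren (fun k => if s k is inl None then 0 else k.+1) p)).
  exists (fun k => match s k with
    | inl None => inr m | inl (Some v) => inl v | inr x => inr x end) => e /=.
  set s' := fun k => _.
  have E x : (fun k => scons x (sb s' e) (if s k is inl None then 0 else k.+1)) = sb s (oc x e).
    by apply: funext => k; rewrite /s' /sb; case sk: (s k) => [[v|]|y] //=; rewrite sk.
  by split=> H x; [rewrite sat_fren E -h | apply/h; rewrite -E -sat_fren].
- move=> V W s P [p [s' h]].
  exists p, (fun k => match s' k with inl w => s w | inr m => inr m end) => e.
  rewrite h; suff -> : sb s' (sb s e) =
    sb (fun k => match s' k with inl w => s w | inr m => inr m end) e by [].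
  by apply: funext => k; rewrite /sb; case: (s' k).
- exists (fRel (lt_symb L) (fun i : 'I_2 => tVar L i)).
  exists (fun k => inl (k == 0)) => e.
  by rewrite /sat tuple2E.
- by exists (fEq (tVar L 0) (tVar L 1)), (fun k => inl (k == 0)).
Defined.

Lemma dfn1_definable P : dfn1 struct_dstr P -> definable (P : M -> Prop).
Proof.
move=> [p [s h]]; have [m _] := dlo_nonempty DLO.
exists (fren (fun k => if s k is inl _ then 0 else k.+1) p).
exists (fun k => if s k is inr x then x else m).
apply: funext => x; apply: propext; rewrite /mkset (h (fun _ => x)) sat_fren.
set v := sb _ _; set w := fun k => scons _ _ _; suff -> : v = w by [].
by apply: funext => k; rewrite /v /w /sb; case sk: (s k) => [[]|y] //=; rewrite sk.
Qed.

End StructDefinable.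

Section Breakpoints.
Variables (L : language) (M : structure L).
Hypothesis lin : linord (@lt L M).
Local Ltac ord := ord_with lin (@lt L M).

Definition no_break (l : list M) (A : M -> Prop) := forall x y, lt x y ->
  (forall z, List.In z l -> lt z x \/ lt y z) -> (A x <-> A y).

Lemma piece_breakpoints (A : M -> Prop) : is_point A \/ is_interval A ->
  exists l, no_break l A.
Proof.
case=> [[a ->]|[a [b [ab h1 h2]]]].
  exists [:: a] => x y xy av; have h := av a (or_introl erefl).
  by split=> E; have {}E : _ = a := E; move: h; rewrite -E => -[h|h]; ord.
exists ((if a is Fin c then [:: c] else nil) ++ (if b is Fin c then [:: c] else nil)).
move=> x y xy av.
have open z : A z -> (forall c, a = Fin c -> z <> c) -> (forall c, b = Fin c -> z <> c) ->
    open_itv a b z.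
  move=> /h2 [[za|za] [zb|zb]] na nb; split=> //.
  - by case: (nb z).
  - by case: (na z).
  - by case: (na z).
  - by case: (nb z).
have avb c : b = Fin c -> lt c x \/ lt y c.
  by move=> E; apply: av; apply/List.in_app_iff; right; rewrite E; left.
have ava c : a = Fin c -> lt c x \/ lt y c.
  by move=> E; apply: av; apply/List.in_app_iff; left; rewrite E; left.
split=> [Ax|Ay]; apply: h1.
  have [o1 o2] : open_itv a b x.
    apply: open Ax _ _ => c E E'; subst c; [case: (ava x E)|case: (avb x E)] => ?; ord.
  split.
    case Ea: a o1 => [|c|] //= o1; case: (ava c Ea) => h; ord.
  case Eb: b o2 => [|c|] //= o2; case: (avb c Eb) => h; ord.
have [o1 o2] : open_itv a b y.
  apply: open Ay _ _ => c E E'; subst c; [case: (ava y E)|case: (avb y E)] => ?; ord.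
split.
  case Ea: a o1 => [|c|] //= o1; case: (ava c Ea) => h; ord.
case Eb: b o2 => [|c|] //= o2; case: (avb c Eb) => h; ord.
Qed.

Lemma finite_union_breakpoints (X : M -> Prop) :
  finite_union_of_points_and_intervals X -> exists l, no_break l X.
Proof.
move=> [n [A [hA ->]]].
have /choice [g hg] := fun i => piece_breakpoints (hA i).
have [l hl] : exists l, forall i z, List.In z (g i) -> List.In z l.
  elim: n A {hA hg} g => [|n IH] A g; first by exists nil => -[].
  have [l hl] := IH (fun i => A (lift ord0 i)) (fun i => g (lift ord0 i)).
  exists (g ord0 ++ l) => i z; case: (unliftP ord0 i) => [j ->|->] h.
    by apply/List.in_app_iff; right; exact: hl h.
  by apply/List.in_app_iff; left.
exists l => x y xy av.
by split=> -[i _ Ai]; exists i => //; apply/(hg i x y) => // z /hl /av.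
Qed.

Definition fu_list (X : M -> Prop) := exists s : list (M -> Prop),
  (forall A, List.In A s -> is_point A \/ is_interval A) /\
  forall x, X x <-> exists2 A, List.In A s & A x.

Lemma fu_listP (X : M -> Prop) : fu_list X -> finite_union_of_points_and_intervals X.
Proof.
move=> [s [hs hX]]; exists (size s), (fun i => List.nth i s (fun _ => False)); split.
  move=> i; apply: hs; apply: List.nth_In; exact/ltP.
apply: funext => x; apply: propext; rewrite hX; split=> [[A As Ax]|[i _ Ai]].
  have [k [kl E]] := List.In_nth _ _ (fun _ => False) As.
  by exists (Ordinal (introT ltP kl)) => //=; rewrite E.
exists (List.nth i s (fun _ => False)) => //; apply: List.nth_In; exact/ltP.
Qed.

Lemma fu_union (X Y : M -> Prop) : fu_list X -> fu_list Y -> fu_list (fun x => X x \/ Y x).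
Proof.
move=> [s [hs hX]] [t [ht hY]]; exists (s ++ t); split.
  by move=> A /List.in_app_iff [/hs|/ht].
move=> x; rewrite hX hY; split.
  by case=> -[A As Ax]; exists A => //; apply/List.in_app_iff; [left|right].
by move=> [A /List.in_app_iff [h|h] Ax]; [left|right]; exists A.
Qed.

Lemma breakpoints_finite_union (l : list M) (X : M -> Prop) p q : lt p q ->
  (forall x y, lt p x -> lt x y -> lt y q ->
     (forall z, List.In z l -> lt z x \/ lt y z) -> (X x <-> X y)) ->
  fu_list (fun x => X x /\ (lt p x /\ lt x q)).
Proof.
elim: l p q => [|z l IH] p q pq h.
  case: (EM (exists x, X x /\ (lt p x /\ lt x q))) => [[x [Xx [px xq]]]|no]; last first.
    exists nil; split=> // x; split=> [hx|[]//].
    by case: no; exists x.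
  exists [:: open_itv (Fin p) (Fin q)]; split.
    move=> A [<-|//]; right; exists (Fin p), (Fin q); split=> //.
    by move=> y [h1 h2]; split; left.
  move=> y; split=> [[_ [py yq]]|[A [<-|//] [/= py yq]]].
    by exists (open_itv (Fin p) (Fin q)) => //; left.
  split=> //; case: (lo_tri lin x y) => [xy|[<-//|yx]].
    by apply/(h x y).
  by apply/(h y x).
case: (EM (lt p z /\ lt z q)) => [[pz zq]|out]; last first.
  apply: IH => // x y px xy yq av; apply: h => // w [<-|]; last exact: av.
  case: (EM (lt z x)) => zx; first by left.
  by right; apply: contrapT => yz; apply: out; split; ord.
have F1 : fu_list (fun x => X x /\ (lt p x /\ lt x z)).
  apply: IH => // x y px xy yz av; apply: h => //; first by ord.
  by move=> w [<-|]; [right | exact: av].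
have F2 : fu_list (fun x => X x /\ (lt z x /\ lt x q)).
  apply: IH => // x y zx xy yq av; apply: h => //; first by ord.
  by move=> w [<-|]; [left | exact: av].
have F3 : fu_list (fun x => X x /\ x = z).
  case: (EM (X z)) => Xz.
    exists [:: [set z]%classic]; split; first by move=> A [<-|//]; left; exists z.
    by move=> x; split=> [[_ ->]|[A [<-|//] E]]; [exists [set z]%classic => //; left|rewrite E].
  by exists nil; split=> // x; split=> [[Xx E]|[]//]; subst x.
have [s [hs hX]] := fu_union F1 (fu_union F3 F2).
exists s; split=> // x; rewrite -hX; split.
  by move=> [Xx [px xq]]; case: (lo_tri lin x z) => [?|[?|?]]; [left|right;left|right;right].
by move=> [[Xx [? ?]]|[[Xx E]|[Xx [? ?]]]]; split=> //; subst; split=> //; ord.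
Qed.

End Breakpoints.

Lemma struct_locally_tame (L : language) (M : structure L)
    (DLO : dense_linear_order_without_endpoints M) :
  (forall X : set M, definable X -> bounded X -> finite_union_of_points_and_intervals X) ->
  locally_tame (struct_dstr DLO).
Proof.
move=> H P HP c d; case: (EM (lt c d)) => cd; last first.
  exists nil => x y [cx xd]; case: cd; exact: (dlo_transitive DLO cx xd).
have HX : dfn1 (struct_dstr DLO) (fun x => P x /\ (dlt (struct_dstr DLO) c x /\
    dlt (struct_dstr DLO) x d)).
  by rewrite /dfn1; dfn_tac.
have [|l hl] := finite_union_breakpoints (lt_linord DLO) (H _ (dfn1_definable HX) _).
  by exists c, d; split=> // x [_ [? ?]].
exists l => x y [cx xd] [cy yd] xy av; have [h1 h2] := hl x y xy av.
by split=> h; [have [] := h1 (conj h (conj cx xd)) | have [] := h2 (conj h (conj cy yd))].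
Qed.

(** * The bounded ultrapower *)

Lemma In_iota j m k : m <= j < m + k -> List.In j (iota m k).
Proof.
elim: k m => [|k IH] m /andP [mj jm]; first by rewrite addn0 ltnNge mj in jm.
move: mj; rewrite leq_eqVlt => /orP [/eqP ->|mj]; [by left | right].
by apply: IH; rewrite mj addSnnS.
Qed.

Lemma nonprincipal_ultrafilter : exists U : (nat -> Prop) -> Prop,
  [/\ forall A B : nat -> Prop, (forall i, A i -> B i) -> U A -> U B,
      forall A B : nat -> Prop, U A -> U B -> U (fun i => A i /\ B i),
      forall A, U A \/ U (fun i => ~ A i),
      ~ U (fun _ => False) & forall n, ~ U (fun i => i = n)].
Proof.
have [U [UU sub]] := ultraFilterLemma eventually_filter.
have PU := @ultra_proper _ _ UU.
exists U; split.
- by move=> A B AB UA; apply: filterS UA => i; exact: AB.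
- by move=> A B UA UB; exact: filterI UA UB.
- by move=> A; exact: in_ultra_setVsetC.
- exact: filter_not_empty.
move=> n Un; apply: (@filter_not_empty _ U).
have Ugt : U (fun i => n < i) by apply: sub; exists n.+1.
apply: filterS (filterI Un Ugt) => i [-> ]; by rewrite /= ltnn.
Qed.

Section FormulaBounds.
Variables (L : language) (M : structure L).
Hypothesis DLO : dense_linear_order_without_endpoints M.
Let O : dstr M := struct_dstr DLO.
Hypothesis LT : locally_tame O.

Fixpoint idx n k : option (fin n) :=
  match n, k with
  | 0, _ => None
  | m.+1, 0 => Some (None : fin m.+1)
  | m.+1, k.+1 => if idx m k is Some i then Some (Some i : fin m.+1) else None
  end.

Fixpoint num n : fin n -> nat :=
  match n with
  | 0 => fun i => 0
  | m.+1 => fun i : option (fin m) => if i is Some j then (num j).+1 else 0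
  end.

Lemma idx_num n k : k < n -> exists2 i, idx n k = Some i & num i = k.
Proof.
elim: n k => [//|n IH] [|k] /=; first by exists None.
by rewrite ltnS => /IH [i -> Ei]; exists (Some i) => //=; rewrite Ei.
Qed.

Lemma num_lt n (i : fin n) : num i < n.
Proof. by elim: n i => [[]|n IH] [i|] //=; rewrite ltnS. Qed.

(** The variables beyond the first [n] get the dummy value [c]. *)
Definition env n (c : M) (y : fin n -> M) : nat -> M :=
  fun k => if idx n k is Some i then y i else c.

Lemma env_oc n c x (y : fin n -> M) : @env n.+1 c (oc x y) = scons x (env c y).
Proof. by apply: funext => -[//|k]; rewrite /env /=; case: (idx n k). Qed.

Lemma env_num n c (v : nat -> M) k : k < n -> env c (fun i : fin n => v (num i)) k = v k.
Proof. by move=> /idx_num [i E Ei]; rewrite /env E Ei. Qed.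

Lemma sat_dfn n c (p : formula L) : dfn O (fun y : fin n -> M => sat (env c y) p).
Proof.
exists p, (fun k => if idx n k is Some i then inl i else inr c) => e.
suff -> : env c e = sb (fun k => if idx n k is Some i then inl i else inr c) e by [].
by apply: funext => k; rewrite /env /sb; case: (idx n k).
Qed.

Lemma formula_witness (p : formula L) : exists n, forall c d, lt c d ->
  exists c' d', lt c' d' /\ forall v : nat -> M, (forall k, k < n -> ext_itv O c d (v k)) ->
    (exists x, sat (scons x v) p) -> exists x, ext_itv O c' d' x /\ sat (scons x v) p.
Proof.
have [n hn] := sat_fv M p; exists n => c d cd.
have [c' [d' [cd' h]]] := bounded_witness (n := n) LT (@sat_dfn n.+1 c p) cd.
exists c', d'; split=> // v Jv [x px].
have E z : sat (scons z v) p <-> sat (@env n.+1 c (oc z (fun i : fin n => v (num i)))) p.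
  apply: hn => -[|k] hk; rewrite env_oc //= env_num //; exact: ltnW.
have [|z [Jz pz]] := h (fun i => v (num i)) (fun i => Jv _ (num_lt i)).
  by exists x; apply/E.
by exists z; split=> //; apply/E.
Qed.

Lemma function_bound m (f : fun_symb L m) c d : lt c d -> exists c' d', lt c' d' /\
  forall t : m.-tuple M, (forall i, ext_itv O c d (tnth t i)) -> ext_itv O c' d' (fun_interp f t).
Proof.
move=> cd; have [m0 Jm0] := open_convex_ex (open_convex_ext_itv (O := O) cd).
have [n h] := formula_witness (fEq (tVar L 0) (tApp f (fun i : 'I_m => tVar L i.+1))).
have [c' [d' [cd' {}h]]] := h c d cd; exists c', d'; split=> // t Jt.
have tE x : sat (scons x (fun k => nth m0 t k)) (fEq (tVar L 0) (tApp f (fun i : 'I_m =>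
    tVar L i.+1)))
    = (x = fun_interp f t).
  rewrite /=; congr (_ = _); congr fun_interp; apply: eq_from_tnth => i.
  by rewrite tnth_mktuple /= -tnth_nth.
have [||x [Jx]] := h (fun k => nth m0 t k).
- move=> k _; case: (ltnP k m) => km; last by rewrite nth_default ?size_tuple.
  by have := Jt (Ordinal km); rewrite (tnth_nth m0).
- by exists (fun_interp f t); rewrite tE.
- by rewrite tE => <-.
Qed.

End FormulaBounds.

Section Ultrapower.
Variables (L : language) (M : structure L).
Hypothesis DLO : dense_linear_order_without_endpoints M.
Let O : dstr M := struct_dstr DLO.
Hypothesis LT : locally_tame O.
Variable U : (nat -> Prop) -> Prop.
Hypotheses (US : forall A B : nat -> Prop, (forall i, A i -> B i) -> U A -> U B)
  (UI : forall A B : nat -> Prop, U A -> U B -> U (fun i => A i /\ B i))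
  (UE : forall A, U A \/ U (fun i => ~ A i)) (U0 : ~ U (fun _ => False))
  (Unp : forall n, ~ U (fun i => i = n)).

Lemma UT A : (forall i, A i) -> U A.
Proof. by move=> h; case: (UE A) => // H; case: U0; apply: US H => i; apply. Qed.

Lemma U_list (I : eqType) (s : seq I) (A : I -> nat -> Prop) :
  (forall j, j \in s -> U (A j)) -> U (fun i => forall j, j \in s -> A j i).
Proof.
elim: s => [|a s IH] h; first exact: UT.
have h' j : j \in s -> U (A j) by move=> js; apply: h; rewrite inE js orbT.
apply: US (UI (h a (mem_head _ _)) (IH h')) => i [h1 h2] j.
by rewrite inE => /orP [/eqP ->|/h2].
Qed.

Lemma U_fin m (A : 'I_m -> nat -> Prop) :
  (forall j, U (A j)) -> U (fun i => forall j, A j i).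
Proof.
move=> h; apply: US (U_list (s := enum 'I_m) (A := A) (fun j _ => h j)) => i h' j.
by apply: h'; rewrite mem_enum.
Qed.

Lemma U_ltn n (A : nat -> nat -> Prop) :
  (forall k, k < n -> U (A k)) -> U (fun i => forall k, k < n -> A k i).
Proof.
move=> h; have h' k : k \in iota 0 n -> U (A k) by rewrite mem_iota => /h.
by apply: US (U_list h') => i h'' k kn; apply: h''; rewrite mem_iota.
Qed.

Definition bdd (f : nat -> M) := exists c d, lt c d /\ forall i, ext_itv O c d (f i).

Definition agree (f g : nat -> M) := U (fun i => f i = g i).

(** A representative of the class of [f], depending only on this class. *)
Definition canon (f : nat -> M) : nat -> M :=
  match pselect (exists g, bdd g /\ agree f g) with
  | left h => projT1 (cid h)
  | right _ => f
  end.

Lemma agree_refl f : agree f f. Proof. exact: UT. Qed.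

Lemma agree_sym f g : agree f g -> agree g f.
Proof. by apply: US => i ->. Qed.

Lemma agree_trans f g h : agree f g -> agree g h -> agree f h.
Proof. by move=> h1 h2; apply: US (UI h1 h2) => i [-> ->]. Qed.

Lemma canonP f : bdd f -> bdd (canon f) /\ agree f (canon f).
Proof.
move=> bf; rewrite /canon; case: pselect => [h|n]; first by case: (cid h).
by case: n; exists f; split=> //; exact: agree_refl.
Qed.

Lemma canon_eq f g : bdd f -> bdd g -> agree f g -> canon f = canon g.
Proof.
move=> bf bg fg.
have E : (fun h => bdd h /\ agree f h) = (fun h => bdd h /\ agree g h).
  apply: funext => h; apply: propext; split=> -[bh ah]; split=> //.
    exact: agree_trans (agree_sym fg) ah.
  exact: agree_trans fg ah.
rewrite /canon; case: pselect => [h|n]; last by case: n; exists f; split=> //; exact: agree_refl.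
case: pselect => [h'|n]; last by case: n; exists g; split=> //; exact: agree_refl.
move: h h'; rewrite E => h h'; by rewrite (Prop_irrelevance h h').
Qed.

Definition upcarrier := {f : nat -> M | bdd f /\ canon f = f}.

Definition rep (a : upcarrier) : nat -> M := proj1_sig a.

Lemma bdd_rep a : bdd (rep a). Proof. by case: a => f []. Qed.

Lemma canon_canon f : bdd f -> canon (canon f) = canon f.
Proof.
move=> bf; have [bc ac] := canonP bf; apply: canon_eq => //.
exact: agree_sym.
Qed.

Definition mk f (bf : bdd f) : upcarrier :=
  exist _ (canon f) (conj (canonP bf).1 (canon_canon bf)).

Lemma rep_mk f (bf : bdd f) : agree (rep (mk bf)) f.
Proof. apply: agree_sym; exact: (canonP bf).2. Qed.

Lemma rep_inj a b : agree (rep a) (rep b) -> a = b.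
Proof.
case: a b => [f [bf cf]] [g [bg cg]] /= h.
have E : f = g by rewrite -cf -cg; apply: canon_eq.
by apply: eq_exist.
Qed.

Lemma bdd_join n (f : nat -> nat -> M) : (forall k, k < n -> bdd (f k)) ->
  exists c d, lt c d /\ forall k, k < n -> forall i, ext_itv O c d (f k i).
Proof.
elim: n => [|n IH] h.
  have [x _] := dlo_nonempty DLO; have [c [d [cd _]]] := ext_itv_in O x.
  by exists c, d.
have [|c [d [cd hcd]]] := IH; first by move=> k kn; apply: h; exact: ltnW.
have [c' [d' [cd' hcd']]] := h n (ltnSn n).
have [a [b [ab h1 h2]]] := ext_itv_join (O := O) cd cd'; exists a, b; split=> // k.
rewrite ltnS leq_eqVlt => /orP [/eqP ->|kn] i; first exact: h2.
by apply: h1; apply: hcd.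
Qed.

Lemma bdd_fun m (f : fun_symb L m) (t : m.-tuple upcarrier) :
  bdd (fun i => fun_interp f [tuple rep (tnth t j) i | j < m]).
Proof.
have [x _] := dlo_nonempty DLO.
have [|c [d [cd h]]] := @bdd_join m (fun k i => nth x [tuple rep (tnth t j) i | j < m] k).
  move=> k km; have [c [d [cd h]]] := bdd_rep (tnth t (Ordinal km)).
  exists c, d; split=> // i; have := h i.
  by rewrite -(tnth_nth x _ (Ordinal km)) tnth_mktuple.
have [c' [d' [cd' h']]] := function_bound LT f cd.
exists c', d'; split=> // i; apply: h' => j.
by rewrite (tnth_nth x); exact: h.
Qed.

(** Sequences with values in one of the intervals [ext_itv c d], modulo [U]. *)
Definition ultrapower : structure L := @Structure L upcarrier
  (fun m f t => mk (bdd_fun f t))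
  (fun m r t => U (fun i => rel_interp r [tuple rep (tnth t j) i | j < m])).

Lemma rep_eval (a : nat -> ultrapower) t :
  U (fun i => rep (eval a t) i = eval (fun k => rep (a k) i) t).
Proof.
elim: t => [k|m f ts IH]; first exact: UT.
have /= h := rep_mk (bdd_fun f [tuple eval a (ts j) | j < m]).
apply: US (UI h (U_fin IH)) => i [-> E]; congr fun_interp.
by apply: eq_mktuple => j; rewrite tnth_mktuple.
Qed.

(** Los's theorem. The quantifier step needs bounded witnesses, which
    [formula_witness] provides. *)
Theorem los (p : formula L) (a : nat -> ultrapower) :
  sat a p <-> U (fun i => sat (fun k => rep (a k) i) p).
Proof.
elim: p a => [|t u|m s ts|p IHp q IHq|p IH] a /=.
- by split=> // /U0.
- split=> [E|h].
    by apply: US (UI (rep_eval a t) (rep_eval a u)) => i [<- <-]; rewrite E.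
  apply: rep_inj; apply: US (UI h (UI (rep_eval a t) (rep_eval a u))) => i [E [-> ->]].
  exact: E.
- have E := U_fin (fun j => rep_eval a (ts j)).
  split=> h; apply: US (UI E h) => i [{}E]; set t1 := [tuple _ | j < m]; set t2 :=
      [tuple _ | j < m];
    (suff -> : t1 = t2 by []); apply: eq_mktuple => j; rewrite tnth_mktuple ?E //.
- rewrite IHp IHq; split=> [h|h hp]; last by apply: US (UI h hp) => i [h1 h2]; exact: h1.
  case: (UE (fun i => sat (fun k => rep (a k) i) p)) => hp.
    by apply: US (h hp) => i.
  by apply: US hp => i.
have E b i : (fun k => rep (scons b a k) i) = scons (rep b i) (fun k => rep (a k) i).
  by apply: funext => -[].
split=> [h|h b]; last first.
  by apply/IH; apply: US h => i hi; rewrite E; apply: hi.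
case: (UE (fun i => forall x, sat (scons x (fun k => rep (a k) i)) p)) => // nh; exfalso.
have [n hn] := formula_witness LT (fImp p (fFalse L)).
have [|c [d [cd hcd]]] := @bdd_join n (fun k => rep (a k)) _; first by move=> k _; exact: bdd_rep.
have [c' [d' [cd' w]]] := hn c d cd.
have [x0 Jx0] := open_convex_ex (open_convex_ext_itv (O := O) cd').
have /choice [g hg] : forall i, exists x, ext_itv O c' d' x /\
    ((exists y, ~ sat (scons y (fun k => rep (a k) i)) p) -> ~ sat (scons x (fun k =>
        rep (a k) i)) p).
  move=> i; case: (EM (exists y, ~ sat (scons y (fun k => rep (a k) i)) p)) => [[y hy]|no].
    have [||x [Jx hx]] := w (fun k => rep (a k) i); first by move=> k kn; exact: hcd.
      by exists y.
    by exists x.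
  by exists x0.
have bg : bdd g by exists c', d'; split=> // i; have [] := hg i.
have /IH hb := h (mk bg); apply: U0; apply: US (UI hb (UI nh (rep_mk bg))) => i.
rewrite E => -[h1 [h2 Eg]]; rewrite Eg in h1; have [_ h3] := hg i; apply: h3 h1.
by apply: contrapT => no; apply: h2 => x; apply: contrapT => nx; apply: no; exists x.
Qed.

Lemma bdd_const m : bdd (fun _ => m).
Proof. by have [c [d [cd h]]] := ext_itv_in O m; exists c, d. Qed.

Definition diag (m : M) : ultrapower := mk (bdd_const m).

Lemma diag_elementary : elementary diag.
Proof.
move=> p v; rewrite los; have [n hn] := sat_fv M p.
have A : U (fun i => forall k, k < n -> rep (diag (v k)) i = v k).
  by apply: U_ltn => k _; exact: (rep_mk (bdd_const (v k))).
have E : U (fun i => sat v p <-> sat (fun k => rep (diag (v k)) i) p).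
  by apply: US A => i h; apply: hn => k /h ->.
split=> h; first by apply: US E => i [h' _]; exact: h'.
apply: contrapT => ns; apply: U0; apply: US (UI E h) => i [[_ h'] hs]; exact: ns (h' hs).
Qed.

(** The class of a strictly decreasing bounded sequence is new. *)
Lemma diag_proper : (range diag <> setT)%classic.
Proof.
move=> E; have [x _] := dlo_nonempty DLO; have [d xd] := dlo_no_max DLO x.
have /choice [g hg] : forall y, exists z, lt x y -> lt x z /\ lt z y.
  move=> y; case: (EM (lt x y)) => [/(dlo_dense DLO) [z hz]|n]; first by exists z.
  by exists y.
have pos i : lt x (iter i g d) by elim: i => [//|i IH] /=; have [] := hg _ IH.
have dec i j : i < j -> lt (iter j g d) (iter i g d).
  elim: j => [//|j IH]; rewrite ltnS leq_eqVlt => /orP [/eqP ->|/IH h].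
    by have [] := hg _ (pos j).
  have [_ h'] := hg _ (pos j); exact: (dlo_transitive DLO h' h).
have bs : bdd (fun i => iter i.+1 g d).
  exists x, d; split=> // i; split; right; first exact: pos.
  exact: (dec 0 i.+1).
have [m _ Em] : range diag (mk bs) by rewrite E.
have h : U (fun i => iter i.+1 g d = m).
  apply: US (UI (rep_mk bs) (rep_mk (bdd_const m))) => i [<- <-].
  by rewrite -/(diag m) Em.
case: (EM (exists i0, iter i0.+1 g d = m)) => [[i0 Ei]|no]; last first.
  by apply: U0; apply: US h => i hi; apply: no; exists i.
apply: (Unp (n := i0)); apply: US h => i; rewrite -Ei => Eii.
case: (ltngtP i i0) => // lt_i.
  have := dec i.+1 i0.+1 lt_i; rewrite Eii => h; case: (dlo_irreflexive DLO h).
by have := dec i0.+1 i.+1 lt_i; rewrite Eii => h; case: (dlo_irreflexive DLO h).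
Qed.

Lemma ltU (a b : ultrapower) : lt a b <-> U (fun i => lt (rep a i) (rep b i)).
Proof.
rewrite /lt /=; suff E i : [tuple rep (tnth [tuple a; b] j) i | j < 2] = [tuple rep a i; rep b i].
  by split; apply: US => i; rewrite E.
by apply: eq_from_tnth => j; rewrite tnth_mktuple; case: j => -[|[|//]] hj /=;
   rewrite !(tnth_nth a) (tnth_nth (rep a i)).
Qed.

Lemma ultrapower_dlo : dense_linear_order_without_endpoints ultrapower.
Proof.
have [x0 _] := dlo_nonempty DLO.
split.
- by exists (diag x0).
- by move=> a /ltU h; apply: U0; apply: US h => i; exact: dlo_irreflexive.
- move=> a b e /ltU h1 /ltU h2; apply/ltU; apply: US (UI h1 h2) => i [l1 l2].
  exact: (dlo_transitive DLO l1 l2).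
- move=> a b; case: (UE (fun i => lt (rep a i) (rep b i))) => [/ltU|n1]; first by left.
  case: (UE (fun i => rep a i = rep b i)) => [/rep_inj|n2]; first by right; left.
  right; right; apply/ltU; apply: US (UI n1 n2) => i [h1 h2].
  by case: (dlo_total DLO (rep a i) (rep b i)) => [/h1|[/h2|]].
- move=> a b /ltU ab.
  have [c1 [d1 [cd1 h1]]] := bdd_rep a; have [c2 [d2 [cd2 h2]]] := bdd_rep b.
  have [c [d [cd j1 j2]]] := ext_itv_join (O := O) cd1 cd2.
  have /choice [g hg] : forall i, exists z, ext_itv O c d z /\
      (lt (rep a i) (rep b i) -> lt (rep a i) z /\ lt z (rep b i)).
    move=> i; have Ja := j1 _ (h1 i); have Jb := j2 _ (h2 i).
    case: (EM (lt (rep a i) (rep b i))) => [xy|n]; last by exists (rep a i).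
    have [z [xz zy]] := dlo_dense DLO xy; exists z; split=> //.
    exact: (open_convex_convex (open_convex_ext_itv (O := O) cd) Ja Jb xz zy).
  have bg : bdd g by exists c, d; split=> // i; have [] := hg i.
  have E := UI ab (rep_mk bg).
  by exists (mk bg); split; apply/ltU; apply: US E => i [l ->]; have [_ /(_ l) []] := hg i.
- move=> a; have [c [d [cd h]]] := bdd_rep a.
  have /choice [g hg] : forall i, exists z, ext_itv O c d z /\ lt z (rep a i).
    by move=> i; have [z Jz za] := open_convex_nomin (open_convex_ext_itv (O := O) cd) (h i);
        exists z.
  have bg : bdd g by exists c, d; split=> // i; have [] := hg i.
  exists (mk bg); apply/ltU; apply: US (rep_mk bg) => i ->; by have [] := hg i.
- move=> a; have [c [d [cd h]]] := bdd_rep a.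
  have /choice [g hg] : forall i, exists z, ext_itv O c d z /\ lt (rep a i) z.
    by move=> i; have [z Jz za] := open_convex_nomax (open_convex_ext_itv (O := O) cd) (h i);
        exists z.
  have bg : bdd g by exists c, d; split=> // i; have [] := hg i.
  exists (mk bg); apply/ltU; apply: US (rep_mk bg) => i ->; by have [] := hg i.
Qed.

(** For each index, the fibre of [X] has a list of at most [k] breakpoints in the
    interval [ext_itv c d] that contains all the data; the entries of these lists, one
    position at a time, form sequences that are the breakpoints of [X]. *)
Lemma ultrapower_tame (X : set ultrapower) : definable X -> bounded X ->
  finite_union_of_points_and_intervals X.
Proof.
move=> [p [v XE]] [a [b [ab Xab]]].
have lin := lt_linord ultrapower_dlo.
suff F : fu_list (fun x => X x /\ (lt a x /\ lt x b)).
  apply: fu_listP; have [s [hs hX]] := F; exists s; split=> // x; rewrite -hX.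
  by split=> [Xx|[]//]; split=> //; exact: Xab.
have [n hn] := sat_fv M p.
have [|c [d [cd hcd]]] := @bdd_join n.+2
    (fun k => match k with 0 => rep a | 1 => rep b | k'.+2 => rep (v k') end).
  by move=> [|[|k]] _; exact: bdd_rep.
have OMJ := @omin_ext_itv M O LT c d cd.
have HX := sub_dfn (open_convex_ext_itv (O := O) cd) (@sat_dfn L M DLO n.+1 c p).
have [k hk] := uniform_breakpoints OMJ HX.
pose y i : fin n -> {x | ext_itv O c d x} := fun j =>
  exist _ (rep (v (num j)) i) (hcd (num j).+2 (num_lt j) i).
have /choice [l hl] := fun i => hk (y i).
have [t0 Jt0] := open_convex_ex (open_convex_ext_itv (O := O) cd).
pose g j i := proj1_sig (List.nth j (l i) (exist _ t0 Jt0)).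
have bg j : bdd (g j).
  by exists c, d; split=> // i; exact: (proj2_sig (List.nth j (l i) (exist _ t0 Jt0))).
apply: (breakpoints_finite_union lin (l := List.map (fun j => mk (bg j)) (iota 0 k))) =>
    // x x' ax xx' x'b av.
have avU : U (fun i => forall j, j < k -> rep (mk (bg j)) i = g j i /\
    (lt (rep (mk (bg j)) i) (rep x i) \/ lt (rep x' i) (rep (mk (bg j)) i))).
  apply: U_ltn => j jk; apply: UI (rep_mk (bg j)) _.
  case: (av (mk (bg j))) => [|/ltU h|/ltU h].
  - apply/List.in_map_iff; exists j; split=> //; exact: In_iota.
  - by apply: US h => i; left.
  - by apply: US h => i; right.
have E z i : (fun j => rep (scons z v j) i) = scons (rep z i) (fun j => rep (v j) i).
  by apply: funext => -[].
have key : U (fun i => sat (scons (rep x i) (fun j => rep (v j) i)) p <->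
                       sat (scons (rep x' i) (fun j => rep (v j) i)) p).
  move: ax xx' x'b => /ltU ax /ltU xx' /ltU x'b.
  apply: US (UI avU (UI ax (UI xx' x'b))) => i [avi [axi [xxi xbi]]].
  have Ja := hcd 0 isT i; have Jb := hcd 1 isT i; rewrite /= in Ja Jb.
  have Jx : ext_itv O c d (rep x i).
    apply: (open_convex_convex (open_convex_ext_itv (O := O) cd) Ja Jb axi).
    exact: (dlo_transitive DLO xxi xbi).
  have Jx' : ext_itv O c d (rep x' i).
    apply: (open_convex_convex (open_convex_ext_itv (O := O) cd) Ja Jb _ xbi).
    exact: (dlo_transitive DLO axi xxi).
  have [sl brk] := hl i.
  have rd z (Jz : ext_itv O c d z) : sat (scons z (fun j => rep (v j) i)) p <->
      sat (@env L M n.+1 c (fun w =>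
          proj1_sig (@oc {x | ext_itv O c d x} (fin n) (exist _ z Jz) (y i) w))) p.
    have -> : (fun w : fin n.+1 =>
        proj1_sig (@oc {x | ext_itv O c d x} (fin n) (exist _ z Jz) (y i) w)) =
        oc z (fun j : fin n => rep (v (num j)) i) by apply: funext => -[].
    rewrite env_oc; apply: hn => -[//|j] jn /=.
    by rewrite (env_num c (fun j => rep (v j) i)) //; exact: ltnW.
  rewrite (rd _ Jx) (rd _ Jx'); apply: brk => // z /(List.In_nth _ _ (exist _ t0 Jt0)) [j [jl jE]].
  have jk : j < k by apply: leq_trans sl; exact/ltP.
  by have [Eg h] := avi j jk; rewrite Eg /g jE in h.
rewrite XE /mkset !los; split=> h; apply: US (UI key h) => i; rewrite !E => -[h1 h2].
  by apply/h1.
by apply/h1.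
Qed.

End Ultrapower.

Theorem theorem17 (L : language) (M : structure L) :
  almost_o_minimal M ->
  exists N : structure L,
    proper_elementary_extension M N /\ almost_o_minimal N.
Proof.
move=> [DLO tame_M].
have LT := @struct_locally_tame L M DLO tame_M.
have [U [US UI UE U0 Unp]] := nonprincipal_ultrafilter.
exists (ultrapower LT US UI UE U0); split; last first.
  by split; [exact: ultrapower_dlo | exact: ultrapower_tame].
exists (@diag L M DLO LT U US UI UE U0); split; first exact: diag_elementary.
exact: diag_proper.
Qed.
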